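(* Let $\mathcal{L}$ be a real line arrangement in $\mathbb{CP}^2$ consisting of $n$ lines, and choose the line at infinity (not in $\mathcal{L}$) such that all the lines of $\mathcal{L}$ intersect in $\mathbb{C}^2$, i.e. all intersection points of lines of $\mathcal{L}$ lie in $\mathbb{C}^2$. Assume that $\mathcal{L}$ has exactly $k$ multiple intersection points $p_1,\dots,p_k$, with multiplicities $m_1,\dots,m_k$ respectively. Assume also that for every equivalence class of the relation $\sim$ on the multiple points, all the multiple points of that class are collinear, i.e. there is a line of $\mathcal{L}$ on which all the multiple points of that class lie. Then $$\pi_1(\mathbb{C}^2-\mathcal{L},u_0)\cong\bigoplus_{i=1}^k\mathbb{F}^{m_i-1}\oplus\mathbb{Z}^{\,n-\sum_{i=1}^k(m_i-1)} .$$ Moreover, the number of infinite cyclic groups $n-\sum_{i=1}^k(m_i-1)$ is the sum of two numbers: the number of equivalence classes of $\sim$ and the number of lines of $\mathcal{L}$ which have only simple intersection points.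
   Context: A real line arrangement is a finite union of distinct projective lines in $\mathbb{CP}^2$, each of which can be defined by a linear equation with real coefficients; $\mathcal{L}$ denotes both the set of lines and their union. A simple point is a point where exactly two lines of the arrangement meet; a multiple point is a point where more than two lines meet; the multiplicity of a point is the number of lines of the arrangement passing through it. The relation $\sim$ on the set of multiple points is defined by: $p\sim q$ if $p$ is connected to $q$ by a path whose vertices are multiple points, i.e. there is a finite sequence of multiple points from $p$ to $q$ (possibly the empty path, when $p=q$) in which any two consecutive points lie on a common line of $\mathcal{L}$; it is an equivalence relation. $\mathbb{F}^k$ denotes the free group on $k$ generators, $\oplus$ denotes the direct product of groups, and $u_0$ is a base point. *)

(* Defs.v *)
From HB Require Import structures.
From mathcomp Require Import all_boot all_order all_algebra generic_quotient.
From mathcomp Require Import all_classical all_reals all_analysis.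
From mathcomp Require Import complex lra.

Set Implicit Arguments.
Unset Strict Implicit.
Unset Printing Implicit Defensive.

Import Order.TTheory GRing.Theory Num.Theory.
Import numFieldNormedType.Exports.

Local Open Scope classical_set_scope.
Local Open Scope ring_scope.

Definition group_isomorphic (G H : groupType) : Prop :=
  exists f : {multiplicative G -> H}, bijective f.

(** Free groups, as groups of reduced words.  The letter [(i, b)] stands for
    the [i]-th generator if [b] is [false], for its inverse otherwise. *)
Section FreeGroup.
Variable n : nat.

Definition letter := ('I_n * bool)%type.
Implicit Types (a b : letter) (u v w : seq letter).

Definition linv a : letter := (a.1, ~~ a.2).

Definition reduced w : bool := sorted (fun a b => b != linv a) w.

Definition push a w : seq letter :=
  if w is b :: w' then (if b == linv a then w' else a :: w) else [:: a].

Definition reduce w : seq letter := foldr push [::] w.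

Definition winv w : seq letter := rev (map linv w).

Record free_group := FreeGroup { fg_word :> seq letter; _ : reduced fg_word }.

HB.instance Definition _ := [isSub for fg_word].
HB.instance Definition _ := [Choice of free_group by <:].

Lemma linvK : involutive linv.
Proof. by case=> i b; rewrite /linv /= negbK. Qed.

Lemma push_reduced a w : reduced w -> reduced (push a w).
Proof.
case: w => [//|b w] /= rbw; case: ifPn => [_|ne]; first exact: path_sorted rbw.
by rewrite /= ne.
Qed.

Lemma reduce_reduced w : reduced (reduce w).
Proof. by elim: w => //= a w; apply: push_reduced. Qed.

Lemma pushK a w : reduced w -> push a (push (linv a) w) = w.
Proof.
case: w => [|b w] /=; first by rewrite eqxx.
rewrite linvK; case: eqP => [-> | _] rw; last by rewrite /= eqxx.
case: w rw => [//|c w] /= /andP[ca _].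
by rewrite (negPf ca).
Qed.

Lemma reduce_id w : reduced w -> reduce w = w.
Proof.
elim: w => //= a w IH rw; rewrite IH; last exact: path_sorted rw.
by case: w rw {IH} => //= b w /andP[/negPf ->].
Qed.

Lemma reduce_cat u v : reduce (u ++ v) = foldr push (reduce v) u.
Proof. by rewrite /reduce foldr_cat. Qed.

Lemma foldr_push_reduced u w : reduced w -> reduced (foldr push w u).
Proof. by move=> rw; elim: u => //= a u; apply: push_reduced. Qed.

Lemma foldr_push_push a u w : reduced w ->
  foldr push w (push a u) = push a (foldr push w u).
Proof.
move=> rw; case: u => [//|b u] /=; case: eqP => [-> | //].
by rewrite pushK //; apply: foldr_push_reduced.
Qed.

Lemma foldr_push_reduce u w : reduced w ->
  foldr push w (reduce u) = foldr push w u.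
Proof.
by move=> rw; elim: u => //= a u IH; rewrite foldr_push_push // IH.
Qed.

Lemma reduce_catl u v : reduce (reduce u ++ v) = reduce (u ++ v).
Proof. by rewrite !reduce_cat foldr_push_reduce // reduce_reduced. Qed.

Lemma reduce_catr u v : reduce (u ++ reduce v) = reduce (u ++ v).
Proof. by rewrite !reduce_cat reduce_id // reduce_reduced. Qed.

Lemma reduce_winvl w : reduce (winv w ++ w) = [::].
Proof.
rewrite reduce_cat /winv; have [k] := ubnP (size w).
elim: k w => // k IH [//|a w] /= sw.
rewrite rev_cons -cats1 foldr_cat /=.
have := pushK (linv a) (reduce_reduced w); rewrite linvK => ->; exact: IH.
Qed.

Lemma winvK : involutive winv.
Proof.
by move=> w; rewrite /winv map_rev revK -map_comp map_id_in // => a _ /=; apply: linvK.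
Qed.

Definition fg_one : free_group := @FreeGroup [::] isT.
Definition fg_mul (x y : free_group) : free_group :=
  FreeGroup (reduce_reduced (x ++ y)).
Definition fg_inv (x : free_group) : free_group :=
  FreeGroup (reduce_reduced (winv x)).

Lemma fg_mulA : associative fg_mul.
Proof. by move=> x y z; apply: val_inj; rewrite /= reduce_catl reduce_catr catA. Qed.

Lemma fg_mul1 : left_id fg_one fg_mul.
Proof. by case=> w rw; apply: val_inj; rewrite /= reduce_id. Qed.

Lemma fg_1mul : right_id fg_one fg_mul.
Proof. by case=> w rw; apply: val_inj; rewrite /= cats0 reduce_id. Qed.

Lemma fg_mulV : left_inverse fg_one fg_inv fg_mul.
Proof. by case=> w rw; apply: val_inj; rewrite /= reduce_catl reduce_winvl. Qed.

Lemma fg_Vmul : right_inverse fg_one fg_inv fg_mul.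
Proof.
case=> w rw; apply: val_inj; rewrite /= reduce_catr.
by have := reduce_winvl (winv w); rewrite winvK.
Qed.

HB.instance Definition _ :=
  isGroup.Build free_group fg_mulA fg_mul1 fg_1mul fg_mulV fg_Vmul.

End FreeGroup.

Section DirectProduct.
Variables (I : finType) (G : I -> groupType).

Definition direct_product : Type := {dffun forall i : I, G i}.

HB.instance Definition _ := Choice.on direct_product.

Implicit Types f g : direct_product.

Definition dp_one : direct_product := [ffun i => 1%g : G i].
Definition dp_mul f g : direct_product := [ffun i => (f i * g i)%g].
Definition dp_inv f : direct_product := [ffun i => (f i)^-1%g].

Lemma dp_mulA : associative dp_mul.
Proof. by move=> f g h; apply/ffunP => i; rewrite !ffunE mulgA. Qed.
Lemma dp_mul1 : left_id dp_one dp_mul.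
Proof. by move=> f; apply/ffunP => i; rewrite !ffunE mul1g. Qed.
Lemma dp_1mul : right_id dp_one dp_mul.
Proof. by move=> f; apply/ffunP => i; rewrite !ffunE mulg1. Qed.
Lemma dp_mulV : left_inverse dp_one dp_inv dp_mul.
Proof. by move=> f; apply/ffunP => i; rewrite !ffunE mulVg. Qed.
Lemma dp_Vmul : right_inverse dp_one dp_inv dp_mul.
Proof. by move=> f; apply/ffunP => i; rewrite !ffunE mulgV. Qed.

HB.instance Definition _ :=
  isGroup.Build direct_product dp_mulA dp_mul1 dp_1mul dp_mulV dp_Vmul.

End DirectProduct.

(** Z^N in multiplicative notation, to be a factor of a direct product. *)
Definition free_abelian_group (N : nat) : groupType :=
  {ffun 'I_N -> Algebra.to_multiplicative int}.

Section WithinContinuity.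

Lemma within_continuous_comp2 (X Y Z : topologicalType) (A : set X) (B : set Y)
    (f : X -> Y) (g : Y -> Z) :
  {within A, continuous f} -> (forall x, A x -> B (f x)) ->
  {within B, continuous g} -> {within A, continuous (fun x => g (f x))}.
Proof.
move=> /subspace_continuousP cf fAB /subspace_continuousP cg.
apply/subspace_continuousP => x Ax.
apply: (@cvg_comp _ _ _ f g _ (within B (nbhs (f x)))) (cg _ (fAB _ Ax)).
move=> U /= BU; have := cf x Ax _ BU.
by rewrite /= /within /nbhs /=; apply: filterS => y h Ay; exact: (h Ay (fAB _ Ay)).
Qed.

Lemma pair_continuous (X Y Z : topologicalType) (f : X -> Y) (g : X -> Z) :
  continuous f -> continuous g -> continuous (fun x => (f x, g x)).
Proof. by move=> cf cg x; apply: cvg_pair => /=; [exact: cf|exact: cg]. Qed.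

Lemma closed_setX (X Y : topologicalType) (A : set X) (B : set Y) :
  closed A -> closed B -> closed (A `*` B).
Proof.
move=> cA cB; rewrite (_ : A `*` B = (fst @^-1` A) `&` (snd @^-1` B)) //.
by apply: closedI; apply: preimage_closed => // ? _;
  [exact: cvg_fst|exact: cvg_snd].
Qed.

End WithinContinuity.

Section FundamentalGroup.
Variables (R : realType) (T : topologicalType) (x0 : T).

(** Only the restriction of a loop to [0, 1] is meaningful. *)
Record loop := Loop {
  loop_fun :> R -> T;
  loop_continuous : {within `[0, 1], continuous loop_fun};
  loop0 : loop_fun 0 = x0;
  loop1 : loop_fun 1 = x0 }.

HB.instance Definition _ := gen_eqMixin loop.
HB.instance Definition _ := gen_choiceMixin loop.

Implicit Types f g h : loop.

Definition homotopic f g : Prop := exists H : R * R -> T,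
  [/\ {within `[0, 1] `*` `[0, 1], continuous H},
      forall t : R, 0 <= t <= 1 -> H (0, t) = f t,
      forall t : R, 0 <= t <= 1 -> H (1, t) = g t &
      forall s : R, 0 <= s <= 1 -> H (s, 0) = x0 /\ H (s, 1) = x0].

Definition concat_fun (f g : R -> T) (t : R) : T :=
  if t <= 2^-1 then f (2 * t) else g (2 * t - 1).

Lemma paste_continuous (X : topologicalType) (A : set X) (F G : X -> T) (u : X -> R) :
  closed A -> continuous u ->
  {within A `&` [set x | u x <= 2^-1], continuous F} ->
  {within A `&` [set x | 2^-1 <= u x], continuous G} ->
  (forall x, A x -> u x = 2^-1 -> F x = G x) ->
  {within A, continuous (fun x => if u x <= 2^-1 then F x else G x)}.
Proof.
move=> cA cu cF cG FG.
have -> : A = (A `&` [set x | u x <= 2^-1]) `|` (A `&` [set x | 2^-1 <= u x]).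
  rewrite -setIUr; apply/seteqP; split=> [x Ax|x []//]; split=> //=.
  by case: (leP (u x) 2^-1) => [|/ltW]; [left|right].
apply: withinU_continuous.
- by apply: closedI => //; apply: (preimage_closed _ (@closed_le _ _)) => ? _; exact: cu.
- by apply: closedI => //; apply: (preimage_closed _ (@closed_ge _ _)) => ? _; exact: cu.
- apply: (subspace_eq_continuous _ cF) => x; rewrite inE => -[_ /= ux].
  by rewrite /from_subspace ux.
- apply: (subspace_eq_continuous _ cG) => x; rewrite inE => -[Ax /= ux].
  rewrite /from_subspace; case: ifPn => // ux'; rewrite FG //; lra.
Qed.

Lemma loop_reparam (f : R -> T) (phi psi : R -> R) g h :
  {within `[0, 1], continuous f} ->
  continuous phi -> continuous psi ->
  (forall t : R, 0 <= t <= 1 -> 0 <= phi t <= 1) ->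
  (forall t : R, 0 <= t <= 1 -> 0 <= psi t <= 1) ->
  phi 0 = psi 0 -> phi 1 = psi 1 ->
  (forall t : R, 0 <= t <= 1 -> g t = f (phi t)) ->
  (forall t : R, 0 <= t <= 1 -> h t = f (psi t)) ->
  homotopic g h.
Proof.
move=> cf cphi cpsi phiI psiI e0 e1 gE hE.
exists (f \o (fun st : R * R => (1 - st.1) * phi st.2 + st.1 * psi st.2)); split.
- apply: (within_continuous_comp2 _ _ cf).
  + apply: continuous_subspaceT => -[s t].
    apply: cvgD; apply: cvgM.
    * apply: cvgB; first exact: cvg_cst.
      exact: cvg_fst.
    * by apply: continuous_comp; [exact: cvg_snd|exact: cphi].
    * exact: cvg_fst.
    * by apply: continuous_comp; [exact: cvg_snd|exact: cpsi].
  + move=> [s t] [] /=; rewrite !in_itv /= => /andP[s0 s1] tI.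
    have /andP[a0 a1] := phiI _ tI; have /andP[b0 b1] := psiI _ tI.
    by apply/andP; split; nra.
- by move=> t tI /=; rewrite subr0 mul1r mul0r addr0 gE.
- by move=> t tI /=; rewrite subrr mul1r mul0r add0r hE.
- move=> s sI /=; rewrite -e0 -e1 -!mulrDl subrK !mul1r.
  by rewrite -!gE ?loop0 ?loop1 ?lexx ?ler01.
Qed.

Lemma homotopic_refl f : homotopic f f.
Proof.
by apply: (@loop_reparam f id id) => //; try exact: loop_continuous;
  move=> x; exact: cvg_id.
Qed.

Lemma homotopic_sym f g : homotopic f g -> homotopic g f.
Proof.
move=> [H [cH H0 H1 Hs]].
exists (H \o (fun st : R * R => (1 - st.1, st.2))); split.
- apply: (within_continuous_comp2 _ _ cH).
  + apply: continuous_subspaceT; apply: pair_continuous => -[s t]; last exact: cvg_snd.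
    apply: cvgB; first exact: cvg_cst.
    exact: cvg_fst.
  + by move=> [s t] [] /=; rewrite !in_itv /= => sI tI; split => //; lra.
- by move=> t tI /=; rewrite subr0 H1.
- by move=> t tI /=; rewrite subrr H0.
- by move=> s sI /=; apply: Hs; lra.
Qed.

Lemma homotopic_trans g f h : homotopic f g -> homotopic g h -> homotopic f h.
Proof.
move=> [H [cH H0 H1 Hs]] [K [cK K0 K1 Ks]].
exists (fun st : R * R => if st.1 <= 2^-1 then H (2 * st.1, st.2) else K (2 * st.1 - 1, st.2)).
have c2 : continuous (fun st : R * R => 2 * st.1).
  move=> st; apply: cvgM; first exact: cvg_cst.
  exact: cvg_fst.
split.
- apply: (@paste_continuous (R * R)%type _ (fun st : R * R => H (2 * st.1, st.2))
    (fun st : R * R => K (2 * st.1 - 1, st.2)) fst).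
  + by apply: closed_setX; exact: itv_closed.
  + by move=> st; exact: cvg_fst.
  + apply: (@within_continuous_comp2 _ _ _ _ _ (fun st : R * R => (2 * st.1, st.2)) _ _ _ cH).
      by apply: continuous_subspaceT; apply: pair_continuous => st;
        [exact: c2|exact: cvg_snd].
    by move=> [s t] [[]] /=; rewrite !in_itv /= => sI tI sh; split => //; lra.
  + apply: (@within_continuous_comp2 _ _ _ _ _ (fun st : R * R => (2 * st.1 - 1, st.2)) _ _ _ cK).
      apply: continuous_subspaceT; apply: pair_continuous => st; last exact: cvg_snd.
      apply: cvgB; first exact: c2.
      exact: cvg_cst.
    by move=> [s t] [[]] /=; rewrite !in_itv /= => sI tI sh; split => //; lra.
  + move=> [s t] [] /=; rewrite !in_itv /= => sI tI ->.
    by rewrite divff // subrr K0 // H1.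
- by move=> t tI /=; rewrite invr_ge0 ler0n mulr0 H0.
- move=> t tI /=; case: ifPn => [|_]; first by move=> ?; exfalso; lra.
  by rewrite mulr1 (_ : 2 - 1 = 1) ?K1 //; lra.
- by move=> s sI /=; case: ifPn => sh; [apply: Hs|apply: Ks]; lra.
Qed.

Local Open Scope quotient_scope.

Definition homotopicb : rel loop := fun f g => `[< homotopic f g >].

Lemma homotopicb_equiv : equiv_class_of homotopicb.
Proof.
split.
- by move=> f; apply/asboolP; exact: homotopic_refl.
- by move=> f g; apply/asboolP/asboolP; exact: homotopic_sym.
- by move=> g f h /asboolP fg /asboolP gh; apply/asboolP; exact: homotopic_trans fg gh.
Qed.

Canonical homotopic_equiv := EquivRelPack homotopicb_equiv.

Definition pi1 : Type := {eq_quot homotopic_equiv}.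

HB.instance Definition _ := Choice.on pi1.

Lemma concat_continuous f g : {within `[0, 1], continuous (concat_fun f g)}.
Proof.
have c2 : continuous (fun t : R => 2 * t).
  move=> t; apply: cvgM; first exact: cvg_cst.
  exact: cvg_id.
apply: (@paste_continuous R _ (fun t => f (2 * t)) (fun t => g (2 * t - 1)) id).
- exact: itv_closed.
- by move=> t; exact: cvg_id.
- apply: (@within_continuous_comp2 _ _ _ _ _ (fun t : R => 2 * t) _ _ _ (@loop_continuous f)).
    exact: continuous_subspaceT.
  by move=> t [] /=; rewrite !in_itv /= => tI th; lra.
- apply: (@within_continuous_comp2 _ _ _ _ _ (fun t : R => 2 * t - 1) _ _ _ (@loop_continuous g)).
    apply: continuous_subspaceT => t; apply: cvgB; first exact: c2.
    exact: cvg_cst.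
  by move=> t [] /=; rewrite !in_itv /= => tI th; lra.
- by move=> t _ ->; rewrite divff // subrr loop0 loop1.
Qed.

Lemma concat0 f g : concat_fun f g 0 = x0.
Proof. by rewrite /concat_fun invr_ge0 ler0n mulr0 loop0. Qed.

Lemma concat1 f g : concat_fun f g 1 = x0.
Proof.
rewrite /concat_fun; case: ifPn => [|_]; first by move=> ?; exfalso; lra.
by rewrite mulr1 (_ : 2 - 1 = 1) ?loop1 //; lra.
Qed.

Definition loop_concat f g : loop :=
  Loop (@concat_continuous f g) (concat0 f g) (concat1 f g).

Lemma cst_loop_continuous : {within `[0, 1], continuous (fun _ : R => x0)}.
Proof. by apply: continuous_subspaceT => t; exact: cvg_cst. Qed.

Definition loop_cst : loop := @Loop (fun=> x0) cst_loop_continuous erefl erefl.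

Lemma rev_continuous f : {within `[0, 1], continuous (fun t => f (1 - t))}.
Proof.
apply: (@within_continuous_comp2 _ _ _ _ _ (fun t : R => 1 - t) _ _ _ (@loop_continuous f)).
  apply: continuous_subspaceT => t; apply: cvgB.
    exact: cvg_cst.
  exact: cvg_id.
by move=> t; rewrite /= !in_itv /= => tI; lra.
Qed.

Lemma rev0 f : f (1 - 0) = x0. Proof. by rewrite subr0 loop1. Qed.
Lemma rev1 f : f (1 - 1) = x0. Proof. by rewrite subrr loop0. Qed.

Definition loop_rev f : loop := Loop (@rev_continuous f) (rev0 f) (rev1 f).

Lemma homotopic_concat f f' g g' : homotopic f f' -> homotopic g g' ->
  homotopic (loop_concat f g) (loop_concat f' g').
Proof.
move=> [H [cH H0 H1 Hs]] [K [cK K0 K1 Ks]].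
exists (fun st : R * R => if st.2 <= 2^-1 then H (st.1, 2 * st.2) else K (st.1, 2 * st.2 - 1)).
have c2 : continuous (fun st : R * R => 2 * st.2).
  move=> st; apply: cvgM; first exact: cvg_cst.
  exact: cvg_snd.
split.
- apply: (@paste_continuous (R * R)%type _ (fun st : R * R => H (st.1, 2 * st.2))
    (fun st : R * R => K (st.1, 2 * st.2 - 1)) snd).
  + by apply: closed_setX; exact: itv_closed.
  + by move=> st; exact: cvg_snd.
  + apply: (@within_continuous_comp2 _ _ _ _ _ (fun st : R * R => (st.1, 2 * st.2)) _ _ _ cH).
      by apply: continuous_subspaceT; apply: pair_continuous => st;
        [exact: cvg_fst|exact: c2].
    by move=> [s t] [[]] /=; rewrite !in_itv /= => sI tI sh; split => //; lra.
  + apply: (@within_continuous_comp2 _ _ _ _ _ (fun st : R * R => (st.1, 2 * st.2 - 1)) _ _ _ cK).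
      apply: continuous_subspaceT; apply: pair_continuous => st; first exact: cvg_fst.
      apply: cvgB; first exact: c2.
      exact: cvg_cst.
    by move=> [s t] [[]] /=; rewrite !in_itv /= => sI tI sh; split => //; lra.
  + move=> [s t] [] /=; rewrite !in_itv /= => sI tI ->.
    by rewrite divff // subrr (Hs _ sI).2 (Ks _ sI).1.
- move=> t tI /=; rewrite /concat_fun; case: ifPn => th.
    by rewrite H0 //; lra.
  by rewrite K0 //; lra.
- move=> t tI /=; rewrite /concat_fun; case: ifPn => th.
    by rewrite H1 //; lra.
  by rewrite K1 //; lra.
- move=> s sI /=; split; first by rewrite invr_ge0 ler0n mulr0 (Hs _ sI).1.
  case: ifPn => [|_]; first by move=> ?; exfalso; lra.
  by rewrite mulr1 (_ : 2 - 1 = 1) ?(Ks _ sI).2 //; lra.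
Qed.

Lemma homotopic_rev f f' : homotopic f f' -> homotopic (loop_rev f) (loop_rev f').
Proof.
move=> [H [cH H0 H1 Hs]].
exists (H \o (fun st : R * R => (st.1, 1 - st.2))); split.
- apply: (within_continuous_comp2 _ _ cH).
  + apply: continuous_subspaceT; apply: pair_continuous => -[s t]; first exact: cvg_fst.
    apply: cvgB; first exact: cvg_cst.
    exact: cvg_snd.
  + by move=> [s t] [] /=; rewrite !in_itv /= => sI tI; split => //; lra.
- by move=> t tI /=; rewrite H0 //; lra.
- by move=> t tI /=; rewrite H1 //; lra.
- by move=> s sI /=; rewrite subr0 subrr; have [] := Hs _ sI.
Qed.

Lemma affine_continuous (a b : R) : continuous (fun t : R => a * t + b : R).
Proof.
move=> t; apply: cvgD; last exact: cvg_cst.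
by apply: cvgM; [exact: cvg_cst|exact: cvg_id].
Qed.


Lemma fun_max_continuous (phi psi : R -> R) : continuous phi -> continuous psi ->
  continuous (fun t : R => Num.max (phi t) (psi t)).
Proof. by move=> cphi cpsi t; have := @continuous_max R R phi psi t (cphi t) (cpsi t). Qed.

Lemma fun_min_continuous (phi psi : R -> R) : continuous phi -> continuous psi ->
  continuous (fun t : R => Num.min (phi t) (psi t)).
Proof. by move=> cphi cpsi t; have := @continuous_min R R phi psi t (cphi t) (cpsi t). Qed.

Lemma homotopic_concatA f g h :
  homotopic (loop_concat f (loop_concat g h)) (loop_concat (loop_concat f g) h).
Proof.
apply: (@loop_reparam (loop_concat (loop_concat f g) h)
  (fun t : R => Num.max (2^-1 * t + 0) (Num.max (1 * t + - 4^-1) (2 * t + -1)))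
  (fun t : R => 1 * t + 0)).
- exact: loop_continuous.
- by do 2?apply: fun_max_continuous; exact: affine_continuous.
- exact: affine_continuous.
- by move=> t tI; rewrite !maxElt; do !case: ifPn; lra.
- by move=> t tI; lra.
- by rewrite !maxElt; do !case: ifPn; lra.
- by rewrite !maxElt; do !case: ifPn; lra.
- move=> t tI /=; rewrite /concat_fun /= /concat_fun !maxElt.
  by do !case: ifPn; move=> *; try (exfalso; lra); congr (_ _); lra.
- by move=> t tI; rewrite mul1r addr0.
Qed.

Lemma homotopic_concat1l f : homotopic (loop_concat loop_cst f) f.
Proof.
apply: (@loop_reparam f (fun t : R => Num.max (0 * t + 0) (2 * t + -1)) (fun t : R => 1 * t + 0)).
- exact: loop_continuous.
- by apply: fun_max_continuous; exact: affine_continuous.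
- exact: affine_continuous.
- by move=> t tI; rewrite !maxElt; do !case: ifPn; lra.
- by move=> t tI; lra.
- by rewrite !maxElt; do !case: ifPn; lra.
- by rewrite !maxElt; do !case: ifPn; lra.
- move=> t tI /=; rewrite /concat_fun /= -[in LHS](loop0 f) !maxElt.
  by do !case: ifPn; move=> *; try (exfalso; lra); congr (_ _); lra.
- by move=> t tI; rewrite mul1r addr0.
Qed.

Lemma homotopic_concat1r f : homotopic (loop_concat f loop_cst) f.
Proof.
apply: (@loop_reparam f (fun t : R => Num.min (2 * t + 0) (0 * t + 1)) (fun t : R => 1 * t + 0)).
- exact: loop_continuous.
- by apply: fun_min_continuous; exact: affine_continuous.
- exact: affine_continuous.
- by move=> t tI; rewrite !minElt; do !case: ifPn; lra.
- by move=> t tI; lra.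
- by rewrite !minElt; do !case: ifPn; lra.
- by rewrite !minElt; do !case: ifPn; lra.
- move=> t tI /=; rewrite /concat_fun /= -[in LHS](loop1 f) !minElt.
  by do !case: ifPn; move=> *; try (exfalso; lra); congr (_ _); lra.
- by move=> t tI; rewrite mul1r addr0.
Qed.

Lemma homotopic_concatVl f : homotopic (loop_concat (loop_rev f) f) loop_cst.
Proof.
apply: (@loop_reparam f (fun t : R => Num.max (-2 * t + 1) (2 * t + -1)) (fun t : R => 0 * t + 1)).
- exact: loop_continuous.
- by apply: fun_max_continuous; exact: affine_continuous.
- exact: affine_continuous.
- by move=> t tI; rewrite !maxElt; do !case: ifPn; lra.
- by move=> t tI; lra.
- by rewrite !maxElt; do !case: ifPn; lra.
- by rewrite !maxElt; do !case: ifPn; lra.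
- move=> t tI /=; rewrite /concat_fun /= !maxElt.
  by do !case: ifPn; move=> *; try (exfalso; lra); congr (_ _); lra.
- by move=> t tI; rewrite mul0r add0r loop1.
Qed.

Lemma homotopic_concatVr f : homotopic (loop_concat f (loop_rev f)) loop_cst.
Proof.
apply: (@loop_reparam f (fun t : R => Num.min (2 * t + 0) (-2 * t + 2)) (fun t : R => 0 * t + 0)).
- exact: loop_continuous.
- by apply: fun_min_continuous; exact: affine_continuous.
- exact: affine_continuous.
- by move=> t tI; rewrite !minElt; do !case: ifPn; lra.
- by move=> t tI; lra.
- by rewrite !minElt; do !case: ifPn; lra.
- by rewrite !minElt; do !case: ifPn; lra.
- move=> t tI /=; rewrite /concat_fun /= !minElt.
  by do !case: ifPn; move=> *; try (exfalso; lra); congr (_ _); lra.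
- by move=> t tI; rewrite mul0r add0r loop0.
Qed.

Definition loop_class (f : loop) : pi1 := \pi_{eq_quot homotopic_equiv} f.

Lemma loop_classP f g : loop_class f = loop_class g <-> homotopic f g.
Proof. by split=> [/eqmodP/asboolP|fg]; [|apply/eqmodP/asboolP]. Qed.

Definition loop_repr (x : pi1) : loop := repr (x : {eq_quot homotopic_equiv}).

Lemma loop_reprK x : loop_class (loop_repr x) = x.
Proof. exact: reprK. Qed.

Lemma loop_repr_class f : homotopic (loop_repr (loop_class f)) f.
Proof. by apply/loop_classP; rewrite loop_reprK. Qed.

Definition pi1_one : pi1 := loop_class loop_cst.
Definition pi1_mul (x y : pi1) : pi1 :=
  loop_class (loop_concat (loop_repr x) (loop_repr y)).
Definition pi1_inv (x : pi1) : pi1 := loop_class (loop_rev (loop_repr x)).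

Lemma loop_class_concat f g :
  loop_class (loop_concat f g) = pi1_mul (loop_class f) (loop_class g).
Proof.
by apply/loop_classP; apply: homotopic_concat; apply: homotopic_sym;
  exact: loop_repr_class.
Qed.

Lemma loop_class_rev f : loop_class (loop_rev f) = pi1_inv (loop_class f).
Proof.
by apply/loop_classP; apply: homotopic_rev; apply: homotopic_sym;
  exact: loop_repr_class.
Qed.

Lemma pi1_mulA : associative pi1_mul.
Proof.
move=> x y z; rewrite -[x]loop_reprK -[y]loop_reprK -[z]loop_reprK.
by rewrite -!loop_class_concat; apply/loop_classP; exact: homotopic_concatA.
Qed.

Lemma pi1_mul1 : left_id pi1_one pi1_mul.
Proof.
move=> x; rewrite -[x]loop_reprK -loop_class_concat.
by apply/loop_classP; exact: homotopic_concat1l.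
Qed.

Lemma pi1_1mul : right_id pi1_one pi1_mul.
Proof.
move=> x; rewrite -[x]loop_reprK -loop_class_concat.
by apply/loop_classP; exact: homotopic_concat1r.
Qed.

Lemma pi1_mulV : left_inverse pi1_one pi1_inv pi1_mul.
Proof.
move=> x; rewrite -[x]loop_reprK -loop_class_rev -loop_class_concat.
by apply/loop_classP; exact: homotopic_concatVl.
Qed.

Lemma pi1_Vmul : right_inverse pi1_one pi1_inv pi1_mul.
Proof.
move=> x; rewrite -[x]loop_reprK -loop_class_rev -loop_class_concat.
by apply/loop_classP; exact: homotopic_concatVr.
Qed.

HB.instance Definition _ :=
  isGroup.Build pi1 pi1_mulA pi1_mul1 pi1_1mul pi1_mulV pi1_Vmul.

End FundamentalGroup.

Section ProjectivePlane.
Variable R : realType.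

(** [R[i]^o] is the field of complex numbers with its usual topology. *)
Local Notation C := (R[i]^o).

Definition nzvec := set_type [set v : 'cV[C]_3 | v != 0].

Definition proportional : rel nzvec := fun u v =>
  `[< exists2 c : C, c != 0 & set_val u = c *: set_val v >].

Lemma proportional_equiv : equiv_class_of proportional.
Proof.
split.
- by move=> u; apply/asboolP; exists 1; rewrite ?oner_neq0 // scale1r.
- have H u v : proportional u v -> proportional v u.
    move=> /asboolP[c c0 uv]; apply/asboolP; exists c^-1; rewrite ?invr_neq0 //.
    by rewrite uv scalerA mulVf // scale1r.
  by move=> u v; apply/idP/idP; exact: H.
- move=> v u w /asboolP[c c0 uv] /asboolP[d d0 vw]; apply/asboolP.
  by exists (c * d); rewrite ?mulf_neq0 // uv vw scalerA.
Qed.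

Canonical proportional_equivRel := EquivRelPack proportional_equiv.

Local Open Scope quotient_scope.

Definition CP2 : Type := quotient_topology {eq_quot proportional_equivRel}.

HB.instance Definition _ := Topological.copy CP2
  (quotient_topology {eq_quot proportional_equivRel}).
HB.instance Definition _ := Quotient.copy CP2
  (quotient_topology {eq_quot proportional_equivRel}).

(** The line of equation [a 0 0 * x + a 0 1 * y + a 0 2 * z = 0]. *)
Definition proj_line (a : 'rV[C]_3) : set CP2 :=
  [set P | a *m set_val (repr P) = 0].

Lemma proj_lineE (a : 'rV[C]_3) (v : nzvec) :
  proj_line a (\pi_CP2 v) <-> a *m set_val v = 0.
Proof.
rewrite /proj_line /=.
have /eqmodP/asboolP[c c0 ->] : repr (\pi_CP2 v) = v %[mod {eq_quot proportional_equivRel}].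
  exact: (@reprK _ CP2).
rewrite -scalemxAr; split=> [/eqP|->]; last by rewrite scaler0.
by rewrite scaler_eq0 (negPf c0) => /eqP.
Qed.

Definition is_line (l : set CP2) : Prop :=
  exists2 a : 'rV[C]_3, a != 0 & l = proj_line a.

Definition is_real_line (l : set CP2) : Prop :=
  exists2 a : 'rV[R]_3, a != 0 & l = proj_line (map_mx (real_complex R) a).

Section Arrangement.
Variables (n : nat) (L : 'I_n -> set CP2).

Definition real_line_arrangement : Prop :=
  injective L /\ forall i, is_real_line (L i).

(** C^2 - L, where C^2 is the complement in CP^2 of the line at infinity. *)
Definition affine_complement (linf : set CP2) : set CP2 :=
  ~` linf `\` \bigcup_(i in setT) L i.

Definition multiplicity (P : CP2) : nat := #|[pred i : 'I_n | P \in L i]|.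

Definition intersection_point (P : CP2) : Prop := (2 <= multiplicity P)%N.
Definition simple_point (P : CP2) : Prop := multiplicity P = 2.
Definition multiple_point (P : CP2) : Prop := (2 < multiplicity P)%N.

(** Holds vacuously if the line meets no other line of [L]. *)
Definition only_simple_points (i : 'I_n) : Prop :=
  forall P, L i P -> intersection_point P -> simple_point P.

(** The relation ~ on an enumeration [p] of the multiple points:
    [connect] is existence of a path in the graph. *)
Definition point_equiv (k : nat) (p : 'I_k -> CP2) : rel 'I_k :=
  connect (fun s t => [exists i, (p s \in L i) && (p t \in L i)]).

End Arrangement.
End ProjectivePlane.

(* Main.v *)
(** Let [P] be a multiple point and [l] the chosen line carrying its class.  A
    projective change of coordinates sends [l] to infinity; the other [m - 1] lines
    through [P] become vertical lines [u = a_i], and the remaining lines, together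
    with the former line at infinity, become graphs [w = beta_j u].  As the class of
    [P] lies on [l], no two graphs meet over an [a_i].  Let [M] be the complement of
    the vertical lines and of the graphs, and [M0] that of the graphs alone.  Then
    [pi1 M = F^(m-1) x pi1 M0]:
    - [pi1 M] is generated by the loops in one fibre and by loops around the [a_i] on
      which [w] is a constant of large modulus;
    - these loops commute with the fibre loops, since near [a_i] the graphs are
      disjoint and the complement is a trivial bundle;
    - counting the crossings of [u] with half-lines issued from the [a_i] gives a
      retraction onto the free group, and dividing by it gives a morphism which is
      locally determined over all of [M0], hence factors through [pi1 M0].
    Inductively, these pencils are removed one after the other; then the same argument
    removes the remaining lines one by one, each splitting off a factor [Z]. *)

From HB Require Import structures.
Require Import Defs.
From mathcomp Require Import all_boot all_order all_algebra generic_quotient.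
From mathcomp Require Import all_classical all_reals all_analysis.
From mathcomp Require Import complex lra ring.

Set Implicit Arguments.
Unset Strict Implicit.
Unset Printing Implicit Defensive.

Import Order.TTheory GRing.Theory Num.Theory.
Import numFieldNormedType.Exports.

Local Open Scope classical_set_scope.
Local Open Scope ring_scope.

(** * Continuity and compactness *)

Section Continuity.
Context {R : realType}.

(** The projection of [M] to the [u]-plane is not a fibration: over a finite set [D] of values of
    [u] graphs meet and the fibre changes. What remains is local: away from [D] fibre loops can be
    transported to nearby fibres, and over a point of [D] a given loop can be kept unchanged. Global
    statements follow by subdividing a segment or a square, often through a group-valued cocycle on
    pairs of nearby points. A generic real shear gives the [a i] and the points of [D] distinct
    abscissae, so that the half-lines below the [a i] are disjoint and a vertical descent to [a i]
    avoids [D]. Dividing [w] by a bound of the graphs makes room for a constant section. The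
    delicate point is injectivity: a homotopy in [M0] may cross the fibres missing over the [a i].
    The cocycle computing the second projection is extended over them by pushing a neighbourhood
    onto a fibre next to [a i], which is unambiguous once the loops around [a i] are killed. The
    chosen line of a class is itself never removed with a pencil: it serves as line at infinity for
    each pencil of its class, and yields a factor [Z] at the end. *)

Lemma continuousT_cst (X Y : topologicalType) (y : Y) : continuous (fun _ : X => y).
Proof. by move=> x; exact: cvg_cst. Qed.

Lemma continuousT_id (X : topologicalType) : continuous (fun x : X => x).
Proof. by move=> x; exact: cvg_id. Qed.

Lemma continuousT_comp (X Y Z : topologicalType) (f : X -> Y) (g : Y -> Z) :
  continuous f -> continuous g -> continuous (fun x => g (f x)).
Proof. by move=> cf cg x; apply: continuous_comp; [exact: cf|exact: cg]. Qed.

Lemma continuousT_fst (X Y Z : topologicalType) (f : X -> Y * Z) :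
  continuous f -> continuous (fun x => (f x).1).
Proof. by move=> cf; apply: (continuousT_comp cf) => x; exact: cvg_fst. Qed.

Lemma continuousT_snd (X Y Z : topologicalType) (f : X -> Y * Z) :
  continuous f -> continuous (fun x => (f x).2).
Proof. by move=> cf; apply: (continuousT_comp cf) => x; exact: cvg_snd. Qed.

Lemma continuousT_add (X : topologicalType) (K : numFieldType) (V : normedModType K)
  (f g : X -> V) : continuous f -> continuous g -> continuous (fun x => f x + g x).
Proof. by move=> cf cg x; apply: cvgD; [exact: cf|exact: cg]. Qed.

Lemma continuousT_opp (X : topologicalType) (K : numFieldType) (V : normedModType K)
  (f : X -> V) : continuous f -> continuous (fun x => - f x).
Proof. by move=> cf x; apply: cvgN; exact: cf. Qed.

Lemma continuousT_mul (X : topologicalType) (K : numFieldType) (f g : X -> K) :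
  continuous f -> continuous g -> continuous (fun x => f x * g x).
Proof. by move=> cf cg x; apply: cvgM; [exact: cf|exact: cg]. Qed.

Lemma continuousT_scale (X : topologicalType) (K : numFieldType) (V : normedModType K)
  (k : X -> K) (f : X -> V) : continuous k -> continuous f ->
  continuous (fun x => k x *: f x).
Proof. by move=> cf cg x; apply: cvgZ; [exact: cf|exact: cg]. Qed.

Lemma continuousT_norm (X : topologicalType) (V : normedModType R)
  (f : X -> V) : continuous f -> continuous (fun x => `|f x|).
Proof. by move=> cf x; apply: cvg_norm; exact: cf. Qed.

Lemma continuousT_max (X : topologicalType) (f g : X -> R) :
  continuous f -> continuous g -> continuous (fun x => Num.max (f x) (g x)).
Proof. by move=> cf cg x; have := @continuous_max R X f g x (cf x) (cg x). Qed.

Lemma continuousT_min (X : topologicalType) (f g : X -> R) :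
  continuous f -> continuous g -> continuous (fun x => Num.min (f x) (g x)).
Proof. by move=> cf cg x; have := @continuous_min R X f g x (cf x) (cg x). Qed.

End Continuity.

Ltac continuity := repeat (first
  [ assumption
  | lazymatch goal with
    | |- continuous (fun x => x) => apply: continuousT_id
    | |- continuous (fun _ => ?y) => exact: continuousT_cst
    | |- continuous (fun x => (@?f x, @?g x)) => apply: pair_continuous
    | |- continuous (fun x => fst (@?f x)) => apply: continuousT_fst
    | |- continuous (fun x => snd (@?f x)) => apply: continuousT_snd
    | |- continuous (fun x => @GRing.add _ (@?f x) (@?g x)) => apply: continuousT_add
    | |- continuous (fun x => @GRing.opp _ (@?f x)) => apply: continuousT_opp
    | |- continuous (fun x => @GRing.mul _ (@?f x) (@?g x)) => apply: continuousT_mul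
    | |- continuous (fun x => @GRing.scale _ _ (@?f x) (@?g x)) => apply: continuousT_scale
    | |- continuous (fun x => Num.max (@?f x) (@?g x)) => apply: continuousT_max
    | |- continuous (fun x => Num.min (@?f x) (@?g x)) => apply: continuousT_min
    | |- continuous (fun x => Num.norm (@?f x)) => apply: continuousT_norm
    | H : continuous ?f |- continuous (fun x => ?f (@?g x)) => apply: (continuousT_comp _ H)
    | |- continuous (fun x => _) => fail
    | |- continuous ?f => change (continuous (fun x => f x))
    end ]).

Section Compactness.
Context {R : realType}.
Implicit Types V : normedModType R.

(** Composing with this retraction onto [[0, 1]] turns a map that is only continuous within the
    interval into one that is continuous on the whole line. *)
Definition clamp (t : R) : R := Num.max 0 (Num.min 1 t).

Lemma clamp_in t : 0 <= clamp t <= 1.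
Proof. by rewrite /clamp maxElt minElt; do !case: ifPn; lra. Qed.

Lemma clamp_id t : 0 <= t <= 1 -> clamp t = t.
Proof. by rewrite /clamp maxElt minElt; do !case: ifPn; lra. Qed.

Lemma clamp_continuous : continuous clamp.
Proof. by rewrite /clamp; continuity. Qed.

Lemma convex_lt (p q c s : R) : p < c -> q < c -> 0 <= s <= 1 -> (1 - s) * p + s * q < c.
Proof.
move=> pc qc sI; have m1 : p <= Num.max p q by rewrite le_max lexx.
have m2 : q <= Num.max p q by rewrite le_max lexx orbT.
have : Num.max p q < c by rewrite gt_max pc qc.
by apply: le_lt_trans; nra.
Qed.

Lemma convex_gt (p q c s : R) : c < p -> c < q -> 0 <= s <= 1 -> c < (1 - s) * p + s * q.
Proof.
move=> pc qc sI; rewrite -ltrN2 opprD -!mulrN; apply: convex_lt => //; rewrite ltrN2 //.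
Qed.

(** A Lebesgue number for a property of triples, by compactness: each point contributes a ball of
    half its radius. Triples are needed because the property used later is a cocycle identity. *)
Lemma uniform_of_local V (S : set V) (P : V -> V -> V -> Prop) : compact S ->
  (forall q, S q -> exists2 e, 0 < e & forall x y z, S x -> S y -> S z ->
     `|q - x| < e -> `|q - y| < e -> `|q - z| < e -> P x y z) ->
  exists2 e, 0 < e & forall x y z, S x -> S y -> S z ->
     `|x - y| < e -> `|x - z| < e -> P x y z.
Proof.
move=> /compact_near_coveringP cS loc.
have := cS R (0^'+) (fun e x => S x -> forall y z, S y -> S z ->
  `|x - y| < e -> `|x - z| < e -> P x y z).
case.
- move=> q Sq; have [e e0 he] := loc q Sq.
  exists (ball q (e / 2), [set d : R | d < e / 2]) => /=.
    split; first by apply: nbhsx_ballx; lra.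
    by apply: nbhs_right_lt; lra.
  move=> [x d] /= [+ de] Sx y z Sy Sz xy xz; rewrite -ball_normE /= => qx.
  apply: he => //; first lra.
    by have := ler_distD x q y; lra.
  by have := ler_distD x q z; lra.
- move=> d /= d0 H.
  exists (d / 2); first by lra.
  move=> x y z Sx Sy Sz xy xz; apply: (H (d / 2)) => //=; last lra.
  by rewrite sub0r normrN gtr0_norm; lra.
Qed.

(** Composing the local relations along the points [k / N]. *)
Lemma chain_unit_interval (Q : R -> R -> Prop) :
  (forall s t u, 0 <= s <= 1 -> 0 <= t <= 1 -> 0 <= u <= 1 ->
     Q s t -> Q t u -> Q s u) ->
  (forall q, 0 <= q <= 1 -> exists2 e, 0 < e & forall s t,
     0 <= s <= 1 -> 0 <= t <= 1 -> `|q - s| < e -> `|q - t| < e -> Q s t) ->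
  forall s t, 0 <= s <= 1 -> 0 <= t <= 1 -> Q s t.
Proof.
move=> Qtr loc s t sI tI.
have [e e0 he] : exists2 e : R, 0 < e & forall x y z : R, `[0, 1]%classic x ->
    `[0, 1]%classic y -> `[0, 1]%classic z ->
    `|x - y| < e -> `|x - z| < e -> Q x y.
  apply: (@uniform_of_local R^o `[0, 1]%classic (fun x y _ => Q x y)).
    exact: segment_compact.
  move=> q; rewrite /= in_itv /= => qI; have [e e0 he] := loc q qI.
  exists e => // x y z; rewrite /= !in_itv /= => xI yI _ qx qy _.
  exact: he.
have [N Ne] : exists N : nat, e^-1 < N%:R.
  by exists (Num.bound e^-1); apply: archi_boundP; rewrite invr_ge0 ltW.
have N0 : 0 < N%:R :> R by apply: lt_trans Ne; rewrite invr_gt0.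
have N1 : N%:R^-1 < e by rewrite -[ltRHS]invrK ltf_pV2 // posrE invr_gt0.
pose p k : R := s + (k%:R / N%:R) * (t - s).
have pI k : (k <= N)%N -> 0 <= p k <= 1.
  move=> kN; rewrite /p; set x : R := k%:R / N%:R.
  have xI : 0 <= x <= 1.
    rewrite divr_ge0 ?ler0n //= ler_pdivrMr // mul1r ler_nat //.
  by clear -xI sI tI; apply/andP; split; nra.
have step k : (k < N)%N -> Q (p k) (p k.+1).
  move=> kN; apply: (he _ _ (p k)); rewrite /= ?in_itv /=; try exact: pI (ltnW kN).
  - exact: pI kN.
  - rewrite (_ : p k - p k.+1 = N%:R^-1 * (s - t)); last first.
      by rewrite /p -natr1; field; rewrite gt_eqF.
    rewrite normrM gtr0_norm ?invr_gt0 //.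
    apply: le_lt_trans N1; apply: ler_piMr; first by rewrite invr_ge0 ltW.
    by rewrite ler_norml; lra.
  - by rewrite subrr normr0.
have H k : (k < N)%N -> Q (p 0%N) (p k.+1).
  elim: k => [|k IH] kN; first exact: step.
  apply: Qtr (step _ kN); try exact: pI; first exact: pI (ltnW kN).
  by apply: IH; exact: ltnW.
have p0 : p 0%N = s by rewrite /p !mul0r addr0.
have pN : p N = t by rewrite /p divff ?gt_eqF // mul1r addrC subrK.
have N' : (N.-1 < N)%N by move: N0; rewrite ltr0n; case: (N).
by have := H _ N'; rewrite (ltn_predK N') p0 pN.
Qed.

Lemma connected_unit_interval (K : Type) (f : R -> K) :
  (forall q, 0 <= q <= 1 -> exists2 e, 0 < e & forall s t,
     0 <= s <= 1 -> 0 <= t <= 1 -> `|q - s| < e -> `|q - t| < e -> f s = f t) ->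
  forall s t, 0 <= s <= 1 -> 0 <= t <= 1 -> f s = f t.
Proof. by apply: chain_unit_interval => s t u _ _ _ ->. Qed.

(** The product of the values of the cocycle along the [N] equal steps of the
    segment from [0] to [p]. *)
Lemma cocycle_potential V (S : set V) (K : groupType) (c : V -> V -> K) :
  compact S -> (forall p t, S p -> 0 <= t <= 1 -> S (t *: p)) ->
  (forall q, S q -> exists2 e, 0 < e & forall x y z, S x -> S y -> S z ->
     `|q - x| < e -> `|q - y| < e -> `|q - z| < e -> (c x y * c y z)%g = c x z) ->
  exists kappa : V -> K, exists2 e, 0 < e &
    forall x y, S x -> S y -> `|x - y| < e -> (kappa x * c x y)%g = kappa y.
Proof.
move=> cS star /(uniform_of_local cS)[e e0 he].
have [M [_ hM]] := compact_bounded cS.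
have SM x : S x -> `|x| <= `|M| + 1.
  by apply: hM; have := ler_norm M; lra.
pose B := `|M| + 1; have B0 : 0 < B by rewrite /B; have := normr_ge0 M; lra.
have [N Ne] : exists N : nat, B / (e / 2) < N%:R.
  by exists (Num.bound (B / (e / 2))); apply: archi_boundP; rewrite divr_ge0 //; lra.
have N0 : 0 < N%:R :> R by apply: lt_trans Ne; rewrite divr_gt0 //; lra.
have NB : B / N%:R < e / 2.
  by move: Ne; rewrite ltr_pdivrMr ?ltr_pdivrMr //; [rewrite mulrC|lra].
pose p k (x : V) := (k%:R / N%:R : R) *: x.
pose kap := fix kap n x := if n is n'.+1 then (kap n' x * c (p n' x) (p n x))%g else 1%g.
have Sp k x : (k <= N)%N -> S x -> S (p k x).
  move=> kN Sx; apply: star => //.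
  by rewrite divr_ge0 ?ler0n //= ler_pdivrMr // mul1r ler_nat.
have c1 x : S x -> c x x = 1%g.
  move=> Sx; apply: (@mulgI _ (c x x)); rewrite mulg1.
  by apply: he => //; rewrite subrr normr0.
exists (kap N), (e / 2); first lra.
move=> x y Sx Sy xy.
have dxy k : (k <= N)%N -> `|p k x - p k y| < e / 2.
  move=> kN; rewrite /p -scalerBr normrZ ger0_norm ?divr_ge0 ?ler0n //.
  apply: le_lt_trans xy; rewrite ler_piMl // ler_pdivrMr // mul1r ler_nat //.
have dS k z : S z -> `|p k z - p k.+1 z| < e / 2.
  move=> Sz; rewrite /p -scalerBl (_ : _ - _ = - N%:R^-1); last first.
    by rewrite -natr1; field; rewrite gt_eqF.
  rewrite normrZ normrN gtr0_norm ?invr_gt0 //.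
  apply: le_lt_trans NB; rewrite mulrC ler_pM2r ?invr_gt0 //; exact: SM.
(* A ladder between the segments from [0] to [x] and from [0] to [y]: each square commutes by two
   applications of the cocycle identity, its corners being less than [e] away from the first one. *)
have H k : (k <= N)%N -> (kap k x * c (p k x) (p k y))%g = kap k y.
  elim: k => [|k IH] kN.
    by rewrite /= /p !mul0r !scale0r mul1g c1 // -(scale0r x); apply: star => //; lra.
  rewrite /= -IH ?(ltnW kN) // -!mulgA; congr (_ * _)%g.
  have kN' := ltnW kN.
  have [d1 d2] := (dxy _ kN', dxy _ kN).
  have [d3 d4] := (dS k _ Sx, dS k _ Sy).
  rewrite !he //; try exact: Sp; try lra.
  - by have := ler_distD (p k y) (p k x) (p k.+1 y); lra.
  - by have := ler_distD (p k.+1 x) (p k x) (p k.+1 y); lra.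
have pN z : p N z = z by rewrite /p divff ?scale1r // gt_eqF.
by rewrite -(H N) // !pN.
Qed.

Lemma local_subpath V (f : R -> V) q e : continuous f -> 0 < e ->
  exists2 d, 0 < d & forall s t v, `|q - s| < d -> `|q - t| < d -> 0 <= v <= 1 ->
    `|f q - f (s + v * (t - s))| < e.
Proof.
move=> cf e0; have /cvgrPdist_lt/(_ _ e0)/nbhs_ballP[d /= d0 H] := cf q.
exists d => // s t v qs qt vI; apply: H; rewrite -ball_normE /=.
have -> : q - (s + v * (t - s)) = (1 - v) * (q - s) + v * (q - t) by ring.
move: qs qt; rewrite !ltr_norml => /andP[? ?] /andP[? ?]; apply/andP.
by split; [exact: convex_gt|exact: convex_lt].
Qed.

Lemma path_lower_bound (f : R -> R) : continuous f -> (forall t, 0 <= t <= 1 -> 0 < f t) ->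
  exists2 m, 0 < m & forall t, 0 <= t <= 1 -> m <= f t.
Proof.
move=> cf f0; have [|c cI hc] := @EVT_min R f 0 1 ler01.
  exact: continuous_subspaceT.
exists (f c); first by apply: f0; rewrite in_itv /= in cI.
by move=> t tI; apply: hc; rewrite in_itv /=.
Qed.

End Compactness.

(** Paths are continuous on the whole line, although only [[0, 1]] counts; this avoids continuity
    within a subset in the later constructions. *)
Definition path_in (R : realType) (T : topologicalType) (X : set T) (f : R -> T) :=
  continuous f /\ forall t : R, 0 <= t <= 1 -> X (f t).

(** [lra] fails on hypotheses that are equations in a type without an order. *)
Ltac lra_skip T := repeat match goal with
  | H : @eq (Topological.sort T) _ _ |- _ => clear H
  | H : _ /\ _ |- _ => clear H
  | H : _ <-> _ |- _ => clear H
  end; lra.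

(** * Paths, their homotopies and their classes *)

Section Paths.
Context {R : realType} {T : topologicalType}.
Implicit Types (X : set T) (f g h : R -> T).

Definition path_homotopic X f g := exists H : R * R -> T,
  [/\ continuous H,
      forall s t : R, 0 <= s <= 1 -> 0 <= t <= 1 -> X (H (s, t)),
      forall t : R, 0 <= t <= 1 -> H (0, t) = f t,
      forall t : R, 0 <= t <= 1 -> H (1, t) = g t &
      forall s : R, 0 <= s <= 1 -> H (s, 0) = f 0 /\ H (s, 1) = f 1].

Lemma path_homotopic_ends X f g : path_homotopic X f g -> g 0 = f 0 /\ g 1 = f 1.
Proof.
move=> [H [_ _ _ H1 Hs]].
by rewrite -!H1 ?lexx ?ler01 //; apply: Hs; rewrite lexx ler01.
Qed.

Lemma concat_continuousT f g : continuous f -> continuous g -> f 1 = g 0 ->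
  continuous (concat_fun f g).
Proof.
move=> cf cg fg; rewrite /concat_fun.
suff : {within setT, continuous (fun t : R => if t <= 2^-1 then f (2 * t) else g (2 * t - 1))}.
  by move=> H; apply/continuous_subspace_setT.
apply: (@paste_continuous R T R setT (fun t => f (2 * t)) (fun t => g (2 * t - 1)) id).
- exact: closedT.
- by move=> x; exact: cvg_id.
- by apply: continuous_subspaceT; apply: (continuousT_comp _ cf); continuity.
- by apply: continuous_subspaceT; apply: (continuousT_comp _ cg); continuity.
- by move=> t _ ->; rewrite divff // subrr fg.
Qed.

Lemma concat_fun0 f g : concat_fun f g 0 = f 0.
Proof. by rewrite /concat_fun invr_ge0 ler0n mulr0. Qed.

Lemma concat_fun1 f g : concat_fun f g 1 = g 1.
Proof.
rewrite /concat_fun; case: ifPn => [|_]; first by move=> ?; exfalso; lra_skip T.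
by congr g; lra_skip T.
Qed.

Lemma path_in_concat X f g : path_in X f -> path_in X g -> f 1 = g 0 ->
  path_in X (concat_fun f g).
Proof.
move=> [cf Xf] [cg Xg] fg; split; first exact: concat_continuousT.
by move=> t tI; rewrite /concat_fun; case: ifPn => th; [apply: Xf|apply: Xg]; lra_skip T.
Qed.

Lemma path_in_rev X f : path_in X f -> path_in X (fun t => f (1 - t)).
Proof.
move=> [cf Xf]; split; first by apply: (continuousT_comp _ cf); continuity.
by move=> t tI; apply: Xf; lra_skip T.
Qed.

Lemma path_in_cst X x : X x -> path_in X (fun _ : R => x).
Proof. by move=> Xx; split => //; exact: continuousT_cst. Qed.

Lemma path_in_sub X Y f : X `<=` Y -> path_in X f -> path_in Y f.
Proof. by move=> XY [cf Xf]; split => // t tI; exact/XY/Xf. Qed.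

(** The straight-line homotopy of the parametrisations, pushed forward by [F]: the source of
    reparametrisations, of classes over convex sets and of the contraction of the plane. *)
Lemma path_homotopic_convex (V : normedModType R) (E : set V) X (F : V -> T)
    (phi psi : R -> V) :
  continuous F -> (forall p, E p -> X (F p)) ->
  (forall p q s, E p -> E q -> 0 <= s <= 1 -> E ((1 - s) *: p + s *: q)) ->
  path_in E phi -> path_in E psi -> phi 0 = psi 0 -> phi 1 = psi 1 ->
  path_homotopic X (fun t => F (phi t)) (fun t => F (psi t)).
Proof.
move=> cF EX cvE [cphi Ephi] [cpsi Epsi] e0 e1.
exists (fun st => F ((1 - st.1) *: phi st.2 + st.1 *: psi st.2)); split => /=.
- have c1 : continuous (fun st : R * R => phi st.2) by apply: (continuousT_comp _ cphi); continuity.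
  have c2 : continuous (fun st : R * R => psi st.2) by apply: (continuousT_comp _ cpsi); continuity.
  by apply: (continuousT_comp _ cF); continuity.
- by move=> s t sI tI; apply: EX; apply: cvE => //; [exact: Ephi|exact: Epsi].
- by move=> t tI; rewrite subr0 scale1r scale0r addr0.
- by move=> t tI; rewrite subrr scale1r scale0r add0r.
- by move=> s sI; rewrite -e0 -e1 -!scalerDl subrK !scale1r.
Qed.

Lemma path_homotopic_eq X f g : path_in X f ->
  (forall t, 0 <= t <= 1 -> f t = g t) -> path_homotopic X f g.
Proof.
move=> [cf Xf] fg; exists (fun st => f st.2); split => //=.
- by apply: (continuousT_comp _ cf); continuity.
- by move=> s t _; exact: Xf.
Qed.

Lemma path_homotopic_refl X f : path_in X f -> path_homotopic X f f.
Proof. by move=> Xf; exact: path_homotopic_eq. Qed.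

Lemma path_homotopic_sym X f g : path_homotopic X f g -> path_homotopic X g f.
Proof.
move=> fg; have [g0 g1] := path_homotopic_ends fg; case: fg => [H [cH XH H0 H1 Hs]].
exists (fun st => H (1 - st.1, st.2)); split => /=.
- by apply: (continuousT_comp _ cH); continuity.
- by move=> s t sI tI; apply: XH => //; lra_skip T.
- by move=> t tI; rewrite subr0 H1.
- by move=> t tI; rewrite subrr H0.
- by move=> s sI; rewrite g0 g1; apply: Hs; lra_skip T.
Qed.

Lemma path_homotopic_trans X g f h :
  path_homotopic X f g -> path_homotopic X g h -> path_homotopic X f h.
Proof.
move=> fg; have ends := path_homotopic_ends fg; case: fg => [H [cH XH H0 H1 Hs]].
move=> [K [cK XK K0 K1 Ks]].
(* The two homotopies are only known to agree on their common side for [0 <= t <= 1], while pasting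
   over the whole plane needs every [t]: hence the clamping. *)
pose cl (st : R * R) := (st.1, clamp st.2).
have ccl : continuous cl.
  have c1 : continuous (fun st : R * R => clamp st.2).
    by apply: (continuousT_comp _ clamp_continuous); continuity.
  by rewrite /cl; continuity.
exists (fun st : R * R => if st.1 <= 2^-1 then H (cl (2 * st.1, st.2))
                          else K (cl (2 * st.1 - 1, st.2))).
split => /=.
- apply/continuous_subspace_setT.
  apply: (@paste_continuous R T _ setT (fun st : R * R => H (cl (2 * st.1, st.2)))
    (fun st : R * R => K (cl (2 * st.1 - 1, st.2))) fst).
  + exact: closedT.
  + by move=> st; exact: cvg_fst.
  + apply: continuous_subspaceT; apply: (continuousT_comp _ cH).
    by apply: (continuousT_comp _ ccl); continuity.
  + apply: continuous_subspaceT; apply: (continuousT_comp _ cK).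
    by apply: (continuousT_comp _ ccl); continuity.
  + move=> [s t] _ /= ->; rewrite /cl /= divff // subrr.
    by rewrite H1 ?clamp_in // K0 ?clamp_in.
- by move=> s t sI tI; rewrite /cl /= clamp_id //; case: ifPn => sh; [apply: XH|apply: XK]; lra_skip T.
- by move=> t tI; rewrite invr_ge0 ler0n /cl /= clamp_id // mulr0 H0.
- move=> t tI; case: ifPn => [|_]; first by move=> ?; exfalso; lra_skip T.
  by rewrite /cl /= clamp_id // mulr1 (_ : 2 - 1 = 1) ?K1 //; lra_skip T.
- move=> s sI; rewrite /cl /= !clamp_id ?lexx ?ler01 //; case: ifPn => sh; first by apply: Hs; lra_skip T.
  by case: ends => <- <-; apply: Ks; lra_skip T.
Qed.

Lemma path_homotopic_concat X f f' g g' :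
  path_homotopic X f f' -> path_homotopic X g g' -> f 1 = g 0 ->
  path_homotopic X (concat_fun f g) (concat_fun f' g').
Proof.
move=> [H [cH XH H0 H1 Hs]] [K [cK XK K0 K1 Ks]] fg.
pose cl (st : R * R) := (clamp st.1, st.2).
have ccl : continuous cl.
  have c1 : continuous (fun st : R * R => clamp st.1).
    by apply: (continuousT_comp _ clamp_continuous); continuity.
  by rewrite /cl; continuity.
exists (fun st : R * R => if st.2 <= 2^-1 then H (cl (st.1, 2 * st.2))
                          else K (cl (st.1, 2 * st.2 - 1))).
split => /=.
- apply/continuous_subspace_setT.
  apply: (@paste_continuous R T _ setT (fun st : R * R => H (cl (st.1, 2 * st.2)))
    (fun st : R * R => K (cl (st.1, 2 * st.2 - 1))) snd).
  + exact: closedT.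
  + by move=> st; exact: cvg_snd.
  + apply: continuous_subspaceT; apply: (continuousT_comp _ cH).
    by apply: (continuousT_comp _ ccl); continuity.
  + apply: continuous_subspaceT; apply: (continuousT_comp _ cK).
    by apply: (continuousT_comp _ ccl); continuity.
  + move=> [s t] _ /= ->; rewrite /cl /= divff // subrr.
    by rewrite (Hs _ (clamp_in s)).2 (Ks _ (clamp_in s)).1 fg.
- by move=> s t sI tI; rewrite /cl /= clamp_id //; case: ifPn => sh; [apply: XH|apply: XK]; lra_skip T.
- move=> t tI; rewrite /concat_fun /cl /= clamp_id ?lexx ?ler01 //.
  by case: ifPn => th; [apply: H0|apply: K0]; lra_skip T.
- move=> t tI; rewrite /concat_fun /cl /= clamp_id ?lexx ?ler01 //.
  by case: ifPn => th; [apply: H1|apply: K1]; lra_skip T.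
- move=> s sI; rewrite concat_fun0 concat_fun1 /cl /= clamp_id // invr_ge0 ler0n mulr0.
  split; first exact: (Hs s sI).1.
  case: ifPn => [|_]; first by move=> ?; exfalso; lra_skip T.
  by rewrite mulr1 (_ : 2 - 1 = 1) ?(Ks _ sI).2 //; lra_skip T.
Qed.

Lemma path_homotopic_reparam X f (phi psi : R -> R) g h : path_in X f ->
  continuous phi -> continuous psi ->
  (forall t : R, 0 <= t <= 1 -> 0 <= phi t <= 1) ->
  (forall t : R, 0 <= t <= 1 -> 0 <= psi t <= 1) ->
  phi 0 = psi 0 -> phi 1 = psi 1 ->
  path_in X g -> (forall t : R, 0 <= t <= 1 -> g t = f (phi t)) ->
  path_in X h -> (forall t : R, 0 <= t <= 1 -> h t = f (psi t)) ->
  path_homotopic X g h.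
Proof.
move=> [cf Xf] cphi cpsi phiI psiI e0 e1 Xg gE Xh hE.
apply: (@path_homotopic_trans _ (fun t => f (phi t))); first exact: path_homotopic_eq.
apply: (@path_homotopic_trans _ (fun t => f (psi t))); last first.
  by apply: path_homotopic_sym; exact: path_homotopic_eq.
apply: (@path_homotopic_convex R^o [set t | 0 <= t <= 1]) => //.
by move=> p q s /= pI qI sI; rewrite /GRing.scale /=; apply/andP; split; nra.
Qed.

Lemma path_homotopic_concatA X f g h : path_in X f -> path_in X g -> path_in X h ->
  f 1 = g 0 -> g 1 = h 0 ->
  path_homotopic X (concat_fun f (concat_fun g h)) (concat_fun (concat_fun f g) h).
Proof.
move=> Xf Xg Xh fg gh.
have Xgh := path_in_concat Xg Xh gh.
have Xfg := path_in_concat Xf Xg fg.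
have fgh : f 1 = concat_fun g h 0 by rewrite concat_fun0.
have fgh' : concat_fun f g 1 = h 0 by rewrite concat_fun1.
(* The speeds [1/2], [1], [2] of the change of parameter increase, so this convex piecewise affine
   function is the maximum of its three pieces. *)
apply: (@path_homotopic_reparam X (concat_fun (concat_fun f g) h)
  (fun t : R => Num.max (2^-1 * t) (Num.max (t - 4^-1) (2 * t - 1)))
  (fun t : R => t)) => //.
- exact: path_in_concat.
- by continuity.
- by continuity.
- by move=> t tI; rewrite !maxElt; do !case: ifPn; lra_skip T.
- by rewrite !maxElt; do !case: ifPn; lra_skip T.
- by rewrite !maxElt; do !case: ifPn; lra_skip T.
- exact: path_in_concat.
- move=> t tI; rewrite /concat_fun !maxElt.
  do !case: ifPn; move=> *; try (exfalso; lra_skip T); congr (_ _); lra_skip T.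
- exact: path_in_concat.
Qed.

Lemma path_homotopic_concat1l X f x : path_in X f -> x = f 0 ->
  path_homotopic X (concat_fun (fun _ : R => x) f) f.
Proof.
move=> Xf ->; have Xc : path_in X (fun _ : R => f 0) by apply: path_in_cst; apply: Xf.2; rewrite lexx ler01.
apply: (@path_homotopic_reparam X f (fun t : R => Num.max 0 (2 * t - 1)) (fun t : R => t)) => //.
- by continuity.
- by continuity.
- by move=> t tI; rewrite !maxElt; do !case: ifPn; lra_skip T.
- by rewrite !maxElt; do !case: ifPn; lra_skip T.
- by rewrite !maxElt; do !case: ifPn; lra_skip T.
- exact: path_in_concat.
- move=> t tI; rewrite /concat_fun !maxElt.
  by do !case: ifPn; move=> *; try (exfalso; lra_skip T); congr (_ _); lra_skip T.
Qed.

Lemma path_homotopic_concat1r X f x : path_in X f -> f 1 = x ->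
  path_homotopic X (concat_fun f (fun=> x)) f.
Proof.
move=> Xf <-; have Xc : path_in X (fun _ : R => f 1) by apply: path_in_cst; apply: Xf.2; rewrite lexx ler01.
apply: (@path_homotopic_reparam X f (fun t : R => Num.min (2 * t) 1) (fun t : R => t)) => //.
- by continuity.
- by continuity.
- by move=> t tI; rewrite !minElt; do !case: ifPn; lra_skip T.
- by rewrite !minElt; do !case: ifPn; lra_skip T.
- by rewrite !minElt; do !case: ifPn; lra_skip T.
- exact: path_in_concat.
- move=> t tI; rewrite /concat_fun !minElt.
  by do !case: ifPn; move=> *; try (exfalso; lra_skip T); congr (_ _); lra_skip T.
Qed.

Lemma path_homotopic_concatV X f : path_in X f ->
  path_homotopic X (concat_fun f (fun t => f (1 - t))) (fun=> f 0).
Proof.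
move=> Xf; have Xr := path_in_rev Xf.
apply: (@path_homotopic_reparam X f (fun t : R => Num.min (2 * t) (2 - 2 * t)) (fun t : R => 0)) => //.
- by continuity.
- by continuity.
- by move=> t tI; rewrite !minElt; do !case: ifPn; lra_skip T.
- by move=> t tI; rewrite lexx ler01.
- by rewrite !minElt; do !case: ifPn; lra_skip T.
- by rewrite !minElt; do !case: ifPn; lra_skip T.
- by apply: path_in_concat => //; rewrite subr0.
- move=> t tI; rewrite /concat_fun !minElt.
  by do !case: ifPn; move=> *; try (exfalso; lra_skip T); congr (_ _); lra_skip T.
- by apply: path_in_cst; apply: Xf.2; rewrite lexx ler01.
Qed.

Lemma path_homotopic_concatVl X f : path_in X f ->
  path_homotopic X (concat_fun (fun t => f (1 - t)) f) (fun=> f 1).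
Proof.
move=> Xf; have Xr := path_in_rev Xf.
have := path_homotopic_concatV Xr; rewrite subr0; apply: path_homotopic_trans.
apply: path_homotopic_concat; try exact: path_homotopic_eq; last by rewrite subrr.
by apply: path_homotopic_eq => // t tI; congr f; lra_skip T.
Qed.

End Paths.

Section BasedLoops.
Context {R : realType} {T : topologicalType} (X : set T) (x0 : set_type X).

Definition based_in (f : R -> T) := [/\ path_in X f, f 0 = val x0 & f 1 = val x0].

Lemma set_lift_continuous (f : R -> T) : based_in f ->
  {within `[0, 1], continuous (fun t => insubd x0 (f t) : set_type X)}.
Proof.
move=> [[cf Xf] _ _]; apply/subspace_continuousP => t tI.
have Xt := Xf t; rewrite /= in_itv /= in tI.
have vt : val (insubd x0 (f t) : set_type X) = f t.
  by rewrite insubdK //; apply/mem_set/Xf.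
move=> U [? [[W oW <-] /= Wt WU]].
rewrite /= /within /= /nbhs /=.
have : nbhs t (f @^-1` W).
  apply: cf; apply: open_nbhs_nbhs; split => //.
  by move: Wt; rewrite set_valE vt.
apply: filterS => s Ws; rewrite in_itv /= => sI; apply: WU => /=.
by rewrite set_valE insubdK //; apply/mem_set/Xf.
Qed.

(** From paths of the ambient space, where all constructions take place, to loops of the subtype,
    where [pi1] is defined. The constant loop is a default value. *)
Definition mkloop (f : R -> T) : loop R x0 :=
  match pselect (based_in f) with
  | left H => @Loop R _ x0 (fun t => insubd x0 (f t)) (set_lift_continuous H)
      (etrans (congr1 (insubd x0) (let: And3 _ h _ := H in h)) (valKd x0 x0))
      (etrans (congr1 (insubd x0) (let: And3 _ _ h := H in h)) (valKd x0 x0))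
  | right _ => loop_cst R x0
  end.

Lemma mkloopE f t : based_in f -> 0 <= t <= 1 -> val (mkloop f t) = f t.
Proof.
move=> bf tI; rewrite /mkloop; case: pselect => //= H.
by rewrite insubdK //; case: H => -[_ Xf] _ _; apply/mem_set/Xf.
Qed.

Definition unloop (l : loop R x0) : R -> T := fun t => val (l (clamp t)).

Lemma val_continuous : continuous (val : set_type X -> T).
Proof. by rewrite -set_valE; exact: initial_continuous. Qed.

Lemma set_typeP (x : set_type X) : X (val x).
Proof. by apply: set_mem; exact: valP. Qed.

Lemma continuous_clamp (Y : topologicalType) (f : R -> Y) :
  {within `[0, 1], continuous f} -> continuous (fun t => f (clamp t)).
Proof.
move=> cf; apply/continuous_subspace_setT.
apply: (within_continuous_comp2 (f := clamp) _ _ cf).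
  by apply: continuous_subspaceT; exact: clamp_continuous.
by move=> t _; rewrite /= in_itv /=; exact: clamp_in.
Qed.

Lemma unloop_based l : based_in (unloop l).
Proof.
split.
- split; last by move=> t _; exact: set_typeP.
  apply: (continuousT_comp _ val_continuous).
  exact/continuous_clamp/loop_continuous.
- by rewrite /unloop clamp_id ?loop0 // lexx ler01.
- by rewrite /unloop clamp_id ?loop1 // lexx ler01.
Qed.

Lemma homotopic_eq (l l' : loop R x0) :
  (forall t, 0 <= t <= 1 -> val (l t) = val (l' t)) -> homotopic l l'.
Proof.
move=> ll'; apply: (@loop_reparam R _ _ l id id) => //; try exact: loop_continuous.
- by move=> x; exact: cvg_id.
- by move=> x; exact: cvg_id.
- by move=> t tI; apply: val_inj; rewrite ll'.
Qed.

Definition pclass (f : R -> T) : pi1 R x0 := loop_class (mkloop f).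

Lemma mkloopK l : homotopic (mkloop (unloop l)) l.
Proof.
apply: homotopic_eq => t tI; rewrite mkloopE //; last exact: unloop_based.
by rewrite /unloop clamp_id.
Qed.

Lemma pclass_repr (g : pi1 R x0) : pclass (unloop (loop_repr g)) = g.
Proof. by rewrite -[RHS]loop_reprK; apply/loop_classP; exact: mkloopK. Qed.

Lemma pclass_surj (g : pi1 R x0) : exists2 f, based_in f & pclass f = g.
Proof. by exists (unloop (loop_repr g)); [exact: unloop_based|exact: pclass_repr]. Qed.

Lemma pclass_homotopic f g : based_in f -> based_in g -> path_homotopic X f g ->
  pclass f = pclass g.
Proof.
move=> bf bg [H [cH XH H0 H1 Hs]]; apply/loop_classP.
exists (fun st => insubd x0 (H st)); split.
- apply/subspace_continuousP => -[s t] [] /=; rewrite !in_itv /= => sI tI.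
  have vt : val (insubd x0 (H (s, t)) : set_type X) = H (s, t).
    by rewrite insubdK //; apply/mem_set/XH.
  move=> U [? [[W oW <-] /= Wt WU]].
  have : nbhs (s, t) (H @^-1` W).
    apply: cH; apply: open_nbhs_nbhs; split => //.
    by move: Wt; rewrite set_valE vt.
  rewrite /nbhs /= /within /=; apply: filterS => -[s' t'] Ws [] /=.
  rewrite !in_itv /= => sI' tI'; apply: WU => /=.
  by rewrite set_valE insubdK //; apply/mem_set/XH.
- move=> t tI; apply: val_inj; rewrite H0 // mkloopE // insubdK //.
  by apply/mem_set; case: bf => -[_ Xf] _ _; exact: Xf.
- move=> t tI; apply: val_inj; rewrite H1 // mkloopE // insubdK //.
  by apply/mem_set; case: bg => -[_ Xf] _ _; exact: Xf.
- by move=> s sI; case: bf => _ f0 f1; have [-> ->] := Hs s sI; rewrite f0 f1 !valKd.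
Qed.

Lemma based_concat f g : based_in f -> based_in g -> based_in (concat_fun f g).
Proof.
move=> [Xf f0 f1] [Xg g0 g1]; split; rewrite ?concat_fun0 ?concat_fun1 //.
by apply: path_in_concat => //; rewrite f1.
Qed.

Lemma pclass_concat f g : based_in f -> based_in g ->
  pclass (concat_fun f g) = (pclass f * pclass g)%g.
Proof.
move=> bf bg; rewrite [RHS](_ : _ = loop_class (loop_concat (mkloop f) (mkloop g))); last first.
  by rewrite loop_class_concat.
apply/loop_classP; apply: homotopic_eq => t tI; rewrite mkloopE //; last exact: based_concat.
by rewrite /= /concat_fun; case: ifPn => th; rewrite mkloopE //; lra.
Qed.

Lemma unloop_homotopic (l l' : loop R x0) : homotopic l l' ->
  path_homotopic X (unloop l) (unloop l').
Proof.
move=> [H [cH H0 H1 Hs]].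
exists (fun st => val (H (clamp st.1, clamp st.2))); split.
- apply: (continuousT_comp _ val_continuous).
  apply/continuous_subspace_setT.
  apply: (within_continuous_comp2 (f := fun st : R * R => (clamp st.1, clamp st.2)) _ _ cH).
    apply: continuous_subspaceT; apply: pair_continuous.
      by apply: (continuousT_comp _ clamp_continuous); continuity.
    by apply: (continuousT_comp _ clamp_continuous); continuity.
  by move=> st _; split; rewrite /= in_itv /=; exact: clamp_in.
- by move=> s t _ _; exact: set_typeP.
- by move=> t tI; rewrite /unloop /= clamp_id ?lexx ?ler01 // H0 // clamp_in.
- by move=> t tI; rewrite /unloop /= (@clamp_id _ 1) ?lexx ?ler01 // H1 // clamp_in.
- move=> s sI; rewrite /unloop /= !(@clamp_id _ 1, @clamp_id _ 0) ?lexx ?ler01 //.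
  by have [-> ->] := Hs _ (clamp_in s); rewrite loop0 loop1.
Qed.

Lemma unloop_mkloop f : based_in f -> path_homotopic X f (unloop (mkloop f)).
Proof.
move=> bf; apply: path_homotopic_eq; first by case: bf.
by move=> t tI; rewrite /unloop clamp_id // mkloopE.
Qed.

Lemma path_homotopic_pclass f g : based_in f -> based_in g -> pclass f = pclass g ->
  path_homotopic X f g.
Proof.
move=> bf bg /loop_classP/unloop_homotopic fg.
apply: path_homotopic_trans (unloop_mkloop bf) _.
apply: path_homotopic_trans fg _.
by apply: path_homotopic_sym; exact: unloop_mkloop.
Qed.

End BasedLoops.

Section PathClass.
Context {R : realType} {T : topologicalType} (X : set T) (x0 : set_type X).
Variable tau : T -> R -> T.
Hypothesis tauP : forall x, X x ->
  [/\ path_in X (tau x), tau x 0 = val x0 & tau x 1 = x].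
Hypothesis tau_base : tau (val x0) = fun=> val x0.
Implicit Types f g : R -> T.

(** A functor from the paths in [X] to the fundamental group: the path is closed
    up by the chosen paths [tau] from the base point to its ends. *)
Definition close f : R -> T :=
  concat_fun (concat_fun (tau (f 0)) f) (fun t => tau (f 1) (1 - t)).

Definition cls f : pi1 R x0 := pclass x0 (close f).

Lemma path_in0 f : path_in X f -> X (f 0).
Proof. by case=> _; apply; rewrite lexx ler01. Qed.

Lemma path_in1 f : path_in X f -> X (f 1).
Proof. by case=> _; apply; rewrite lexx ler01. Qed.

Let tau_path x : X x -> path_in X (tau x). Proof. by case/tauP. Qed.
Let tau_0 x : X x -> tau x 0 = val x0. Proof. by case/tauP. Qed.
Let tau_1 x : X x -> tau x 1 = x. Proof. by case/tauP. Qed.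

Lemma based_close f : path_in X f -> based_in x0 (close f).
Proof.
move=> Xf; have [X0 X1] := (path_in0 Xf, path_in1 Xf); split.
- apply: path_in_concat; rewrite ?concat_fun1 ?subr0 ?tau_1 //.
  + by apply: path_in_concat => //; rewrite ?tau_1 //; exact: tau_path.
  + by apply: path_in_rev; exact: tau_path.
- by rewrite /close !concat_fun0 tau_0.
- by rewrite /close concat_fun1 subrr tau_0.
Qed.

Lemma cls_homotopic f g : path_in X f -> path_in X g -> path_homotopic X f g ->
  cls f = cls g.
Proof.
move=> Xf Xg fg; apply: pclass_homotopic; try exact: based_close.
have [X0 X1] := (path_in0 Xf, path_in1 Xf).
rewrite /close; have [-> ->] := path_homotopic_ends fg.
apply: path_homotopic_concat.
- apply: path_homotopic_concat => //; last exact: tau_1.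
  by apply: path_homotopic_refl; exact: tau_path.
- by apply: path_homotopic_refl; apply: path_in_rev; exact: tau_path.
- by rewrite concat_fun1 subr0 tau_1.
Qed.

Lemma cls_eq f g : path_in X f -> path_in X g ->
  (forall t, 0 <= t <= 1 -> f t = g t) -> cls f = cls g.
Proof. by move=> Xf Xg fg; apply: cls_homotopic => //; exact: path_homotopic_eq. Qed.

Lemma cls_concat f g : path_in X f -> path_in X g -> f 1 = g 0 ->
  cls (concat_fun f g) = (cls f * cls g)%g.
Proof.
move=> Xf Xg fg; rewrite /cls -pclass_concat; try exact: based_close.
have Xfg := path_in_concat Xf Xg fg.
apply: pclass_homotopic; first exact: based_close.
  by apply: based_concat; exact: based_close.
have [[X0 X1] X2] := (path_in0 Xf, path_in1 Xf, path_in1 Xg).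
rewrite /close concat_fun0 concat_fun1.
have X0' : X (g 0) by rewrite -fg.
set a := tau (f 0); set b := tau (f 1); set c := tau (g 1).
have Xa : path_in X a by exact: tau_path.
have Xb : path_in X b by exact: tau_path.
have Xc : path_in X c by exact: tau_path.
have [Xb' Xc'] := (path_in_rev Xb, path_in_rev Xc).
have af : a 1 = f 0 by exact: tau_1.
have fb : f 1 = b (1 - 0) by rewrite subr0 /b tau_1.
have bg : b 1 = g 0 by rewrite /b tau_1.
have gc : g 1 = c (1 - 0) by rewrite subr0 /c tau_1.
have bb : b (1 - 1) = b 0 by rewrite subrr.
have -> : tau (g 0) = b by rewrite -fg.
have Xaf := path_in_concat Xa Xf af.
have Xbg := path_in_concat Xb Xg bg.
have P := fun f g Hf Hg => @path_in_concat R T X f g Hf Hg.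
(* [(a (f g)) c' ~ ((a f) g) c' ~ (a f) (g c')]
   and [((a f) b') ((b g) c') ~ (a f) (b' (b (g c'))) ~ (a f) (g c')] *)
have Xgc := P _ _ Xg Xc' gc.
have afgc : concat_fun a f 1 = concat_fun g (fun t => c (1 - t)) 0.
  by rewrite concat_fun1 concat_fun0.
apply: (@path_homotopic_trans _ _ _ (concat_fun (concat_fun a f) (concat_fun g (fun t => c (1 - t))))).
  apply: (@path_homotopic_trans _ _ _ (concat_fun (concat_fun (concat_fun a f) g) (fun t => c (1 - t)))).
    apply: path_homotopic_concat; last by rewrite !concat_fun1.
      exact: path_homotopic_concatA.
    exact: path_homotopic_refl.
  apply: path_homotopic_sym; apply: path_homotopic_concatA => //.
  by rewrite concat_fun1.
have b'b : (fun t : R => b (1 - t)) 1 = concat_fun b g 0 by rewrite concat_fun0 bb.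
apply: path_homotopic_sym.
have bgc : concat_fun b g 1 = c (1 - 0) by rewrite concat_fun1.
have Xbgc := P _ _ Xbg Xc' bgc.
apply: (@path_homotopic_trans _ _ _ (concat_fun (concat_fun a f)
   (concat_fun (fun t => b (1 - t)) (concat_fun (concat_fun b g) (fun t => c (1 - t)))))).
  apply: path_homotopic_sym; apply: path_homotopic_concatA => //.
  - by rewrite concat_fun1.
  - by rewrite !concat_fun0 bb.
have b'bg : concat_fun (fun t => b (1 - t)) b 1 = g 0 by rewrite concat_fun1.
have Xb'b := P _ _ Xb' Xb bb.
apply: path_homotopic_concat; last by rewrite concat_fun1 concat_fun0.
  exact: path_homotopic_refl.
apply: (@path_homotopic_trans _ _ _ (concat_fun (fun t => b (1 - t)) (concat_fun b (concat_fun g (fun t => c (1 - t)))))).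
  apply: path_homotopic_concat; last by rewrite !concat_fun0 bb.
    exact: path_homotopic_refl.
  by apply: path_homotopic_sym; exact: path_homotopic_concatA.
apply: (@path_homotopic_trans _ _ _ (concat_fun (concat_fun (fun t => b (1 - t)) b) (concat_fun g (fun t => c (1 - t))))).
  by apply: path_homotopic_concatA => //; rewrite concat_fun0.
apply: (@path_homotopic_trans _ _ _ (concat_fun (fun=> b 1) (concat_fun g (fun t => c (1 - t))))).
  apply: path_homotopic_concat; last by rewrite concat_fun1 concat_fun0.
    exact: path_homotopic_concatVl.
  exact: path_homotopic_refl.
by apply: path_homotopic_concat1l => //; rewrite concat_fun0.
Qed.

(** The constant path is pointwise equal to its concatenation with itself, so its class is
    idempotent. *)
Lemma cls_cst x : X x -> cls (fun=> x) = 1%g.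
Proof.
move=> Xx; have Xc : path_in X (fun _ : R => x) by exact: path_in_cst.
apply: (@mulgI _ (cls (fun=> x))); rewrite mulg1 -cls_concat //.
by apply: cls_eq => //; [exact: path_in_concat|move=> t _; rewrite /concat_fun; case: ifP].
Qed.

Lemma cls_rev f : path_in X f -> cls (fun t => f (1 - t)) = (cls f)^-1%g.
Proof.
move=> Xf; have Xr := path_in_rev Xf.
apply: (@mulgI _ (cls f)); rewrite mulgV -cls_concat ?subr0 //.
rewrite -(cls_cst (path_in0 Xf)); apply: cls_homotopic.
- by apply: path_in_concat; rewrite ?subr0.
- exact/path_in_cst/path_in0.
- exact: path_homotopic_concatV.
Qed.

(** As [tau] is constant at the base point, closing up a based loop only adds constant paths. *)
Lemma cls_based f : based_in x0 f -> cls f = pclass x0 f.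
Proof.
move=> bf; have [Xf f0 f1] := bf; apply: pclass_homotopic => //; first exact: based_close.
rewrite /close f0 f1 tau_base.
have X0 := @set_typeP T X x0.
apply: (@path_homotopic_trans _ _ _ (concat_fun (fun=> val x0) f)).
  apply: path_homotopic_concat1r; last by rewrite concat_fun1.
  by apply: path_in_concat => //; exact: path_in_cst.
exact: path_homotopic_concat1l.
Qed.

Definition seg (V : normedModType R) (F : V -> T) (p q : V) : R -> T :=
  fun t => F (p + t *: (q - p)).

Definition convex_subset (V : normedModType R) (E : set V) :=
  forall p q s, E p -> E q -> 0 <= s <= 1 -> E ((1 - s) *: p + s *: q).

Section Segments.
Context {V : normedModType R} (F : V -> T) (E : set V).
Hypothesis cF : continuous F.
Hypothesis EX : forall p, E p -> X (F p).
Hypothesis cvE : convex_subset E.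

Lemma seg_convex p q : E p -> E q -> path_in E (fun t : R => p + t *: (q - p)).
Proof.
move=> Ep Eq; split; first by continuity.
by move=> t tI; rewrite scalerBr addrCA addrC -[X in X - _]scale1r -scalerBl; exact: cvE.
Qed.

Lemma seg_path p q : E p -> E q -> path_in X (seg F p q).
Proof.
move=> Ep Eq; have [cs Es] := seg_convex Ep Eq.
by split; [exact: (continuousT_comp cs cF)|move=> t tI; exact/EX/Es].
Qed.

Lemma cls_convex (phi psi : R -> V) : path_in E phi -> path_in E psi ->
  phi 0 = psi 0 -> phi 1 = psi 1 ->
  cls (fun t => F (phi t)) = cls (fun t => F (psi t)).
Proof.
move=> Ephi Epsi e0 e1; apply: cls_homotopic.
- by case: Ephi => cphi H; split; [exact: (continuousT_comp cphi cF)|move=> t tI; exact/EX/H].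
- by case: Epsi => cphi H; split; [exact: (continuousT_comp cphi cF)|move=> t tI; exact/EX/H].
- exact: (@path_homotopic_convex _ _ V E).
Qed.

Lemma cls_seg_convex (phi : R -> V) p q : path_in E phi -> phi 0 = p -> phi 1 = q ->
  cls (fun t => F (phi t)) = cls (seg F p q).
Proof.
move=> Ephi <- <-; apply: cls_convex => //.
- by apply: seg_convex; case: Ephi => _; apply; rewrite lexx ler01.
- by rewrite scale0r addr0.
- by rewrite scale1r addrC subrK.
Qed.

(** Over a convex parameter set a class depends on the ends only. This exact identity on small
    convex pieces is what the later subdivisions are made of. *)
Lemma cls_seg_cocycle p q r : E p -> E q -> E r ->
  (cls (seg F p q) * cls (seg F q r))%g = cls (seg F p r).
Proof.
move=> Ep Eq Er; rewrite -cls_concat; try exact: seg_path; last first.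
  by rewrite /seg scale1r scale0r addr0 addrC subrK.
pose phi := concat_fun (fun t : R => p + t *: (q - p)) (fun t : R => q + t *: (r - q)).
have -> : concat_fun (seg F p q) (seg F q r) = fun t => F (phi t).
  by apply/funext => t; rewrite /phi /concat_fun /seg; case: ifP.
apply: cls_seg_convex.
- apply: path_in_concat; try exact: seg_convex.
  by rewrite scale1r scale0r addr0 addrC subrK.
- by rewrite /phi concat_fun0 scale0r addr0.
- by rewrite /phi concat_fun1 scale1r addrC subrK.
Qed.

End Segments.

Lemma convex_unit_interval : convex_subset [set t : R^o | 0 <= t <= 1].
Proof. by move=> p q s /= pI qI sI; rewrite /GRing.scale /=; apply/andP; split; nra. Qed.

Lemma seg01 f : seg (f : R^o -> T) 0 1 = f.
Proof. by apply/funext => t; rewrite /seg subr0 add0r /GRing.scale /= mulr1. Qed.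

(** Both products are the class of the image of the diagonal of the unit square. *)
Lemma cls_square (F : R * R -> T) : continuous F ->
  (forall s t : R, 0 <= s <= 1 -> 0 <= t <= 1 -> X (F (s, t))) ->
  (cls (fun s => F (s, 0%R)) * cls (fun t => F (1%R, t)))%g =
  (cls (fun t => F (0%R, t)) * cls (fun s => F (s, 1%R)))%g.
Proof.
move=> cF XF; pose E : set (R * R)%type := [set st | 0 <= st.1 <= 1 /\ 0 <= st.2 <= 1].
have EX st : E st -> X (F st) by case: st => s t [sI tI]; exact: XF.
have cvE : convex_subset E.
  move=> [p1 p2] [q1 q2] s [/= pI1 pI2] [/= qI1 qI2] sI; rewrite /E /= /GRing.scale /=.
  by split; apply/andP; split; nra.
have I0 : 0 <= (0 : R) <= 1 by lra.
have I1 : 0 <= (1 : R) <= 1 by lra.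
have e1 : (fun s => F (s, 0)) = seg F ((0, 0) : R * R) ((1, 0) : R * R).
  by apply/funext => t; rewrite /seg; congr (F (_, _)); rewrite /= /GRing.scale /=; ring.
have e2 : (fun t => F (1, t)) = seg F ((1, 0) : R * R) ((1, 1) : R * R).
  by apply/funext => t; rewrite /seg; congr (F (_, _)); rewrite /= /GRing.scale /=; ring.
have e3 : (fun t => F (0, t)) = seg F ((0, 0) : R * R) ((0, 1) : R * R).
  by apply/funext => t; rewrite /seg; congr (F (_, _)); rewrite /= /GRing.scale /=; ring.
have e4 : (fun t => F (t, 1)) = seg F ((0, 1) : R * R) ((1, 1) : R * R).
  by apply/funext => t; rewrite /seg; congr (F (_, _)); rewrite /= /GRing.scale /=; ring.
by rewrite e1 e2 e3 e4 !(cls_seg_cocycle cF EX cvE).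
Qed.

End PathClass.

(** * Morphisms from local cocycles *)

Section Holonomy.
Context {R : realType} {T : topologicalType} (X : set T) (K : groupType).
Variable c : T -> T -> K.
Hypothesis cocycle : forall q, X q -> exists2 B, nbhs q B &
  forall x y z, X x -> X y -> X z -> B x -> B y -> B z -> (c x y * c y z)%g = c x z.
Implicit Types f g : R -> T.

(** A primitive of the cocycle along the path: its local increments are the values of [c]. The
    holonomy [hol] is the total increment, like the integral of a closed form. *)
Definition development f (kappa : R -> K) :=
  forall q, 0 <= q <= 1 -> exists2 e, 0 < e & forall s t,
    0 <= s <= 1 -> 0 <= t <= 1 -> `|q - s| < e -> `|q - t| < e ->
    (kappa s * c (f s) (f t))%g = kappa t.

Lemma pullback_cocycle (V : normedModType R) (S : set V) (F : V -> T) :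
  continuous F -> (forall p, S p -> X (F p)) -> forall q, S q ->
  exists2 e, 0 < e & forall x y z, S x -> S y -> S z ->
   `|q - x| < e -> `|q - y| < e -> `|q - z| < e ->
   (c (F x) (F y) * c (F y) (F z))%g = c (F x) (F z).
Proof.
move=> cF SX q Sq; have [B nB hB] := cocycle (SX _ Sq).
have /nbhs_ballP[e /= e0 eB] : nbhs q (F @^-1` B) by exact: cF.
exists e => // x y z Sx Sy Sz qx qy qz.
by apply: hB; try exact: SX; apply: eB; rewrite -ball_normE.
Qed.

Lemma development_exists f : path_in X f -> exists kappa, development f kappa.
Proof.
move=> [cf Xf].
have [kap [e e0 hk]] : exists kappa : R^o -> K, exists2 e : R, 0 < e &
    forall x y : R^o, `[0, 1]%classic x -> `[0, 1]%classic y -> `|x - y| < e ->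
    (kappa x * c (f x) (f y))%g = kappa y.
  apply: (@cocycle_potential R R^o `[0, 1]%classic K (fun s t => c (f s) (f t))).
  - exact: segment_compact.
  - move=> p t; rewrite /= !in_itv /= /GRing.scale /= => pI tI.
    by apply/andP; split; nra.
  - apply: (@pullback_cocycle R^o) => // p; rewrite /= in_itv /=; exact: Xf.
exists kap => q qI; exists (e / 2); first by lra.
move=> s t sI tI qs qt; apply: hk; rewrite /= ?in_itv //=.
by have := ler_distD q s t; rewrite (distrC s q); lra.
Qed.

(** The quotient [k s * (k' s)^-1] of two primitives is locally constant on [[0, 1]]. *)
Lemma development_unique f k k' : development f k -> development f k' ->
  ((k 0%R)^-1 * k 1%R = (k' 0%R)^-1 * k' 1%R)%g.
Proof.
move=> dk dk'.
suff : (k 0%R * (k' 0%R)^-1 = k 1%R * (k' 1%R)^-1)%g.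
  by move=> e; rewrite -(mulgVK (k' 1%R) (k 1%R)) -e !mulgA mulVg mul1g.
apply: (@connected_unit_interval R K (fun s => k s * (k' s)^-1)%g); try lra.
move=> q qI; have [e e0 he] := dk q qI; have [e' e0' he'] := dk' q qI.
exists (Num.min e e'); first by rewrite lt_min e0.
move=> s t sI tI; rewrite !lt_min => /andP[s1 s2] /andP[t1 t2].
by rewrite -(he s t) // -(he' s t) // invgM mulgA mulgK.
Qed.

(** By [development_exists] the default value does not occur for paths in [X]. *)
Definition hol f : K :=
  if pselect (exists kappa, development f kappa) is left e
  then let k := projT1 (cid e) in ((k 0%R)^-1 * k 1%R)%g else 1%g.

Lemma hol_development f k : development f k -> hol f = ((k 0%R)^-1 * k 1%R)%g.
Proof.
move=> dk; rewrite /hol; case: pselect => [e|]; last by case; exists k.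
by apply: development_unique dk; case: cid.
Qed.

(** Where the cocycle identity holds on the whole of [S], the map [t |-> c (f 0) (f t)] is itself a
    primitive. *)
Lemma hol_cocycle (S : set T) f :
  (forall x y z, S x -> S y -> S z -> (c x y * c y z)%g = c x z) ->
  path_in S f -> hol f = c (f 0) (f 1).
Proof.
move=> hS [cf Sf].
have S0 : S (f 0) by apply: Sf; lra.
have c1 : c (f 0) (f 0) = 1%g by apply: (@mulgI _ (c (f 0) (f 0))); rewrite mulg1 hS.
rewrite (@hol_development _ (fun t => c (f 0) (f t))) ?c1 ?invg1 ?mul1g //.
move=> q qI; exists 1 => // s t sI tI _ _; rewrite hS //; exact: Sf.
Qed.

Lemma development_eq f g k : (forall t, 0 <= t <= 1 -> f t = g t) ->
  development f k -> development g k.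
Proof.
move=> fg dk q qI; have [e e0 he] := dk q qI; exists e => // s t sI tI.
by rewrite -!fg //; exact: he.
Qed.

(** A potential on the whole square restricts to a primitive along every path of the homotopy. It is
    constant along the two sides on which the homotopy does not move, because [c x x = 1]. *)
Lemma hol_homotopic f g : path_homotopic X f g -> path_in X f -> path_in X g ->
  hol f = hol g.
Proof.
move=> [H [cH XH H0 H1 Hs]] Xf Xg.
pose S : set (R * R)%type := (`[0, 1]%classic : set R) `*` (`[0, 1]%classic : set R).
have SX p : S p -> X (H p).
  by case: p => s t [] /=; rewrite !in_itv /= => sI tI; exact: XH.
have [kap [e e0 hk]] : exists kappa : R * R -> K, exists2 e : R, 0 < e &
    forall x y : R * R, S x -> S y -> `|x - y| < e ->
    (kappa x * c (H x) (H y))%g = kappa y.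
  apply: (@cocycle_potential R _ S K (fun s t => c (H s) (H t))).
  - by apply: compact_setX; exact: segment_compact.
  - move=> [p1 p2] t [] /=; rewrite /S /= !in_itv /= /GRing.scale /= => p1I p2I tI.
    by split; apply/andP; split; nra.
  - exact: pullback_cocycle.
have normp (a b : R) : `|(a, b) : R * R| = Num.max `|a| `|b| by [].
have SI (s t : R) : 0 <= s <= 1 -> 0 <= t <= 1 -> S (s, t).
  by move=> sI tI; split; rewrite /= in_itv.
have side (s : R) : 0 <= s <= 1 -> development (fun t => H (s, t)) (fun t => kap (s, t)).
  move=> sI q qI; exists (e / 2); first by lra.
  move=> u t uI tI qu qt; apply: hk; try exact: SI.
  rewrite (_ : (s, u) - (s, t) = (0, u - t) :> R * R); last by congr (_, _); rewrite /= ?subrr.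
  rewrite normp normr0 gt_max e0 /=.
  by have := ler_distD q u t; rewrite (distrC u q); lra.
have I0 : 0 <= (0 : R) <= 1 by lra.
have I1 : 0 <= (1 : R) <= 1 by lra.
have cst (t : R) (x : T) : 0 <= t <= 1 -> (forall s, 0 <= s <= 1 -> H (s, t) = x) ->
    kap (0, t) = kap (1, t).
  move=> tI Hx.
  apply: (@connected_unit_interval R K (fun s => kap (s, t))) => // q qI.
  exists (e / 2); first by lra.
  move=> u s uI sI qu qs; rewrite -(hk (u, t) (s, t)); try exact: SI.
    have Xx : X x by rewrite -(Hx _ uI); exact: XH.
    have [B nB hB] := cocycle Xx; have Bx := nbhs_singleton nB.
    rewrite !Hx //; have c1 : c x x = 1%g by apply: (@mulgI _ (c x x)); rewrite mulg1 hB.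
    by rewrite c1 mulg1.
  rewrite (_ : (u, t) - (s, t) = (u - s, 0) :> R * R); last by congr (_, _); rewrite /= ?subrr.
  rewrite normp normr0 gt_max e0 andbT.
  by have := ler_distD q u s; rewrite (distrC u q); lra.
have e1 := cst 0 (f 0) I0 (fun s sI => (Hs s sI).1).
have e2 := cst 1 (f 1) I1 (fun s sI => (Hs s sI).2).
rewrite (hol_development (development_eq H0 (side 0 I0))).
rewrite (hol_development (development_eq H1 (side 1 I1))).
by rewrite e1 e2.
Qed.

(** The two halves of a primitive along the concatenation, rescaled, are primitives along the two
    paths. *)
Lemma hol_concat f g : path_in X f -> path_in X g -> f 1 = g 0 ->
  hol (concat_fun f g) = (hol f * hol g)%g.
Proof.
move=> Xf Xg fg; have Xfg := path_in_concat Xf Xg fg.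
have [k dk] := development_exists Xfg.
have d1 : development f (fun t => k (t / 2)).
  move=> q qI; have [|e e0 he] := dk (q / 2); first by lra_skip T.
  exists e => // s t sI tI qs qt; rewrite -(he (s / 2) (t / 2)).
  - by rewrite /concat_fun !ifT; [congr (_ * c _ _)%g; congr f; field| |]; lra_skip T.
  - by lra_skip T.
  - by lra_skip T.
  - by rewrite -mulrBl normrM (@ger0_norm _ 2^-1); have := normr_ge0 (q - s); lra_skip T.
  - by rewrite -mulrBl normrM (@ger0_norm _ 2^-1); have := normr_ge0 (q - t); lra_skip T.
have gE (t : R) : 0 <= t <= 1 -> concat_fun f g ((t + 1) / 2) = g t.
  move=> tI; rewrite /concat_fun; case: ifPn => [h|_]; last by congr g; field.
  have -> : t = 0 by lra_skip T.
  by rewrite -fg; congr f; field.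
have d2 : development g (fun t => k ((t + 1) / 2)).
  move=> q qI; have [|e e0 he] := dk ((q + 1) / 2); first by lra_skip T.
  exists e => // s t sI tI qs qt; rewrite -(he ((s + 1) / 2) ((t + 1) / 2)).
  - by rewrite !gE.
  - by lra_skip T.
  - by lra_skip T.
  - rewrite -mulrBl (_ : _ - _ = q - s); last by ring.
    by rewrite normrM (@ger0_norm _ 2^-1); have := normr_ge0 (q - s); lra_skip T.
  - rewrite -mulrBl (_ : _ - _ = q - t); last by ring.
    by rewrite normrM (@ger0_norm _ 2^-1); have := normr_ge0 (q - t); lra_skip T.
rewrite (hol_development dk) (hol_development d1) (hol_development d2).
rewrite mul0r add0r mul1r (_ : (1 + 1) / 2 = 1); last by field.
by rewrite -!mulgA mulVKg.
Qed.

Lemma hol_rev f : path_in X f -> hol (fun t => f (1 - t)) = (hol f)^-1%g.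
Proof.
move=> Xf; have Xr := path_in_rev Xf.
have X0 : X (f 0) by exact: path_in0 Xf.
apply: (@mulgI _ (hol f)); rewrite mulgV -hol_concat ?subr0 //.
rewrite (hol_homotopic (path_homotopic_concatV Xf)); last 2 first.
- by apply: path_in_concat; rewrite ?subr0.
- exact: path_in_cst.
rewrite (@hol_cocycle [set f 0]) //; last 1 first.
- by split => //; exact: continuousT_cst.
- have [B nB hB] := cocycle X0; have Bx := nbhs_singleton nB.
  by apply: (@mulgI _ (c (f 0) (f 0))); rewrite mulg1 hB.
- have [B nB hB] := cocycle X0; have Bx := nbhs_singleton nB.
  by move=> x y z -> -> ->; rewrite hB.
Qed.

Lemma hol_morphism (x0 : set_type X) : exists h : {multiplicative pi1 R x0 -> K},
  forall f, based_in x0 f -> h (pclass x0 f) = hol f.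
Proof.
pose h (g : pi1 R x0) := hol (unloop (loop_repr g)).
have hE f : based_in x0 f -> h (pclass x0 f) = hol f.
  move=> bf; have b := unloop_based (loop_repr (pclass x0 f)).
  apply: hol_homotopic; last by case: bf.
    by apply: (path_homotopic_pclass (x0 := x0)) => //; exact: pclass_repr.
  by case: b.
have hM : {morph h : x y / (x * y)%g}.
  move=> x y; have [f bf <-] := pclass_surj x; have [g bg <-] := pclass_surj y.
  rewrite -pclass_concat // !hE //; last exact: based_concat.
  case: bf bg => [Xf f0 f1] [Xg g0 g1]; apply: hol_concat => //.
  by rewrite f1.
by exists (HB.pack_for {multiplicative pi1 R x0 -> K} h (isMultiplicative.Build _ _ h hM)).
Qed.

Lemma hol_close (x0 : set_type X) (tau : T -> R -> T)
    (tauP : forall x, X x -> [/\ path_in X (tau x), tau x 0 = val x0 & tau x 1 = x]) f :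
  path_in X f -> hol (close tau f) = (hol (tau (f 0%R)) * hol f * (hol (tau (f 1%R)))^-1)%g.
Proof.
move=> Xf; have [X0 X1] := (path_in0 Xf, path_in1 Xf).
have [P0 s0 t0] := tauP _ X0; have [P1 s1 t1] := tauP _ X1.
rewrite /close hol_concat ?hol_concat // ?concat_fun1 ?subr0 //.
- by rewrite hol_rev.
- exact: path_in_concat.
- exact: path_in_rev.
Qed.

End Holonomy.

(** * Complements of graphs over the plane *)

Section FiniteAvoidance.
Context {R : realType}.

(** Pigeonhole: one of the [size Z + 1] distinct numbers [e / (k + 2)] is missing from [Z]. *)
Lemma pos_notin (Z : seq R) (e : R) : 0 < e -> exists2 t, 0 < t < e & t \notin Z.
Proof.
move=> e0.
pose f (k : nat) : R := e / k.+2%:R.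
have fI k : 0 < f k < e.
  rewrite /f divr_gt0 ?ltr0n //= ltr_pdivrMr ?ltr0n //.
  by rewrite ltr_pMr // ltr1n.
have finj : injective f.
  move=> k l; rewrite /f => /(mulfI (lt0r_neq0 e0))/invr_inj/eqP.
  by rewrite eqr_nat => /eqP[].
have [/allP H|/allPn[t /mapP[k _ ->] tZ]] := boolP (all (mem Z) (map f (iota 0 (size Z).+1))).
  have u : uniq (map f (iota 0 (size Z).+1)) by rewrite map_inj_uniq // iota_uniq.
  by have := uniq_leq_size u H; rewrite size_map size_iota ltnn.
by exists (f k).
Qed.

Lemma fin_pos_lower_bound (I : finType) (f : I -> R) : (forall i, 0 < f i) ->
  exists2 m, 0 < m & forall i, m <= f i.
Proof.
move=> f0; suff [m m0 hm] : exists2 m, 0 < m & forall i, i \in enum I -> m <= f i.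
  by exists m => // i; apply: hm; rewrite mem_enum.
elim: (enum I) => [|i s [m m0 hm]]; first by exists 1.
exists (Num.min m (f i)); first by rewrite lt_min m0 f0.
by move=> j; rewrite inE ge_min => /predU1P[->|/hm ->] //; rewrite lexx orbT.
Qed.

Lemma seq_upper_bound (s : seq R) : exists M, forall x, x \in s -> x < M.
Proof.
elim: s => [|x s [M hM]]; first by exists 0.
exists (Num.max M (x + 1)) => y; rewrite inE lt_max => /predU1P[->|/hM ->] //.
by rewrite ltrDl ltr01 orbT.
Qed.

End FiniteAvoidance.

Section Plane.
Context {R : realType}.
Local Notation plane := (R * R)%type.
Implicit Types (p q : plane) (Z : seq plane).

Lemma plane_normE (x y : R) : `|(x, y) : plane| = Num.max `|x| `|y|.
Proof. by []. Qed.

Lemma plane_norm_lt p (e : R) : (`|p| < e) = (`|p.1| < e) && (`|p.2| < e).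
Proof. by case: p => x y; rewrite plane_normE gt_max. Qed.

Lemma plane_minus_finite Z p q : p \notin Z -> q \notin Z ->
  exists f : R -> plane, [/\ path_in [set x | x \notin Z] f, f 0 = p & f 1 = q].
Proof.
move=> pZ qZ.
(* The path runs through a point [m] on the vertical line of abscissa [X0], by two segments. As [X0]
   differs from both end abscissae, neither segment is vertical, and each point of [Z] excludes at
   most one height of [m] for each of them; [bad] lists these heights. *)
have [X0 _] := pos_notin [:: p.1; q.1] ltr01.
rewrite !inE negb_or => /andP[Xp Xq].
pose bad p := [seq p.2 + (z.2 - p.2) * (X0 - p.1) / (z.1 - p.1) | z <- Z].
have [t _] := pos_notin (bad p ++ bad q) ltr01; rewrite mem_cat negb_or => /andP[tp tq].
pose m : plane := (X0, t).
have avoid p0 : p0 \notin Z -> X0 != p0.1 -> t \notin bad p0 ->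
    forall s : R, p0 + s *: (m - p0) \notin Z.
  move=> p0Z Xp0 tp0 s; apply/negP => zZ.
  have [s0|s0] := eqVneq s 0; first by rewrite s0 scale0r addr0 (negPf p0Z) in zZ.
  move/negP: tp0; apply; apply/mapP; exists (p0 + s *: (m - p0)) => //=.
  case: p0 Xp0 {p0Z zZ} => x y /= Xx; rewrite /GRing.scale /=.
  rewrite (addrC y (s * _)) addrK (addrC x) addrK.
  by field; rewrite s0 subr_eq0 Xx.
pose f := concat_fun (fun t : R => p + t *: (m - p)) (fun t : R => q + (1 - t) *: (m - q)).
exists f; split.
- apply: path_in_concat; first 2 last.
  + by rewrite scale1r subr0 scale1r !(addrC _ (m - _)) !subrK.
  + split; first by continuity.
    by move=> s _; exact: avoid.
  + split; first by continuity.
    by move=> s _; exact: avoid.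
- by rewrite /f concat_fun0 scale0r addr0.
- by rewrite /f concat_fun1 subrr scale0r addr0.
Qed.

End Plane.

Section Transport.
Context {R : realType}.
Local Notation plane := (R * R)%type.
Variables (J : finType) (beta : J -> plane -> plane).
Hypothesis beta_continuous : forall j, continuous (beta j).
Hypothesis beta_bounded : forall j u, `|beta j u| <= 1.

(** At distance at least [3] from the graphs, which stay in the unit ball, it lies outside all the
    discs of radius [2 * rho <= 2] that [transport] moves. *)
Definition winf : plane := (4, 0).

Definition fibre (u : plane) : set plane := [set w | forall j, w != beta j u].

(** Moves the [w]-plane so that the points [beta j u] go to the points [beta j u'],
    keeping the complement of their discs of radius [2 * rho] fixed. *)
Definition transport (rho : R) (u u' w : plane) : plane :=
  w + \sum_j Num.max 0 (1 - `|w - beta j u| / (2 * rho)) *: (beta j u' - beta j u).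

Lemma transport_continuous (X : topologicalType) rho (f g h : X -> plane) :
  continuous f -> continuous g -> continuous h ->
  continuous (fun x => transport rho (f x) (g x) (h x)).
Proof.
move=> cf cg ch; rewrite /transport; apply: continuousT_add => //.
elim: (index_enum J) => [|j s IH].
  rewrite (_ : (fun x => _) = fun=> 0); first exact: continuousT_cst.
  by apply/funext => x; rewrite big_nil.
rewrite (_ : (fun x => _) = fun x => Num.max 0 (1 - `|h x - beta j (f x)| / (2 * rho)) *:
    (beta j (g x) - beta j (f x)) + \sum_(j <- s) Num.max 0 (1 - `|h x - beta j (f x)| / (2 * rho)) *:
    (beta j (g x) - beta j (f x))); last by apply/funext => x; rewrite big_cons.
have c1 := continuousT_comp cf (beta_continuous (j := j)).
have c2 := continuousT_comp cg (beta_continuous (j := j)).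
by apply: continuousT_add => //; continuity.
Qed.

Lemma transport_id rho u w : transport rho u u w = w.
Proof. by rewrite /transport big1 ?addr0 // => j _; rewrite subrr scaler0. Qed.

(** With motions below [rho] and mutual distances at least [4 * rho], the discs of radius [2 * rho]
    around the points [beta j u] are disjoint, and a moved point cannot collide with another point
    of the fibre. The bound [rho <= 1] keeps [winf] outside the discs. *)
Definition nearly_constant (q : plane) (e rho : R) := [/\ 0 < e, 0 < rho <= 1,
  forall j u u', `|q - u| < e -> `|q - u'| < e -> `|beta j u - beta j u'| < rho &
  forall j k u, j != k -> `|q - u| < e -> 4 * rho <= `|beta j u - beta k u|].

Lemma nearly_constant_exists q : injective (beta ^~ q) ->
  exists e rho, nearly_constant q e rho.
Proof.
move=> inj.
have [s s0 hs] : exists2 s : R, 0 < s & forall jk : J * J,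
    s <= if jk.1 == jk.2 then 1 else `|beta jk.1 q - beta jk.2 q|.
  apply: fin_pos_lower_bound => -[j k] /=; case: eqVneq => // jk.
  by rewrite normr_gt0 subr_eq0; apply: contra jk => /eqP/inj ->.
(* Each graph will move by less than [rho / 2] from its value at [q], so the distance of two of them
   drops by less than [rho] below [s]; then [5 * rho <= s] leaves [4 * rho]. *)
pose rho := Num.min 1 (s / 5).
have r0 : 0 < rho by rewrite lt_min ltr01 divr_gt0.
have r1 : rho <= 1 by rewrite ge_min lexx.
have rs : 5 * rho <= s by have : rho <= s / 5 by [rewrite ge_min lexx orbT]; lra.
have [e e0 he] : exists2 e, 0 < e & forall j u, `|q - u| < e -> `|beta j q - beta j u| < rho / 2.
  have H j : exists2 e, 0 < e & forall u, `|q - u| < e -> `|beta j q - beta j u| < rho / 2.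
    have r2 : 0 < rho / 2 by lra.
    have /cvgrPdist_lt/(_ _ r2)/nbhs_ballP[e /= e0 H] := @beta_continuous j q.
    by exists e => // u qu; apply: H; rewrite -ball_normE.
  have [f f0 hf] : exists2 f : J -> R, (forall j, 0 < f j) & forall j u,
      `|q - u| < f j -> `|beta j q - beta j u| < rho / 2.
    have /choice[f hf] : forall j, exists e, 0 < e /\ forall u, `|q - u| < e -> `|beta j q - beta j u| < rho / 2.
      by move=> j; have [e] := H j; exists e.
    by exists f => j; case: (hf j).
  have [e e0 he] := fin_pos_lower_bound f0.
  by exists e => // j u qu; apply: hf; exact: lt_le_trans (he j).
exists e, rho; split => //; first by rewrite r0.
  move=> j u u' qu qu'; have := ler_distD (beta j q) (beta j u) (beta j u').
  by have := he j u qu; have := he j u' qu'; rewrite (distrC (beta j u) (beta j q)); lra.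
move=> j k u jk qu; have := hs (j, k); rewrite /= (negPf jk) => sjk.
have h1 := he j u qu; have h2 := he k u qu.
have h3 := ler_distD (beta j u) (beta j q) (beta k q).
have h4 := ler_distD (beta k u) (beta j u) (beta k q).
by rewrite (distrC (beta k u)) in h4; lra.
Qed.

Section NearlyConstant.
Variables (q : plane) (e rho : R).
Hypothesis nc : nearly_constant q e rho.

(** A point lies in at most one moved disc. At distance [z] from the centre of that disc, its
    displacement differs from that of the centre by less than [z / 2], so it does not hit the
    centre. From every other graph it is at distance at least [2 * rho], and both move by less than
    [rho]. *)
Lemma transport_fibre u u' w : `|q - u| < e -> `|q - u'| < e ->
  fibre u w -> fibre u' (transport rho u u' w).
Proof.
case: nc => e0 /andP[r0 r1] osc sep qu qu' wu j.
have [[k kw]|far] := pselect (exists k, `|w - beta k u| < 2 * rho).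
- have other l : l != k -> 2 * rho <= `|w - beta l u|.
    move=> lk; have := sep _ _ _ lk qu; have := ler_distD w (beta l u) (beta k u).
    by rewrite (distrC (beta l u) w); lra.
  have l0 l : l != k -> Num.max 0 (1 - `|w - beta l u| / (2 * rho)) = 0.
    move=> lk; apply/max_idPl; rewrite subr_le0 ler_pdivlMr; last by lra.
    by rewrite mul1r other.
  rewrite /transport (bigD1 k) //= big1 ?addr0; last by move=> l lk; rewrite l0 // scale0r.
  have dk := osc k _ _ qu' qu.
  set z := `|w - beta k u|; set d := beta k u' - beta k u.
  have lE : Num.max 0 (1 - z / (2 * rho)) = 1 - z / (2 * rho).
    by apply/max_idPr; rewrite subr_ge0 ler_pdivrMr ?mul1r ?ltW //; lra.
  rewrite lE.
  have z0 : 0 < z by rewrite normr_gt0 subr_eq0; exact: wu.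
  have zr : 0 < z / (2 * rho) by rewrite divr_gt0 //; lra.
  have zr1 : z / (2 * rho) < 1 by rewrite ltr_pdivrMr ?mul1r //; lra.
  have [->|jk] := eqVneq j k.
    rewrite -subr_eq0 (_ : _ - _ = (w - beta k u) - (z / (2 * rho)) *: d); last first.
      rewrite scalerBl scale1r /d; set x := _ *: _.
      by rewrite addrA addrAC [w + _]addrC -addrA; ring.
    apply/eqP => /subr0_eq E.
    have zE : z = z / (2 * rho) * `|d| by rewrite {1}/z E normrZ gtr0_norm.
    have : z <= z / (2 * rho) * rho by rewrite [leLHS]zE ler_pM2l // ltW.
    have -> : z / (2 * rho) * rho = z / 2 by field; rewrite gt_eqF.
    by move: z0; lra.
  rewrite -subr_eq0 -normr_gt0.
  have o := other j jk; have dj := osc j _ _ qu qu'.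
  have h1 := ler_distD (w + (1 - z / (2 * rho)) *: d) w (beta j u).
  have h2 := ler_distD (beta j u') (w + (1 - z / (2 * rho)) *: d) (beta j u).
  have h3 : `|w - (w + (1 - z / (2 * rho)) *: d)| < rho.
    rewrite opprD addrA subrr add0r normrN normrZ ger0_norm; last by lra.
    by apply: le_lt_trans dk; rewrite ler_piMl //; lra.
  by rewrite (distrC (beta j u')) in h2; lra.
- rewrite /transport big1 ?addr0; last first.
    move=> k _; suff -> : Num.max 0 (1 - `|w - beta k u| / (2 * rho)) = 0 by rewrite scale0r.
    apply/max_idPl; rewrite subr_le0 ler_pdivlMr ?mul1r; last by lra.
    by rewrite leNgt; apply/negP => kw; apply: far; exists k.
  apply/eqP => wE; apply: far; exists j; rewrite wE.
  by have := osc j _ _ qu' qu; lra.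
Qed.

Lemma winf_far j u : 3 <= `|winf - beta j u|.
Proof.
have : `|winf| = 4 :> R by rewrite /winf plane_normE normr0 ger0_norm // max_l.
have := ler_dist_dist winf (beta j u); have := beta_bounded j u.
by move=> h1 h2 h3; have := ler_norm (`|winf| - `|beta j u|); lra.
Qed.

Lemma winf_fibre u : fibre u winf.
Proof. by move=> j; rewrite -subr_eq0 -normr_gt0; have := winf_far j u; lra. Qed.

Lemma transport_winf u u' : transport rho u u' winf = winf.
Proof.
case: nc => e0 /andP[r0 r1] _ _; rewrite /transport big1 ?addr0 // => j _.
suff -> : Num.max 0 (1 - `|winf - beta j u| / (2 * rho)) = 0 by rewrite scale0r.
apply/max_idPl; rewrite subr_le0 ler_pdivlMr ?mul1r; last by lra.
by have := winf_far j u; lra.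
Qed.

End NearlyConstant.

End Transport.

(** * Generated subgroups, convex sets and rectangles *)

Section Generated.
Variable G : groupType.

(** The generated subgroup as an intersection of all stable properties: applied to a property, it is
    an induction on generators. *)
Definition generated (S : G -> Prop) (g : G) := forall P : G -> Prop,
  P 1%g -> (forall x y, P x -> P y -> P (x * y)%g) -> (forall x, P x -> P x^-1%g) ->
  (forall x, S x -> P x) -> P g.

Lemma generated1 S : generated S 1%g. Proof. by []. Qed.

Lemma generatedM S x y : generated S x -> generated S y -> generated S (x * y)%g.
Proof. by move=> Sx Sy P P1 PM PV PS; apply: (PM); [exact: (Sx P P1 PM PV PS)|exact: (Sy P P1 PM PV PS)]. Qed.

Lemma generatedV S x : generated S x -> generated S x^-1%g.
Proof. by move=> Sx P P1 PM PV PS; apply: (PV); exact: (Sx P P1 PM PV PS). Qed.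

Lemma generated_in (S : G -> Prop) x : S x -> generated S x.
Proof. by move=> Sx P _ _ _; apply. Qed.

Lemma generated_sub (S S' : G -> Prop) x : (forall y, S y -> generated S' y) ->
  generated S x -> generated S' x.
Proof.
move=> SS' Sx; apply: (Sx (generated S') (@generated1 S')) => // [y z|y].
  exact: generatedM.
exact: generatedV.
Qed.

Lemma conj_comp (p q s c d : G) :
  (p * c * q^-1 * (q * d * s^-1) = p * (c * d) * s^-1)%g.
Proof. by rewrite !mulgA mulgVK. Qed.

End Generated.

Section Convex.
Context {R : realType}.
Local Notation plane := (R * R)%type.

Lemma seg_combination (V : normedModType R) (p q : V) (t : R) :
  p + t *: (q - p) = (1 - t) *: p + t *: q.
Proof. by rewrite scalerBr scalerBl scale1r (addrC (t *: q)) addrA. Qed.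

Lemma convex_setI (V : normedModType R) (E F : set V) :
  convex_subset E -> convex_subset F -> convex_subset (E `&` F).
Proof. by move=> cE cF p q s [Ep Fp] [Eq Fq] sI; split; [exact: cE|exact: cF]. Qed.

Lemma convex_lt1 c : convex_subset [set u : plane | u.1 < c].
Proof. by move=> p q s; exact: convex_lt. Qed.
Lemma convex_gt1 c : convex_subset [set u : plane | c < u.1].
Proof. by move=> p q s; exact: convex_gt. Qed.
Lemma convex_lt2 c : convex_subset [set u : plane | u.2 < c].
Proof. by move=> p q s; exact: convex_lt. Qed.
Lemma convex_gt2 c : convex_subset [set u : plane | c < u.2].
Proof. by move=> p q s; exact: convex_gt. Qed.

Lemma convex_ball (V : normedModType R) (q : V) (e : R) : convex_subset [set u | `|q - u| < e].
Proof.
move=> u v s /= qu qv sI.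
have -> : q - ((1 - s) *: u + s *: v) = (1 - s) *: (q - u) + s *: (q - v).
  rewrite !scalerBr addrACA -scalerDl subrK scale1r opprD //.
apply: (@le_lt_trans _ _ ((1 - s) * `|q - u| + s * `|q - v|)); last exact: convex_lt.
apply: (le_trans (ler_normD _ _)); rewrite !normrZ !ger0_norm //; lra.
Qed.

End Convex.

Section Rectangle.
Variables (G : groupType) (S : Type) (s : S -> S -> G).
Variables (u t tY lY rY l rr c1 c2 c3 c4 : S).

(** A rectangular loop shrunk to the square [c1 c2 c3 c4] based at [t]. *)
Lemma rectangle_shrink :
  (s u tY * s tY lY)%g = s u lY -> (s tY t * s t lY)%g = s tY lY ->
  (s t c1 * s c1 lY)%g = s t lY -> (s c1 lY * s lY l)%g = s c1 l ->
  (s c1 c2 * s c2 l)%g = s c1 l ->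
  (s u tY * s tY rY)%g = s u rY -> (s tY t * s t rY)%g = s tY rY ->
  (s t c4 * s c4 rY)%g = s t rY -> (s c4 rY * s rY rr)%g = s c4 rr ->
  (s c4 c3 * s c3 rr)%g = s c4 rr ->
  (s c2 l * s l rr)%g = s c2 rr -> (s c2 c3 * s c3 rr)%g = s c2 rr ->
  (s c4 c3)^-1%g = s c3 c4 -> (s t c4)^-1%g = s c4 t ->
  (s u lY * s lY l * s l rr * (s u rY * s rY rr)^-1 =
   (s u tY * s tY t) * (s t c1 * s c1 c2 * s c2 c3 * s c3 c4 * s c4 t) *
   (s u tY * s tY t)^-1)%g.
Proof.
move=> e1 e2 e3 e4 e5 f1 f2 f3 f4 f5 g1 g2 v1 v2.
have -> : (s u lY * s lY l * s l rr)%g = (s u tY * s tY t * s t c1 * s c1 c2 * s c2 c3 * s c3 rr)%g.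
  rewrite -e1 -e2 -e3 !mulgA -(mulgA _ (s c1 lY)) e4 -e5.
  by rewrite !mulgA -(mulgA _ (s c2 l)) g1 -g2 !mulgA.
have -> : (s u rY * s rY rr)%g = (s u tY * s tY t * s t c4 * s c4 c3 * s c3 rr)%g.
  by rewrite -f1 -f2 -f3 !mulgA -(mulgA _ (s c4 rY)) f4 -f5 !mulgA.
by rewrite !invgM v1 v2 !mulgA mulgK.
Qed.

(** Conjugation by each side carries the value of [f] at one corner to its value at the next, so
    going round brings [f t] back to itself. *)
Lemma rectangle_commute (f : S -> G) :
  (f t * s t c1)%g = (s t c1 * f c1)%g -> (f c1 * s c1 c2)%g = (s c1 c2 * f c2)%g ->
  (f c2 * s c2 c3)%g = (s c2 c3 * f c3)%g -> (f c3 * s c3 c4)%g = (s c3 c4 * f c4)%g ->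
  (f c4 * s c4 t)%g = (s c4 t * f t)%g ->
  commute (s t c1 * s c1 c2 * s c2 c3 * s c3 c4 * s c4 t)%g (f t).
Proof.
move=> h1 h2 h3 h4 h5.
have chain (x y z v w : G) : (x * v = v * y)%g -> (y * w = w * z)%g -> (x * (v * w) = v * w * z)%g.
  by move=> e e'; rewrite mulgA e -mulgA e' mulgA.
by rewrite /commute -(chain _ _ _ _ _ (chain _ _ _ _ _ (chain _ _ _ _ _ (chain _ _ _ _ _ h1 h2) h3) h4) h5).
Qed.

End Rectangle.

Fact product_key : unit. Proof. exact: tt. Qed.

(** * Generation by fibre loops and loops around the punctures *)

Section BasePlane.
Context {R : realType}.
Local Notation plane := (R * R)%type.
Variables (J : finType) (beta : J -> plane -> plane) (D : seq plane).
Variables (r : nat) (a : 'I_r -> plane) (Y eps : R).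
Hypothesis beta_continuous : forall j, continuous (beta j).
Hypothesis beta_bounded : forall j u, `|beta j u| <= 1.
Hypothesis betaD : forall u, u \notin D -> injective (beta ^~ u).
Hypothesis a_below : forall i, (a i).2 + 1 < Y.
Hypothesis eps_gt0 : 0 < eps.
Hypothesis a_sep : forall i i', i != i' -> 2 * eps <= `|(a i).1 - (a i').1|.

Definition punctured : set plane := [set u | forall i, u != a i].

Definition total_space : set (plane * plane) :=
  [set x | punctured x.1 /\ fibre beta x.1 x.2].

(** At level [winf] no graph is ever met, so this constant section lifts every path of the punctured
    plane, even through [D]. *)
Definition sigma (u : plane) : plane * plane := (u, winf).

(** The height [Y] exceeds those of all punctures and of all points of [D]: the horizontal line of
    the base point is free of both. *)
Definition u0 : plane := (0, Y).

Lemma sigma_continuous : continuous sigma.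
Proof. by rewrite /sigma; continuity. Qed.

Lemma sigma_total u : punctured u -> total_space (sigma u).
Proof. by move=> pu; split => //; exact: winf_fibre. Qed.

Lemma punctured_u0 : punctured u0.
Proof.
by move=> i; apply/eqP => /(congr1 snd) /= E; have := a_below i; rewrite -E; lra.
Qed.

Hypothesis Dtop : forall d, d \in D -> d.2 < Y.
Hypothesis Dx : forall d, d \in D -> forall i, d.1 != (a i).1.
Hypothesis aD : forall i, a i \notin D.

Lemma u0D : u0 \notin D.
Proof. by apply/negP => /Dtop; rewrite ltxx. Qed.

Variable x0 : set_type total_space.
Hypothesis x0E : val x0 = sigma u0.
Variable tau : plane * plane -> R -> plane * plane.
Hypothesis tauP : forall x, total_space x ->
  [/\ path_in total_space (tau x), tau x 0 = val x0 & tau x 1 = x].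
Hypothesis tau_base : tau (val x0) = fun=> val x0.

Local Notation cl := (cls x0 tau).

Definition sg (p q : plane) : pi1 R x0 := cl (seg sigma p q).

Lemma sg_tri (E : set plane) p q s : convex_subset E -> E `<=` punctured ->
  E p -> E q -> E s -> (sg p q * sg q s)%g = sg p s.
Proof.
move=> cE Ep *; apply: (cls_seg_cocycle tauP sigma_continuous (E := E)) => // u Eu.
exact/sigma_total/Ep.
Qed.

Lemma sg_id p : punctured p -> sg p p = 1%g.
Proof.
move=> pp; apply: (@mulgI _ (sg p p)); rewrite mulg1 (@sg_tri [set p]) //.
  by move=> x y s -> -> sI /=; rewrite -scalerDl subrK scale1r.
by move=> x ->.
Qed.

Lemma sg_inv (E : set plane) p q : convex_subset E -> E `<=` punctured ->
  E p -> E q -> (sg p q)^-1%g = sg q p.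
Proof.
move=> cE EP Ep Eq; apply: (@mulgI _ (sg p q)).
by rewrite mulgV (@sg_tri E) // sg_id //; exact: EP.
Qed.

Definition left_of i : plane := ((a i).1 - eps, (a i).2 - 1).
Definition right_of i : plane := ((a i).1 + eps, (a i).2 - 1).
Definition down (x y : R) : pi1 R x0 := (sg u0 (x, Y) * sg (x, Y) (x, y))%g.

Definition lam_left i := down (left_of i).1 (left_of i).2.
Definition lam_right i := down (right_of i).1 (right_of i).2.

(** The rectangular loop around [a i] at level [winf]. *)
Definition around : 'I_r -> pi1 R x0 := locked_with product_key
  (fun i => lam_left i * sg (left_of i) (right_of i) * (lam_right i)^-1)%g.

Lemma aroundE i : around i = (lam_left i * sg (left_of i) (right_of i) * (lam_right i)^-1)%g.
Proof. by rewrite /around unlock. Qed.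

Definition under (u : plane) i := ((a i).1 == u.1) && (u.2 < (a i).2).

(** A vertical descent to a point straight below a puncture would run into the puncture, so it is
    displaced to the left. The half-line below a puncture thus belongs to its left side. *)
Definition shift_x (u : plane) := if [exists i, under u i] then u.1 - eps else u.1.

(** Locked, lest [rewrite mulgA] unfold it. *)
Definition pot : plane -> pi1 R x0 := locked_with product_key
  (fun u => down (shift_x u) u.2 * sg (shift_x u, u.2) u)%g.

Lemma potE u : pot u = (down (shift_x u) u.2 * sg (shift_x u, u.2) u)%g.
Proof. by rewrite /pot unlock. Qed.

Definition above_all : set plane := [set u | forall i, (a i).2 < u.2].

Lemma convex_above_all : convex_subset above_all.
Proof. by move=> p q s pT qT sI i; exact: convex_gt. Qed.

Lemma above_all_punctured : above_all `<=` punctured.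
Proof. by move=> u uT i; apply/eqP => E; have := uT i; rewrite E ltxx. Qed.

Lemma above_all_Y x : above_all (x, Y).
Proof. by move=> i /=; have := a_below i; lra. Qed.

(** Two kinds of convex puncture-free sets are used: half-strips going up from a level above their
    punctures, and half-strips going down ([box]) from the level of a puncture. *)
Definition strip (c d h : R) : set plane :=
  [set u | c < u.1] `&` [set u | u.1 < d] `&` [set u | h < u.2].

Lemma convex_strip c d h : convex_subset (strip c d h).
Proof.
apply: convex_setI; last exact: convex_gt2.
by apply: convex_setI; [exact: convex_gt1|exact: convex_lt1].
Qed.

Definition free_strip (c d h : R) := forall i, c < (a i).1 < d -> (a i).2 <= h.

Lemma free_strip_punctured c d h : free_strip c d h -> strip c d h `<=` punctured.
Proof.
move=> fs u [[/= cu ud] hu] i; apply/eqP => E.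
have : (a i).2 <= h by apply: fs; rewrite -E cu ud.
by rewrite -E leNgt hu.
Qed.

Definition box (c d h : R) : set plane :=
  [set u | c < u.1] `&` [set u | u.1 < d] `&` [set u | u.2 < h].

Lemma convex_box c d h : convex_subset (box c d h).
Proof.
apply: convex_setI; last exact: convex_lt2.
by apply: convex_setI; [exact: convex_gt1|exact: convex_lt1].
Qed.

Lemma near_a i k : (a i).1 - 2 * eps < (a k).1 < (a i).1 + 2 * eps -> k = i.
Proof.
move=> /andP[h1 h2]; apply/eqP/negPn/negP => /a_sep; apply/negP; rewrite -ltNge.
by rewrite ltr_norml; lra.
Qed.

Lemma box_punctured i : box ((a i).1 - 2 * eps) ((a i).1 + 2 * eps) (a i).2 `<=` punctured.
Proof.
move=> u [[/= cu ud] uh] k; apply/eqP => E.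
have ki : k = i by apply: near_a; rewrite -E cu ud.
by move: uh; rewrite E ki ltxx.
Qed.

Lemma free_left i h : free_strip ((a i).1 - 2 * eps) (a i).1 h.
Proof.
move=> k /andP[k1 k2]; suff ki : k = i by rewrite ki ltxx in k2.
by apply: near_a; rewrite k1 /=; apply: (lt_trans k2); rewrite ltrDl mulr_gt0.
Qed.

Lemma free_right i h : free_strip (a i).1 ((a i).1 + 2 * eps) h.
Proof.
move=> k /andP[k1 k2]; suff ki : k = i by rewrite ki ltxx in k1.
by apply: near_a; rewrite k2 andbT; apply: lt_trans k1; rewrite gtrDl oppr_lt0 mulr_gt0.
Qed.

Lemma free_above i : free_strip ((a i).1 - 2 * eps) ((a i).1 + 2 * eps) (a i).2.
Proof. by move=> k /near_a ->. Qed.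

(** The horizontal edge at height [Y] lies in two convex puncture-free sets, [above_all] and the
    strip, so the descent can slide sideways to the abscissa [x']. *)
Lemma down_strip c d h x y x' : free_strip c d h -> h < Y -> h < y ->
  c < x < d -> c < x' < d -> (down x y = sg u0 (x', Y) * sg (x', Y) (x, y))%g.
Proof.
move=> fs hY hy /andP[cx xd] /andP[cx' xd'].
have sT := @sg_tri above_all _ _ _ convex_above_all above_all_punctured.
have sS := @sg_tri (strip c d h) _ _ _ (@convex_strip c d h) (free_strip_punctured fs).
rewrite /down -(sT u0 (x', Y) (x, Y)); try exact: above_all_Y.
by rewrite -mulgA (sS (x', Y) (x, Y)) //; split => //; split.
Qed.

Lemma pot_free u : punctured u -> ~~ [exists i, under u i] -> pot u = down u.1 u.2.
Proof.
move=> pu nu; rewrite potE /shift_x (negPf nu); case: u pu {nu} => x y pu /=.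
by rewrite sg_id // mulg1.
Qed.

Lemma pot_strip c d h u v : free_strip c d h -> h < Y -> strip c d h u -> strip c d h v ->
  ~~ [exists i, under u i] -> ~~ [exists i, under v i] -> (pot u * sg u v)%g = pot v.
Proof.
move=> fs hY Su Sv nu nv.
have sS := @sg_tri (strip c d h) _ _ _ (@convex_strip c d h) (free_strip_punctured fs).
rewrite !pot_free //; try exact: free_strip_punctured fs _ _.
case: u v Su Sv {nu nv} => [x y] [x' y'] /[dup] Su [[/= cx xd] hy] /[dup] Sv [[/= cx' xd'] hy'].
by rewrite (@down_strip c d h x y x') // ?cx ?cx' // -mulgA sS.
Qed.

Lemma pot_left i u : box ((a i).1 - 2 * eps) ((a i).1 + 2 * eps) (a i).2 u ->
  u.1 <= (a i).1 -> pot u = (lam_left i * sg (left_of i) u)%g.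
Proof.
move=> Bu ua; have [[/= cu ud] uh] := Bu.
have e2 : 0 < 2 * eps by rewrite mulr_gt0.
have sB := @sg_tri _ _ _ _ (@convex_box _ _ _) (@box_punctured i).
(* Low enough for the strip to the left of [a i] to reach the three heights that are compared: those
   of [u], of [left_of i] and [Y]. *)
pose h := Num.min (u.2 - 1) (Num.min ((a i).2 - 2) (Y - 1)).
have hu : h < u.2 by rewrite gt_min ltrBlDr ltrDl ltr01.
have hY : h < Y by rewrite !gt_min; apply/orP; right; apply/orP; right; lra.
have ha : h < (a i).2 - 1 by rewrite !gt_min; apply/orP; right; apply/orP; left; lra.
have lI : (a i).1 - 2 * eps < (a i).1 - eps < (a i).1 by have := eps_gt0; lra.
have Bl : box ((a i).1 - 2 * eps) ((a i).1 + 2 * eps) (a i).2 (left_of i).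
  by rewrite /left_of; split; [split|] => /=; have := eps_gt0; lra.
have sS := @sg_tri _ _ _ _ (@convex_strip _ _ _) (free_strip_punctured (@free_left i h)).
rewrite potE /shift_x; case: ifPn => [/existsP[k uk]|nu].
- have ki : k = i.
    by move: uk => /andP[/eqP ku _]; apply: near_a; rewrite ku cu ud.
  move: uk; rewrite ki => /andP[/eqP au _].
  have Bm : box ((a i).1 - 2 * eps) ((a i).1 + 2 * eps) (a i).2 ((a i).1 - eps, u.2).
    by split; [split|] => //=; have := eps_gt0; lra.
  rewrite -au /lam_left (@down_strip _ _ h _ _ ((a i).1 - eps) (@free_left i h)) //.
  have sS1 := sS ((a i).1 - eps, Y) (left_of i) ((a i).1 - eps, u.2).
  rewrite -sS1; last 3 first.
  + by split; [split|]; rewrite /=; lra.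
  + by split; [split|]; rewrite /=; lra.
  + by split; [split|]; rewrite /=; lra.
  by rewrite -!mulgA sB.
- have ua' : u.1 < (a i).1.
    rewrite lt_neqAle ua andbT; apply: contra nu => /eqP ua'.
    by apply/existsP; exists i; rewrite /under ua' eqxx.
  have pu : punctured u by exact: box_punctured Bu.
  rewrite (_ : sg (u.1, u.2) u = 1%g) ?mulg1; last by case: (u) pu => x y /= pu; exact: sg_id.
  rewrite (@down_strip _ _ h _ _ ((a i).1 - eps) (@free_left i h)) ?cu ?ua' //.
  rewrite /lam_left /down -mulgA; congr (_ * _)%g.
  rewrite sS //.
  + by split; [split|]; rewrite /=; lra.
  + by split; [split|]; rewrite /=; lra.
Qed.

Lemma pot_right i u : box ((a i).1 - 2 * eps) ((a i).1 + 2 * eps) (a i).2 u ->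
  (a i).1 < u.1 -> pot u = (lam_right i * sg (right_of i) u)%g.
Proof.
move=> Bu ua; have [[/= cu ud] uh] := Bu.
have e2 : 0 < 2 * eps by rewrite mulr_gt0.
pose h := Num.min (u.2 - 1) (Num.min ((a i).2 - 2) (Y - 1)).
have hu : h < u.2 by rewrite gt_min ltrBlDr ltrDl ltr01.
have hY : h < Y by rewrite !gt_min; apply/orP; right; apply/orP; right; lra.
have ha : h < (a i).2 - 1 by rewrite !gt_min; apply/orP; right; apply/orP; left; lra.
have lI : (a i).1 < (a i).1 + eps < (a i).1 + 2 * eps by have := eps_gt0; lra.
have sS := @sg_tri _ _ _ _ (@convex_strip _ _ _) (free_strip_punctured (@free_right i h)).
have nu : ~~ [exists k, under u k].
  apply/existsP => -[k /[dup] uk /andP[/eqP ku _]].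
  have ki : k = i by apply: near_a; rewrite ku cu ud.
  by move: ua; rewrite -ku ki ltxx.
have pu : punctured u by exact: box_punctured Bu.
rewrite pot_free // (@down_strip _ _ h _ _ ((a i).1 + eps) (@free_right i h)) ?ua ?ud //.
rewrite /lam_right /down -mulgA; congr (_ * _)%g.
rewrite sS //.
- by split; [split|]; rewrite /=; lra.
- by split; [split|]; rewrite /=; lra.
Qed.

Definition loops_around : pi1 R x0 -> Prop := generated (fun g => exists i, g = around i).

Lemma coord_lt (p q : plane) e : `|p - q| < e ->
  [/\ p.1 - e < q.1, q.1 < p.1 + e, p.2 - e < q.2 & q.2 < p.2 + e].
Proof. by rewrite plane_norm_lt /= !ltr_norml => /andP[/andP[? ?] /andP[? ?]]; split; lra. Qed.

(** Around a point straight below a puncture a ball fits into the [box] of that puncture; around any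
    other point, into a strip all of whose nearby punctures lie below the ball. *)
Lemma punctured_local q : punctured q -> exists2 e, 0 < e &
  (exists i, forall u, `|q - u| < e -> box ((a i).1 - 2 * eps) ((a i).1 + 2 * eps) (a i).2 u) \/
  (exists2 h, h < Y & free_strip (q.1 - e) (q.1 + e) h /\
     forall u, `|q - u| < e -> strip (q.1 - e) (q.1 + e) h u).
Proof.
move=> pq.
have [/existsP[i /[dup] ui /andP[/eqP aq qa]]|nu] := boolP [exists i, under q i].
- pose e := Num.min eps ((a i).2 - q.2).
  have e0 : 0 < e by rewrite lt_min eps_gt0 subr_gt0.
  have e1 : e <= eps by rewrite ge_min lexx.
  have e2 : e <= (a i).2 - q.2 by rewrite ge_min lexx orbT.
  have e3 := eps_gt0.
  by exists e => //; left; exists i => u /coord_lt[*]; split; [split|] => /=; lra.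
- have [e e0 he] : exists2 e, 0 < e & forall i,
      e <= if (a i).1 == q.1 then q.2 - (a i).2 else `|(a i).1 - q.1|.
    apply: fin_pos_lower_bound => i; case: eqVneq => aq; last by rewrite normr_gt0 subr_eq0.
    rewrite subr_gt0 lt_neqAle; apply/andP; split.
      apply: contra (pq i) => /eqP aq2; apply/eqP; move: aq aq2.
      by case: (q) (a i) => [x y] [x' y'] /= -> ->.
    rewrite leNgt; apply/negP => qa; move/existsP: nu; apply; exists i.
    by rewrite /under aq eqxx qa.
  pose h := Num.min (q.2 - e) (Y - 1).
  have h1 : h <= q.2 - e by rewrite ge_min lexx.
  have h2 : h <= Y - 1 by rewrite ge_min lexx orbT.
  exists e => //; right; exists h; first by lra.
  split; last by move=> u /coord_lt[*]; split; [split|] => /=; lra.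
  move=> i /andP[i1 i2]; have := he i; case: eqVneq => [_ ei|ne ei].
    by rewrite le_min; have := a_below i; lra.
  by exfalso; move: ei; case: (lerP (a i).1 q.1) => iq; lra.
Qed.

(** A short step has defect [1], unless it crosses the half-line below some [a i]; then the defect
    is [around i] or its inverse. *)
Lemma pot_local q : punctured q -> exists2 e, 0 < e & forall u v,
  `|q - u| < e -> `|q - v| < e ->
  punctured u /\ loops_around (pot u * sg u v * (pot v)^-1)%g.
Proof.
move=> /punctured_local[e e0 [[i inB]|[h hY [fs inS]]]].
- have sB := @sg_tri _ _ _ _ (@convex_box _ _ _) (@box_punctured i).
  have sV := @sg_inv _ _ _ (@convex_box _ _ _) (@box_punctured i).
  have e3 := eps_gt0.
  have Bl : box ((a i).1 - 2 * eps) ((a i).1 + 2 * eps) (a i).2 (left_of i).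
    by rewrite /left_of; split; [split|] => /=; lra.
  have Br : box ((a i).1 - 2 * eps) ((a i).1 + 2 * eps) (a i).2 (right_of i).
    by rewrite /right_of; split; [split|] => /=; lra.
  exists e => // u v /inB Bu /inB Bv; split; first exact: box_punctured Bu.
  have gi : loops_around (around i) by apply: generated_in; exists i.
  have [ua|ua] := lerP u.1 (a i).1; have [va|va] := lerP v.1 (a i).1.
  + rewrite (pot_left Bu) // (pot_left Bv) // invgM sV //.
    by rewrite !mulgA -(mulgA (lam_left i)) sB // -(mulgA (lam_left i)) sB // sg_id ?mulg1 ?mulgV //;
      exact: box_punctured Bl.
  + rewrite (pot_left Bu) // (pot_right Bv) // invgM sV //.
    by rewrite !mulgA -(mulgA (lam_left i)) sB // -(mulgA (lam_left i)) sB // -aroundE.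
  + rewrite (pot_right Bu) // (pot_left Bv) // invgM sV //.
    rewrite !mulgA -(mulgA (lam_right i)) sB // -(mulgA (lam_right i)) sB //.
    rewrite (_ : _ * _ = (around i)^-1)%g; first exact: generatedV.
    by rewrite aroundE (invgM (lam_left i * _)%g) (invgM (lam_left i)) invgK sV // !mulgA.
  + rewrite (pot_right Bu) // (pot_right Bv) // invgM sV //.
    by rewrite !mulgA -(mulgA (lam_right i)) sB // -(mulgA (lam_right i)) sB // sg_id ?mulg1 ?mulgV //;
      exact: box_punctured Br.
- have free u : `|q - u| < e -> ~~ [exists i, under u i].
    move=> /inS[[/= u1 u2] u3]; apply/existsP => -[i /andP[/eqP iu ui]].
    by have := fs i; rewrite iu u1 u2 => /(_ isT); lra.
  exists e => // u v qu qv; have [Su Sv] := (inS _ qu, inS _ qv).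
  split; first exact: free_strip_punctured fs _ Su.
  by rewrite (pot_strip fs _ Su Sv) ?free // ?mulgV //.
Qed.

Definition fibre_loop (u : plane) (phi : R -> plane) :=
  [/\ path_in (fibre beta u) phi, phi 0 = winf & phi 1 = winf].

Definition fib (u : plane) (phi : R -> plane) : R -> plane * plane := fun t => (u, phi t).

Lemma path_in_sigma (p : R -> plane) : path_in punctured p -> path_in total_space (fun v => sigma (p v)).
Proof.
move=> [cp pp]; split; first exact: (continuousT_comp cp sigma_continuous).
by move=> t tI; apply: sigma_total; exact: pp.
Qed.

Lemma path_in_fib u phi : punctured u -> path_in (fibre beta u) phi -> path_in total_space (fib u phi).
Proof.
move=> pu [cphi Fphi]; split; first by rewrite /fib; continuity.
by move=> t tI; split => //; exact: Fphi.
Qed.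

Lemma unit_convex (s t v : R) : 0 <= s <= 1 -> 0 <= t <= 1 -> 0 <= v <= 1 ->
  0 <= s + v * (t - s) <= 1.
Proof. by move=> sI tI vI; apply/andP; split; nra. Qed.

Lemma cls_subpath (f : R -> plane * plane) s t u : path_in total_space f ->
  0 <= s <= 1 -> 0 <= t <= 1 -> 0 <= u <= 1 ->
  (cl (seg (f : R^o -> _) s t) * cl (seg (f : R^o -> _) t u))%g = cl (seg (f : R^o -> _) s u).
Proof.
move=> [cf Tf] sI tI uI.
exact: (cls_seg_cocycle tauP (V := R^o) (E := [set t | 0 <= t <= 1]) cf Tf
  (@convex_unit_interval R)).
Qed.

(** The defects of the short steps multiply along the path, the intermediate potentials
    cancelling. *)
Lemma sigma_path_pot (p : R -> plane) : path_in punctured p ->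
  loops_around (pot (p 0%R) * cl (fun v => sigma (p v)) * (pot (p 1%R))^-1)%g.
Proof.
move=> Pp; have Ts := path_in_sigma Pp; have [cp pp] := Pp.
rewrite -[X in cl X](@seg01 R _ (fun v => sigma (p v))).
apply: (@chain_unit_interval R (fun s t => loops_around
   (pot (p s) * cl (seg ((fun v => sigma (p v)) : R^o -> _) s t) * (pot (p t))^-1)%g)); last 2 first.
- by rewrite lexx ler01.
- by rewrite lexx ler01.
- move=> s t u sI tI uI h1 h2; have := generatedM h1 h2.
  by rewrite !mulgA mulgVK -(mulgA (pot (p s))) cls_subpath.
- move=> q qI; have [e e0 he] := pot_local (pp _ qI).
  have [d d0 hd] := local_subpath q cp e0.
  exists d => // s t sI tI qs qt.
  have I0 : 0 <= (0 : R) <= 1 by rewrite lexx ler01.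
  have I1 : 0 <= (1 : R) <= 1 by rewrite lexx ler01.
  have h0 := hd s t 0 qs qt I0; have h1 := hd s t 1 qs qt I1.
  rewrite mul0r addr0 in h0; rewrite mul1r (addrC s) subrK in h1.
  suff -> : cl (seg ((fun v => sigma (p v)) : R^o -> _) s t) = sg (p s) (p t) by case: (he _ _ h0 h1).
  have EX u : `|p q - u| < e -> total_space (sigma u).
    by move=> qu; apply: sigma_total; case: (he u u qu qu).
  apply: (@cls_seg_convex _ _ _ _ _ tauP _ sigma [set u | `|p q - u| < e]
    sigma_continuous EX (@convex_ball _ _ _ _) (fun v => p (s + v *: (t - s)))).
  + split; first by apply: (continuousT_comp _ cp); rewrite /GRing.scale /=; continuity.
    by move=> v vI; exact: hd.
  + by rewrite scale0r addr0.
  + by rewrite scale1r addrC subrK.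
Qed.

Lemma transport_square q e rho (b : plane) (p : R -> plane) (phi : R -> plane) :
  nearly_constant beta q e rho -> `|q - b| < e ->
  path_in ([set u | `|q - u| < e] `&` punctured) p -> path_in (fibre beta b) phi ->
  (cl (fun v => (p v, transport beta rho b (p v) (phi 0%R))) *
   cl (fib (p 1%R) (fun t => transport beta rho b (p 1%R) (phi t))))%g =
  (cl (fib (p 0%R) (fun t => transport beta rho b (p 0%R) (phi t))) *
   cl (fun v => (p v, transport beta rho b (p v) (phi 1%R))))%g.
Proof.
move=> nc qb [cp pp] [cphi Fphi].
apply: (cls_square tauP (F := fun st => (p st.1, transport beta rho b (p st.1) (phi st.2)))).
- have c1 : continuous (fun st : R * R => p st.1) by apply: (continuousT_comp _ cp); continuity.
  have c2 : continuous (fun st : R * R => phi st.2) by apply: (continuousT_comp _ cphi); continuity.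
  apply: pair_continuous => //; apply: (transport_continuous (beta := beta)) => //.
  exact: continuousT_cst.
- move=> s t sI tI; have [qp Pp] := pp _ sI; split => //=.
  by apply: (transport_fibre nc) => //; exact: Fphi.
Qed.

Lemma transport_loop q e rho (b u : plane) (phi : R -> plane) :
  nearly_constant beta q e rho -> `|q - b| < e -> `|q - u| < e ->
  fibre_loop b phi -> fibre_loop u (fun t => transport beta rho b u (phi t)).
Proof.
move=> nc qb qu [[cphi Fphi] phi0 phi1]; split.
- split; first by apply: (transport_continuous (beta := beta)) => //; exact: continuousT_cst.
  by move=> t tI; apply: (transport_fibre nc) => //; exact: Fphi.
- by rewrite phi0 (transport_winf beta_bounded nc).
- by rewrite phi1 (transport_winf beta_bounded nc).
Qed.

(** [transport] fixes [winf], so the two edges swept by the ends of the loop stay on the section. *)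
Lemma transport_loop_square q e rho (b : plane) (p : R -> plane) (phi : R -> plane) :
  nearly_constant beta q e rho -> `|q - b| < e ->
  path_in ([set u | `|q - u| < e] `&` punctured) p -> fibre_loop b phi ->
  (cl (fun v => sigma (p v)) *
   cl (fib (p 1%R) (fun t => transport beta rho b (p 1%R) (phi t))))%g =
  (cl (fib (p 0%R) (fun t => transport beta rho b (p 0%R) (phi t))) *
   cl (fun v => sigma (p v)))%g.
Proof.
move=> nc qb Pp [Fphi phi0 phi1].
have := transport_square nc qb Pp Fphi; rewrite phi0 phi1.
by under [X in cl X]eq_fun do rewrite (transport_winf beta_bounded nc).
Qed.

(** Near a point outside [D] the graphs are nearly constant and loops pass from fibre to fibre by
    [transport]; subdividing the path composes these moves. *)
Lemma transport_along (p : R -> plane) phi :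
  path_in [set u | punctured u /\ u \notin D] p -> fibre_loop (p 0) phi ->
  exists2 psi, fibre_loop (p 1) psi &
  (cl (fib (p 0%R) phi) * cl (fun v => sigma (p v)))%g =
  (cl (fun v => sigma (p v)) * cl (fib (p 1%R) psi))%g.
Proof.
move=> [cp pp] Lphi.
have Ts : path_in total_space (fun v => sigma (p v)).
  by apply: path_in_sigma; split => // t /pp[].
suff : forall phi, fibre_loop (p 0) phi -> exists2 psi, fibre_loop (p 1) psi &
    (cl (fib (p 0%R) phi) * cl (seg ((fun v => sigma (p v)) : R^o -> _) 0%R 1%R))%g =
    (cl (seg ((fun v => sigma (p v)) : R^o -> _) 0%R 1%R) * cl (fib (p 1%R) psi))%g.
  by rewrite seg01; apply.
move=> {phi Lphi}.
apply: (@chain_unit_interval R (fun s t => forall phi, fibre_loop (p s) phi ->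
   exists2 psi, fibre_loop (p t) psi &
    (cl (fib (p s) phi) * cl (seg ((fun v => sigma (p v)) : R^o -> _) s t))%g =
    (cl (seg ((fun v => sigma (p v)) : R^o -> _) s t) * cl (fib (p t) psi))%g)); last 2 first.
- by rewrite lexx ler01.
- by rewrite lexx ler01.
- move=> s t u sI tI uI st tu phi /st[psi Lpsi E1]; have [chi Lchi E2] := tu _ Lpsi.
  by exists chi => //; rewrite -(cls_subpath Ts sI tI uI) mulgA E1 -!mulgA E2.
- move=> q qI; have [pq qD] := pp _ qI.
  have [e [rho nc]] := nearly_constant_exists beta_continuous (betaD qD).
  have e0 : 0 < e by case: nc.
  have [d d0 hd] := local_subpath q cp e0.
  exists d => // s t sI tI qs qt phi Lphi.
  have I0 : 0 <= (0 : R) <= 1 by rewrite lexx ler01.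
  have I1 : 0 <= (1 : R) <= 1 by rewrite lexx ler01.
  have h0 := hd s t 0 qs qt I0; have h1 := hd s t 1 qs qt I1.
  rewrite mul0r addr0 in h0; rewrite mul1r (addrC s) subrK in h1.
  exists (fun v => transport beta rho (p s) (p t) (phi v)); first exact: (transport_loop nc).
  pose p' (v : R) := p (s + v *: (t - s)).
  have p'0 : p' 0 = p s by rewrite /p' scale0r addr0.
  have p'1 : p' 1 = p t by rewrite /p' scale1r addrC subrK.
  have := @transport_loop_square _ _ _ (p s) p' phi nc h0.
  rewrite p'0 p'1 => -> //.
    have -> // : (fun v => transport beta rho (p s) (p s) (phi v)) = phi.
    by apply/funext => v; rewrite transport_id.
  split; first by apply: (continuousT_comp _ cp); rewrite /GRing.scale /=; continuity.
  move=> v vI; split; first exact: hd.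
  by have [] := pp _ (unit_convex sI tI vI).
Qed.

Lemma pot_u0 : pot u0 = 1%g.
Proof.
have nu : ~~ [exists i, under u0 i].
  by apply/existsP => -[i /andP[_]] /=; have := a_below i; lra.
rewrite pot_free //; last exact: punctured_u0.
by rewrite /down !sg_id ?mulg1 //; exact: punctured_u0.
Qed.

Lemma fibre_connected u w : fibre beta u w ->
  exists f : R -> plane, [/\ path_in (fibre beta u) f, f 0 = winf & f 1 = w].
Proof.
pose Z := [seq beta j u | j <- enum J].
have ZE v : fibre beta u v <-> v \notin Z.
  split=> [Fv|vZ j]; first by apply/mapP => -[j _ E]; have := Fv j; rewrite E eqxx.
  by apply: contra vZ => /eqP ->; apply: map_f; rewrite mem_enum.
move=> /ZE wZ; have /ZE iZ : fibre beta u winf by exact: winf_fibre.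
have [f [[cf Zf] f0 f1]] := plane_minus_finite iZ wZ.
by exists f; split => //; split => // t /Zf/ZE.
Qed.

Definition generators (g : pi1 R x0) : Prop :=
  (exists i, g = around i) \/ exists2 phi, fibre_loop u0 phi & g = cl (fib u0 phi).

Lemma loops_around_generators g : loops_around g -> generated generators g.
Proof. by apply: generated_sub => y [i ->]; apply: generated_in; left; exists i. Qed.

(** By compactness the path keeps a positive distance to the graphs, so it can be reused unchanged
    in neighbouring fibres. This replaces [transport] over [D], where graphs may collide. *)
Lemma fibre_loop_margin u (phi : R -> plane) : path_in (fibre beta u) phi -> exists2 e, 0 < e &
  forall v t, `|u - v| < e -> 0 <= t <= 1 -> fibre beta v (phi t).
Proof.
move=> [cphi Fphi].
have H j : exists e, 0 < e /\ forall v t, `|u - v| < e -> 0 <= t <= 1 -> phi t != beta j v.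
  have [m m0 hm] : exists2 m, 0 < m & forall t, 0 <= t <= 1 -> m <= `|phi t - beta j u|.
    apply: path_lower_bound; first by continuity.
    by move=> t tI; rewrite normr_gt0 subr_eq0; exact: Fphi.
  have /cvgrPdist_lt/(_ _ m0)/nbhs_ballP[e /= e0 he] := @beta_continuous j u.
  exists e; split => // v t uv tI; apply/eqP => E; have := hm t tI; rewrite E.
  have : `|beta j u - beta j v| < m by apply: he; rewrite -ball_normE.
  by rewrite distrC; lra.
have /choice[e he] := H.
have [m m0 hm] := fin_pos_lower_bound (fun j => (he j).1).
exists m => // v t uv tI j; apply: (he j).2 => //; exact: lt_le_trans (hm j).
Qed.

Lemma punctured_open u : punctured u -> exists2 e, 0 < e & forall v, `|u - v| < e -> punctured v.
Proof. by move=> /pot_local[e e0 he]; exists e => // v uv; case: (he v v uv uv). Qed.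

Lemma fib_square u v (phi : R -> plane) :
  (forall s t : R, 0 <= s <= 1 -> 0 <= t <= 1 -> total_space (u + s *: (v - u), phi t)) ->
  continuous phi ->
  (cl (seg (fun w => (w, phi 0%R)) u v) * cl (fib v phi))%g =
  (cl (fib u phi) * cl (seg (fun w => (w, phi 1%R)) u v))%g.
Proof.
move=> H cphi.
have := @cls_square R _ total_space x0 tau tauP (fun st => (u + st.1 *: (v - u), phi st.2)).
rewrite /= scale0r addr0 scale1r (addrC u) subrK.
apply; last exact: H.
have c2 : continuous (fun st : R * R => phi st.2) by apply: (continuousT_comp _ cphi); continuity.
by continuity.
Qed.

(** Outside [D] the loop is transported to the base fibre along a path avoiding [D], and the base
    path contributes loops around punctures. Over a point of [D] the same loop is first shifted to a
    nearby fibre outside [D]. *)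
Lemma fibre_loop_generated u phi : punctured u -> fibre_loop u phi ->
  generated generators (pot u * cl (fib u phi) * (pot u)^-1)%g.
Proof.
have inD u' psi : punctured u' -> u' \notin D -> fibre_loop u' psi ->
    generated generators (pot u' * cl (fib u' psi) * (pot u')^-1)%g.
  move=> pu uD Lpsi.
  pose Z := D ++ [seq a i | i <- enum 'I_r].
  have ZE v : punctured v /\ v \notin D <-> v \notin Z.
    rewrite mem_cat negb_or; split=> [[pv ->]|/andP[-> vZ]].
      by apply/mapP => -[i _ E]; have := pv i; rewrite E eqxx.
    by split => // i; apply: contra vZ => /eqP ->; apply: map_f; rewrite mem_enum.
  have /ZE uZ : punctured u' /\ u' \notin D by [].
  have /ZE u0Z : punctured u0 /\ u0 \notin D by split; [exact: punctured_u0|exact: u0D].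
  have [p [[cp Zp] p0 p1]] := plane_minus_finite uZ u0Z.
  have Pp : path_in [set u | punctured u /\ u \notin D] p by split => // t /Zp/ZE.
  have [||chi Lchi] := @transport_along p psi _ _ => //; first by rewrite p0.
  rewrite p0 p1 => E.
  have h : generated generators (pot u' * cl (fun v => sigma (p v)))%g.
    have := @sigma_path_pot p; rewrite p0 p1 pot_u0 invg1 mulg1 => H.
    apply: loops_around_generators; apply: H; split => // t tI.
    by have [] := Pp.2 t tI.
  rewrite p1 in Lchi.
  have -> : (pot u' * cl (fib u' psi) * (pot u')^-1 =
    (pot u' * cl (fun v => sigma (p v))) * cl (fib u0 chi) * (pot u' * cl (fun v => sigma (p v)))^-1)%g.
    by rewrite invgM -!mulgA; congr (_ * _)%g; rewrite !mulgA -E mulgK.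
  apply: generatedM; last exact: generatedV.
  by apply: generatedM => //; apply: generated_in; right; exists chi.
move=> pu Lphi; have [uD|uD] := boolP (u \in D); last exact: inD.
have [[cphi Fphi] phi0 phi1] := Lphi.
have [e1 e10 he1] := fibre_loop_margin (conj cphi Fphi).
have [e2 e20 he2] := punctured_open pu.
pose e := Num.min e1 e2; have e0 : 0 < e by rewrite lt_min e10.
(* The horizontal shift by [t] misses [D] because [t] is not a difference of abscissae between a
   point of [D] and [u]. *)
have [t /andP[t0 te] tZ] := pos_notin [seq d.1 - u.1 | d <- D] e0.
pose v : plane := (u.1 + t, u.2).
have uv (s : R) : 0 <= s <= 1 -> `|u - (u + s *: (v - u))| < e.
  move=> sI; rewrite opprD addrA subrr add0r normrN normrZ ger0_norm; last by lra.
  have -> : v - u = (t, 0) by rewrite /v; congr (_, _); rewrite /= ?subrr // addrC addKr.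
  by rewrite plane_normE normr0 gtr0_norm // max_l ?ltW //; nra.
have v1 : u + 1 *: (v - u) = v by rewrite scale1r addrC subrK.
have I1 : 0 <= (1 : R) <= 1 by rewrite lexx ler01.
have uv1 := uv 1 I1; rewrite v1 in uv1.
have vD : v \notin D.
  by apply: contra tZ => vD; apply/mapP; exists v => //=; rewrite addrC addKr.
have pv : punctured v by apply: he2; apply: lt_le_trans uv1 _; rewrite ge_min lexx orbT.
have Lv : fibre_loop v phi.
  by split => //; split => // s; apply: he1; apply: lt_le_trans uv1 _; rewrite ge_min lexx.
have Ps : path_in punctured (fun s : R => u + s *: (v - u)).
  split; first by continuity.
  by move=> s /uv us; apply: he2; apply: lt_le_trans us _; rewrite ge_min lexx orbT.
have E : (sg u v * cl (fib v phi) = cl (fib u phi) * sg u v)%g.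
  have := @fib_square u v phi; rewrite phi0 phi1; apply => //.
  move=> s s' sI sI'; split => /=.
    by apply: he2; apply: lt_le_trans (uv s sI) _; rewrite ge_min lexx orbT.
  by apply: he1 => //; apply: lt_le_trans (uv s sI) _; rewrite ge_min lexx.
have h : generated generators (pot u * sg u v * (pot v)^-1)%g.
  have := sigma_path_pot Ps; rewrite v1 scale0r addr0; exact: loops_around_generators.
have -> : (pot u * cl (fib u phi) * (pot u)^-1 = (pot u * sg u v * (pot v)^-1) *
   (pot v * cl (fib v phi) * (pot v)^-1) * (pot u * sg u v * (pot v)^-1)^-1)%g.
  rewrite !invgM invgK !mulgA !mulgVK; congr (_ * _)%g.
  by rewrite -(mulgA (pot u)) E mulgA mulgK.
by apply: generatedM; [apply: generatedM => //; exact: inD|exact: generatedV].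
Qed.

Lemma prod_norm_lt (p : plane * plane) (e : R) : (`|p| < e) = (`|p.1| < e) && (`|p.2| < e).
Proof. by rewrite -gt_max. Qed.

Lemma fibre_open u w : fibre beta u w -> exists2 e, 0 < e &
  forall v z, `|u - v| < e -> `|w - z| < e -> fibre beta v z.
Proof.
move=> Fw; have [m m0 hm] : exists2 m, 0 < m & forall j, m <= `|w - beta j u|.
  by apply: fin_pos_lower_bound => j; rewrite normr_gt0 subr_eq0.
have H j : exists e, 0 < e /\ forall v, `|u - v| < e -> `|beta j u - beta j v| < m / 2.
  have m2 : 0 < m / 2 by lra.
  have /cvgrPdist_lt/(_ _ m2)/nbhs_ballP[e /= e0 he] := @beta_continuous j u.
  by exists e; split => // v uv; apply: he; rewrite -ball_normE.
have /choice[e he] := H.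
have [d d0 hd] := fin_pos_lower_bound (fun j => (he j).1).
exists (Num.min d (m / 2)); first by rewrite lt_min d0 /=; lra.
move=> v z; rewrite !lt_min => /andP[uv _] /andP[_ wz] j; apply/eqP => E.
have h1 : `|beta j u - beta j v| < m / 2 by apply: (he j).2; exact: lt_le_trans (hd j).
have h2 := hm j; rewrite -E in h1.
have := ler_distD z w (beta j u); rewrite (distrC z); lra.
Qed.

Lemma total_open q : total_space q -> exists2 e, 0 < e & forall x, `|q - x| < e -> total_space x.
Proof.
move=> [pq Fq]; have [e e0 he] := punctured_open pq; have [d d0 hd] := fibre_open Fq.
exists (Num.min e d); first by rewrite lt_min e0.
move=> x; rewrite prod_norm_lt !lt_min => /andP[/andP[x1 x2] /andP[x3 x4]].
by split; [exact: he|exact: hd].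
Qed.

Lemma cls_local f q e : path_in total_space f -> 0 <= q <= 1 -> 0 < e ->
  (forall x, `|f q - x| < e -> total_space x) -> exists2 d, 0 < d & forall s t,
    0 <= s <= 1 -> 0 <= t <= 1 -> `|q - s| < d -> `|q - t| < d ->
    [/\ `|f q - f s| < e, `|f q - f t| < e &
      cl (seg (f : R^o -> _) s t) = cl (seg (fun x => x) (f s) (f t))].
Proof.
move=> [cf Tf] qI e0 he; have [d d0 hd] := local_subpath q cf e0.
exists d => // s t sI tI qs qt.
have I0 : 0 <= (0 : R) <= 1 by rewrite lexx ler01.
have I1 : 0 <= (1 : R) <= 1 by rewrite lexx ler01.
have h0 := hd s t 0 qs qt I0; have h1 := hd s t 1 qs qt I1.
rewrite mul0r addr0 in h0; rewrite mul1r (addrC s) subrK in h1.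
split => //.
apply: (@cls_seg_convex _ _ _ _ _ tauP _ (fun x => x) [set u | `|f q - u| < e]
    (@continuousT_id _) he (@convex_ball _ _ _ _) (fun v => f (s + v *: (t - s)))).
- split; first by apply: (continuousT_comp _ cf); rewrite /GRing.scale /=; continuity.
  by move=> v vI; exact: hd.
- by rewrite scale0r addr0.
- by rewrite scale1r addrC subrK.
Qed.

Lemma fib_concat u f g : concat_fun (fib u f) (fib u g) = fib u (concat_fun f g).
Proof. by apply/funext => t; rewrite /concat_fun /fib; case: ifP. Qed.

Lemma cls_fib_concat u f g : punctured u -> path_in (fibre beta u) f ->
  path_in (fibre beta u) g -> f 1 = g 0 ->
  cl (fib u (concat_fun f g)) = (cl (fib u f) * cl (fib u g))%g.
Proof.
move=> pu Ff Fg fg; rewrite -fib_concat cls_concat //; try exact: path_in_fib.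
by rewrite /fib fg.
Qed.

(** Over the base points near [q.1] the fibre path [f] still avoids the graphs; prolonged by a short
    segment, it reaches each nearby point inside its own fibre. Sliding [f] from one fibre to the
    other gives the relation. *)
Lemma pot_fibre_path q (f : R -> plane) : total_space q -> path_in (fibre beta q.1) f -> f 0 = winf ->
  f 1 = q.2 -> exists2 e, 0 < e & forall x y, `|q - x| < e -> `|q - y| < e ->
  exists h k, [/\ total_space x, total_space y, path_in (fibre beta x.1) h /\ path_in (fibre beta y.1) k,
    [/\ h 0 = winf, h 1 = x.2, k 0 = winf & k 1 = y.2] &
    (cl (fib x.1 h) * cl (seg (fun x => x) x y) = sg x.1 y.1 * cl (fib y.1 k))%g].
Proof.
move=> /[dup] Tq [pq _] Ff f0 f1; have [e1 e10 he1] := total_open Tq.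
have [e2 e20 he2] := fibre_loop_margin Ff.
pose e := Num.min e1 e2; have e0 : 0 < e by rewrite lt_min e10.
have he x : `|q - x| < e -> total_space x by rewrite lt_min => /andP[/he1].
have hq x : `|q - x| < e -> `|q.1 - x.1| < e by rewrite prod_norm_lt => /andP[].
have hq2 x : `|q - x| < e -> `|q.2 - x.2| < e by rewrite prod_norm_lt => /andP[].
have hf v t : `|q.1 - v| < e -> 0 <= t <= 1 -> fibre beta v (f t).
  by rewrite lt_min => /andP[_ qv] tI; exact: he2.
have qq : `|q - q| < e by rewrite subrr normr0.
have mix x y : `|q - x| < e -> `|q - y| < e -> `|q - (x.1, y.2)| < e.
  by rewrite !prod_norm_lt /= => /andP[-> _] /andP[_ ->].
have sB x y z := @cls_seg_cocycle _ _ _ _ _ tauP _ (fun x => x) [set u | `|q - u| < e]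
  (@continuousT_id _) he (@convex_ball _ _ _ _) x y z.
exists e => // x y qx qy.
pose sf (z : plane * plane) (t : R) : plane := q.2 + t *: (z.2 - q.2).
have Fsf z : `|q - z| < e -> path_in (fibre beta z.1) (sf z).
  move=> qz; split; first by rewrite /sf; continuity.
  move=> t tI; suff [_ H] : total_space (z.1, sf z t) by exact: H.
  apply: he; rewrite prod_norm_lt /= (hq _ qz) /=.
  have -> : sf z t = (1 - t) *: q.2 + t *: z.2.
    exact: seg_combination.
  by apply: convex_ball => //=; [rewrite subrr normr0|exact: hq2].
have Ff' z : `|q - z| < e -> path_in (fibre beta z.1) f.
  by move=> qz; split; [case: Ff|move=> t; apply: hf; exact: hq].
have fsf z : f 1 = sf z 0 by rewrite /sf scale0r addr0.
exists (concat_fun f (sf x)), (concat_fun f (sf y)).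
have Tx := he _ qx; have Ty := he _ qy; split => //.
- by split; apply: path_in_concat => //; [exact: Ff'|exact: Fsf|exact: Ff'|exact: Fsf].
- by rewrite !concat_fun0 !concat_fun1 /sf !scale1r !(addrC q.2) !subrK.
rewrite !cls_fib_concat //; try exact: Ff'; try exact: Fsf; try by [case: Tx|case: Ty].
have sfE z : fib z.1 (sf z) = seg (fun x => x) (z.1, q.2) z.
  apply/funext => t; rewrite /fib /sf /seg /=; case: z => z1 z2 /=.
  by congr (_, _); rewrite /= subrr scaler0 addr0.
rewrite !sfE -[LHS]mulgA sB //; try exact: mix.
rewrite -(sB _ (y.1, q.2)) //; try exact: mix.
rewrite !mulgA; congr (_ * _)%g.
have -> : seg (fun x => x) (x.1, q.2) (y.1, q.2) = seg (fun w : plane => (w, q.2)) x.1 y.1.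
  by apply/funext => t; rewrite /seg /=; congr (_, _); rewrite /= subrr scaler0 addr0.
have := @fib_square x.1 y.1 f; rewrite f0 f1 => -> //; last by case: Ff.
move=> s t sI tI; have h : `|q.1 - (x.1 + s *: (y.1 - x.1))| < e.
  by rewrite seg_combination; apply: convex_ball => //=; exact: hq.
split => /=; last exact: hf.
suff [] : total_space (x.1 + s *: (y.1 - x.1), q.2) by [].
by apply: he; rewrite prod_norm_lt /= h subrr normr0.
Qed.

(** [Pot] reaches a point through the base at level [winf], then inside the fibre by an arbitrarily
    chosen path. Changing this choice costs a fibre loop, so between nearby points the defect of
    [Pot] splits into two fibre loops and one defect of [pot]. *)
Lemma generation g : generated generators g.
Proof.
have [fp fpP] : exists fp : plane * plane -> R -> plane, forall x, fibre beta x.1 x.2 ->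
    [/\ path_in (fibre beta x.1) (fp x), fp x 0 = winf & fp x 1 = x.2].
  have /choice[fp fpP] : forall x : plane * plane, exists f : R -> plane, fibre beta x.1 x.2 ->
    [/\ path_in (fibre beta x.1) f, f 0 = winf & f 1 = x.2].
    move=> x; have [/fibre_connected[f fP]|nF] := pselect (fibre beta x.1 x.2); first by exists f.
    by exists (fun=> winf).
  by exists fp.
pose Pot x := (pot x.1 * cl (fib x.1 (fp x)))%g.
have closed_up u f h : punctured u -> path_in (fibre beta u) f -> path_in (fibre beta u) h ->
    f 0 = winf -> h 0 = winf -> f 1 = h 1 ->
    generated generators (pot u * cl (fib u f) * (cl (fib u h))^-1 * (pot u)^-1)%g.
  move=> pu Ff Fh f0 h0 fh; have Fr := path_in_rev Fh.
  have -> : (cl (fib u h))^-1%g = cl (fib u (fun t => h (1 - t))).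
    by rewrite -(cls_rev tauP) //; exact: path_in_fib.
  rewrite -(mulgA (pot u)) -cls_fib_concat ?subr0 //.
  apply: fibre_loop_generated => //; split.
  - by apply: path_in_concat; rewrite ?subr0.
  - by rewrite concat_fun0.
  - by rewrite concat_fun1 subrr.
have loc q : total_space q -> exists2 e, 0 < e & (forall x, `|q - x| < e -> total_space x) /\
   forall x y, `|q - x| < e -> `|q - y| < e ->
   generated generators (Pot x * cl (seg (fun x => x) x y) * (Pot y)^-1)%g.
  move=> Tq; have [_ Fq] := Tq; have [Ff f0 f1] := fpP _ Fq.
  have [e e0 he] := pot_fibre_path Tq Ff f0 f1.
  exists e => //; split=> [x qx|x y qx qy]; first by have [h [k []]] := he x x qx qx.
  have [h [k [Tx Ty [Fh Fk] [h0 h1 k0 k1] E]]] := he x y qx qy.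
  have [px Fx] := Tx; have [py Fy] := Ty.
  have [Ffx fx0 fx1] := fpP _ Fx; have [Ffy fy0 fy1] := fpP _ Fy.
  have -> : (Pot x * cl (seg (fun x => x) x y) * (Pot y)^-1 =
    (pot x.1 * cl (fib x.1 (fp x)) * (cl (fib x.1 h))^-1 * (pot x.1)^-1) *
    (pot x.1 * sg x.1 y.1 * (pot y.1)^-1) *
    (pot y.1 * cl (fib y.1 (fp y)) * (cl (fib y.1 k))^-1 * (pot y.1)^-1)^-1)%g.
    rewrite /Pot !invgM !invgK !mulgA !mulgVK -(mulgA _ (sg _ _)) -E.
    by rewrite !mulgA mulgVK.
  apply: generatedM; last by apply: generatedV; apply: closed_up; rewrite ?k1.
  apply: generatedM; first by apply: closed_up; rewrite ?h1.
  apply: loops_around_generators.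
  pose p (t : R) : plane := x.1 + t *: (y.1 - x.1).
  have Pp : path_in punctured p.
    split; first by rewrite /p; continuity.
    move=> t tI; have [e' e'0 he'] := total_open Tq.
    suff : total_space (p t, x.2 + t *: (y.2 - x.2)) by case.
    suff : `|q - (x + t *: (y - x))| < e by move=> /[dup] /he /[apply] [] [h' [k' []]].
    have -> : x + t *: (y - x) = (1 - t) *: x + t *: y.
      exact: seg_combination.
    exact: convex_ball.
  by have := sigma_path_pot Pp; rewrite /p scale0r addr0 scale1r (addrC x.1) subrK.
have [f bf <-] := pclass_surj g; have [Tf f0 f1] := bf.
rewrite -(cls_based tauP tau_base bf).
have H : generated generators (Pot (f 0%R) * cl (seg (f : R^o -> _) 0%R 1%R) * (Pot (f 1%R))^-1)%g.
  apply: (@chain_unit_interval R (fun s t => generated generators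
    (Pot (f s) * cl (seg (f : R^o -> _) s t) * (Pot (f t))^-1)%g)); last 2 first.
  - by rewrite lexx ler01.
  - by rewrite lexx ler01.
  - move=> s t u sI tI uI h1 h2; have := generatedM h1 h2.
    by rewrite conj_comp cls_subpath.
  - move=> q qI; have [e e0 [Te he]] := loc _ (Tf.2 _ qI).
    have [d d0 hd] := cls_local Tf qI e0 Te.
    by exists d => // s t sI tI qs qt; have [h1 h2 ->] := hd s t sI tI qs qt; exact: he.
move: H; rewrite seg01 f0 f1 => H.
(* The fibre path chosen for the base point need not be constant: it is a loop of the base fibre, by
   which the result must be conjugated. *)
have HP : generated generators (Pot (val x0)).
  rewrite /Pot x0E /= pot_u0 mul1g; apply: generated_in; right.
  have F0 : fibre beta u0 winf by exact: winf_fibre.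
  have [Ff ff0 ff1] := fpP (sigma u0) F0.
  by exists (fp (sigma u0)).
have := generatedM (generatedM (generatedV HP) H) HP.
by move: (Pot _) => P; rewrite !mulgA mulVg mul1g mulgVK.
Qed.

Lemma commute_conj (G : groupType) (p x y : G) :
  commute x y -> commute (p * x * p^-1)%g (p * y * p^-1)%g.
Proof. by rewrite /commute !conj_comp => ->. Qed.

Lemma step_transport i e rho b phi (E : set plane) p q :
  nearly_constant beta (a i) e rho -> `|a i - b| < e -> fibre_loop b phi ->
  convex_subset E -> E `<=` punctured -> E p -> E q -> `|a i - p| < e -> `|a i - q| < e ->
  (cl (fib p (fun t => transport beta rho b p (phi t))) * sg p q)%g =
  (sg p q * cl (fib q (fun t => transport beta rho b q (phi t))))%g.
Proof.
move=> nc ib Lphi cE EP Ep Eq ip iq.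
have := @transport_loop_square _ _ _ b (fun t => p + t *: (q - p)) phi nc ib.
rewrite scale0r addr0 scale1r (addrC p) subrK => -> //.
have -> : (fun t : R => p + t *: (q - p)) = (fun t : R => (1 - t) *: p + t *: q).
  by apply/funext => t; exact: seg_combination.
split; first by continuity.
by move=> t tI; split; [exact: convex_ball|apply: EP; exact: cE].
Qed.

(** Over [a i] itself the graphs are distinct, so loops can be carried around a small square about
    [a i]; they return unchanged because [transport] is always taken from the one fibre over
    [top_pt]. The loop around [a i] is conjugate to this square, and the conjugating path carries
    the fibre loops along. *)
Lemma around_commute i phi : fibre_loop u0 phi -> commute (around i) (cl (fib u0 phi)).
Proof.
move=> Lphi; have aiD := aD i.
have [e [rho nc]] := nearly_constant_exists beta_continuous (betaD aiD).
have e0 : 0 < e by case: nc.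
have ey := a_below i.
(* The corners of the square must be within [e] of [a i], inside the half-strips of half-width
   [2 * eps], and above the level [y - 2] of the side strips. *)
pose n := Num.min eps (Num.min (e / 2) (1 / 2)).
have n0 : 0 < n by rewrite !lt_min eps_gt0 /=; lra.
have n1 : n <= eps by rewrite ge_min lexx.
have n2 : n <= e / 2 by rewrite !ge_min lexx orbT.
have n3 : n <= 1 / 2 by rewrite !ge_min lexx !orbT.
have e2 := eps_gt0.
case ai : (a i) => [x y]; rewrite ai /= in ey.
pose top_pt : plane := (x, y + n).
pose c1 : plane := (x - n, y + n). pose c2 : plane := (x - n, y - n).
pose c3 : plane := (x + n, y - n). pose c4 : plane := (x + n, y + n).
pose P := (sg u0 (x, Y) * sg (x, Y) top_pt)%g.
have sT := @sg_tri above_all _ _ _ convex_above_all above_all_punctured.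
have sU := @sg_tri _ _ _ _ (@convex_strip _ _ _) (free_strip_punctured (@free_above i)).
have vU := @sg_inv _ _ _ (@convex_strip _ _ _) (free_strip_punctured (@free_above i)).
have sL := @sg_tri _ _ _ _ (@convex_strip _ _ _) (free_strip_punctured (@free_left i (y - 2))).
have sR := @sg_tri _ _ _ _ (@convex_strip _ _ _) (free_strip_punctured (@free_right i (y - 2))).
have vR := @sg_inv _ _ _ (@convex_strip _ _ _) (free_strip_punctured (@free_right i (y - 2))).
have sB := @sg_tri _ _ _ _ (@convex_box _ _ _) (@box_punctured i).
have vB := @sg_inv _ _ _ (@convex_box _ _ _) (@box_punctured i).
rewrite ai /= in sU vU sL sR vR sB vB.
have inU s t : x - 2 * eps < s < x + 2 * eps -> y < t -> strip (x - 2 * eps) (x + 2 * eps) y (s, t).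
  by move=> /andP[? ?] ?; split.
have inL s t : x - 2 * eps < s < x -> y - 2 < t -> strip (x - 2 * eps) x (y - 2) (s, t).
  by move=> /andP[? ?] ?; split.
have inR s t : x < s < x + 2 * eps -> y - 2 < t -> strip x (x + 2 * eps) (y - 2) (s, t).
  by move=> /andP[? ?] ?; split.
have inB s t : x - 2 * eps < s < x + 2 * eps -> t < y -> box (x - 2 * eps) (x + 2 * eps) y (s, t).
  by move=> /andP[? ?] ?; split.
have [U0 Ut] : strip (x - 2 * eps) (x + 2 * eps) y (x, Y) /\ strip (x - 2 * eps) (x + 2 * eps) y top_pt.
  by split; apply: inU; lra.
have [U1 U4] : strip (x - 2 * eps) (x + 2 * eps) y c1 /\ strip (x - 2 * eps) (x + 2 * eps) y c4.
  by split; apply: inU; lra.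
have [Ul Ur] : strip (x - 2 * eps) (x + 2 * eps) y (x - eps, Y) /\
    strip (x - 2 * eps) (x + 2 * eps) y (x + eps, Y).
  by split; apply: inU; lra.
have [L1 L2] : strip (x - 2 * eps) x (y - 2) c1 /\ strip (x - 2 * eps) x (y - 2) c2.
  by split; apply: inL; lra.
have [LY Ll] : strip (x - 2 * eps) x (y - 2) (x - eps, Y) /\
    strip (x - 2 * eps) x (y - 2) (x - eps, y - 1).
  by split; apply: inL; lra.
have [R3 R4] : strip x (x + 2 * eps) (y - 2) c3 /\ strip x (x + 2 * eps) (y - 2) c4.
  by split; apply: inR; lra.
have [RY Rr] : strip x (x + 2 * eps) (y - 2) (x + eps, Y) /\
    strip x (x + 2 * eps) (y - 2) (x + eps, y - 1).
  by split; apply: inR; lra.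
have [B2 B3] : box (x - 2 * eps) (x + 2 * eps) y c2 /\ box (x - 2 * eps) (x + 2 * eps) y c3.
  by split; apply: inB; lra.
have [Bl Br] : box (x - 2 * eps) (x + 2 * eps) y (x - eps, y - 1) /\
    box (x - 2 * eps) (x + 2 * eps) y (x + eps, y - 1).
  by split; apply: inB; lra.
have lE : left_of i = (x - eps, y - 1) by rewrite /left_of ai.
have rE : right_of i = (x + eps, y - 1) by rewrite /right_of ai.
pose Q := (sg top_pt c1 * sg c1 c2 * sg c2 c3 * sg c3 c4 * sg c4 top_pt)%g.
have aE : around i = (P * Q * P^-1)%g.
  have eT p q s := sT (p, Y) (q, Y) (s, Y) (above_all_Y p) (above_all_Y q) (above_all_Y s).
  rewrite aroundE /lam_left /lam_right /down lE rE.
  exact: (@rectangle_shrink _ _ sg u0 top_pt (x, Y) (x - eps, Y) (x + eps, Y)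
    (x - eps, y - 1) (x + eps, y - 1) c1 c2 c3 c4 (eT 0 x (x - eps))
    (sU _ _ _ U0 Ut Ul) (sU _ _ _ Ut U1 Ul) (sL _ _ _ L1 LY Ll) (sL _ _ _ L1 L2 Ll)
    (eT 0 x (x + eps)) (sU _ _ _ U0 Ut Ur) (sU _ _ _ Ut U4 Ur) (sR _ _ _ R4 RY Rr)
    (sR _ _ _ R4 R3 Rr) (sB _ _ _ B2 Bl Br) (sB _ _ _ B2 B3 Br) (vR _ _ R4 R3) (vU _ _ Ut U4)).
(* The path to the square avoids [D]: it runs at height [Y], above [D], and then on the vertical
   line of [a i], which contains no point of [D]. *)
have Pup : path_in [set u | punctured u /\ u \notin D] (fun t : R => u0 + t *: ((x, Y) - u0)).
  split; first by continuity.
  move=> t tI; have y2 : (u0 + t *: ((x, Y) - u0)).2 = Y by rewrite /= subrr scaler0 addr0.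
  split; first by apply: above_all_punctured => k; rewrite y2; have := a_below k; lra.
  by apply/negP => /Dtop; rewrite y2 ltxx.
have Pdn : path_in [set u | punctured u /\ u \notin D] (fun t : R => (x, Y) + t *: (top_pt - (x, Y))).
  split; first by continuity.
  move=> t tI; have xx : ((x, Y) + t *: (top_pt - (x, Y))).1 = x by rewrite /= subrr scaler0 addr0.
  split; last by apply/negP => /Dx/(_ i); rewrite xx ai eqxx.
  have fs := free_strip_punctured (@free_above i); rewrite ai /= in fs; apply: fs.
  by rewrite seg_combination; exact: convex_strip.
have [|psi1] := transport_along Pup (phi := phi); first by rewrite scale0r addr0.
rewrite scale1r (addrC u0) subrK => Lpsi1; rewrite scale0r addr0 => E1.
have [|psi] := transport_along Pdn (phi := psi1); first by rewrite scale0r addr0.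
rewrite scale1r (addrC (x, Y)) subrK => Lpsi; rewrite scale0r addr0 => E2.
have FP : (cl (fib u0 phi) = P * cl (fib top_pt psi) * P^-1)%g.
  apply: (@mulIg _ P); rewrite mulgVK /P mulgA [in LHS]/sg E1.
  by rewrite -!mulgA; congr (_ * _)%g; rewrite E2.
rewrite aE FP; apply: commute_conj.
have near s t : `|s| <= n -> `|t| <= n -> `|a i - (x + s, y + t)| < e.
  move=> sn tn; rewrite ai plane_norm_lt /= !opprD !addrA !subrr !add0r !normrN.
  by rewrite !(le_lt_trans sn) ?(le_lt_trans tn) //; lra.
have nn : `|n| <= n by rewrite gtr0_norm.
have nN : `|- n| <= n by rewrite normrN gtr0_norm.
have n00 : `|(0 : R)| <= n by rewrite normr0 ltW.
have tE : top_pt = (x + 0, y + n) by rewrite addr0.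
have nt : `|a i - top_pt| < e by rewrite tE; exact: near.
have [nc1 nc2 nc3 nc4] : [/\ `|a i - c1| < e, `|a i - c2| < e, `|a i - c3| < e & `|a i - c4| < e].
  by split; exact: near.
have st := @step_transport i e rho top_pt psi _ _ _ nc nt Lpsi.
have stU := st _ _ _ (@convex_strip _ _ _) (free_strip_punctured (@free_above i)).
have stL := st _ _ _ (@convex_strip _ _ _) (free_strip_punctured (@free_left i (y - 2))).
have stR := st _ _ _ (@convex_strip _ _ _) (free_strip_punctured (@free_right i (y - 2))).
have stB := st _ _ _ (@convex_box _ _ _) (@box_punctured i).
rewrite ai /= -ai in stU stL stR stB.
have idE : (fun t => transport beta rho top_pt top_pt (psi t)) = psi.
  by apply/funext => t; rewrite transport_id.
have h1 := stU _ _ Ut U1 nt nc1.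
have h2 := stL _ _ L1 L2 nc1 nc2.
have h3 := stB _ _ B2 B3 nc2 nc3.
have h4 := stR _ _ R3 R4 nc3 nc4.
have h5 := stU _ _ U4 Ut nc4 nt.
rewrite -idE.
exact: (@rectangle_commute _ _ sg top_pt c1 c2 c3 c4
  (fun p => cl (fib p (fun t => transport beta rho top_pt p (psi t))))).
Qed.

End BasePlane.

Lemma morphism1 (G H : groupType) (f : {multiplicative G -> H}) : f 1%g = 1%g.
Proof. by apply: (@mulgI _ (f 1%g)); rewrite -gmulfM !mulg1. Qed.

Lemma morphismV (G H : groupType) (f : {multiplicative G -> H}) x : f x^-1%g = (f x)^-1%g.
Proof. by apply: (@mulgI _ (f x)); rewrite -gmulfM !mulgV morphism1. Qed.

(** * The crossing morphism *)

Section FreeGroupLift.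
Variables (r : nat) (G : groupType).

Definition fg_gen (i : 'I_r) : free_group r := @FreeGroup r [:: (i, false)] isT.

Section Lift.
Variable g : 'I_r -> G.

Definition letter_val (a : letter r) : G := if a.2 then (g a.1)^-1%g else g a.1.

Definition word_val (w : seq (letter r)) : G := foldr (fun a x => letter_val a * x)%g 1%g w.

Lemma letter_valV a : letter_val (linv a) = (letter_val a)^-1%g.
Proof. by case: a => i [] //=; rewrite /letter_val /= invgK. Qed.

Lemma word_val_push a w : word_val (push a w) = (letter_val a * word_val w)%g.
Proof. by case: w => [//|b w] /=; case: eqP => // ->; rewrite letter_valV mulVKg. Qed.

Lemma word_val_reduce w : word_val (reduce w) = word_val w.
Proof. by elim: w => //= a w IH; rewrite word_val_push IH. Qed.

Lemma word_val_cat u v : word_val (u ++ v) = (word_val u * word_val v)%g.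
Proof. by elim: u => [|a u IH] /=; rewrite ?mul1g // IH mulgA. Qed.

Lemma free_lift : exists f : {multiplicative free_group r -> G}, forall i, f (fg_gen i) = g i.
Proof.
pose f (x : free_group r) := word_val x.
have fM : {morph f : x y / (x * y)%g}.
  by move=> x y; rewrite /f /= word_val_reduce word_val_cat.
exists (HB.pack_for {multiplicative free_group r -> G} f (isMultiplicative.Build _ _ f fM)) => i.
by rewrite /= /f /word_val /= mulg1.
Qed.

End Lift.

Lemma fg_cons a w (raw : reduced (a :: w)) (rw : reduced w) :
  FreeGroup raw = ((if a.2 then (fg_gen a.1)^-1 else fg_gen a.1) * FreeGroup rw)%g.
Proof.
apply: val_inj; rewrite /=.
have -> : fg_word (if a.2 then (fg_gen a.1)^-1%g else fg_gen a.1) = [:: a].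
  by case: (a) => i [].
by rewrite cat1s reduce_id.
Qed.

Lemma free_hom_eq (f f' : {multiplicative free_group r -> G}) :
  (forall i, f (fg_gen i) = f' (fg_gen i)) -> f =1 f'.
Proof.
move=> ff' [w rw]; elim: w rw => [|a w IH] rw.
  have -> : FreeGroup rw = 1%g by exact: val_inj.
  by rewrite !morphism1.
have rw' : reduced w by exact: path_sorted rw.
by rewrite (fg_cons rw rw') !gmulfM IH; case: a.2; rewrite ?morphismV ff'.
Qed.

End FreeGroupLift.

Section Commuting.
Variables (r : nat) (G : groupType) (f : {multiplicative free_group r -> G}).

Lemma commute_free_image (z : G) : (forall i, commute z (f (fg_gen i))) ->
  forall w, commute z (f w).
Proof.
move=> H [w rw]; elim: w rw => [|a w IH] rw.
  have -> : FreeGroup rw = 1%g by exact: val_inj.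
  by rewrite morphism1; exact: commute1.
have rw' : reduced w by exact: path_sorted rw.
rewrite (fg_cons rw rw') gmulfM; apply: commuteM => //.
by case: a.2; rewrite ?morphismV; [apply: commuteV|].
Qed.

End Commuting.

Section Bundle.
Context {R : realType}.
Local Notation plane := (R * R)%type.
Variables (J : finType) (beta : J -> plane -> plane) (D : seq plane).
Variables (r : nat) (a : 'I_r -> plane) (Y eps : R).
Hypothesis beta_continuous : forall j, continuous (beta j).
Hypothesis beta_bounded : forall j u, `|beta j u| <= 1.
Hypothesis betaD : forall u, u \notin D -> injective (beta ^~ u).
Hypothesis a_below : forall i, (a i).2 + 1 < Y.
Hypothesis eps_gt0 : 0 < eps.
Hypothesis a_sep : forall i i', i != i' -> 2 * eps <= `|(a i).1 - (a i').1|.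
Hypothesis Dtop : forall d, d \in D -> d.2 < Y.
Hypothesis Dx : forall d, d \in D -> forall i, d.1 != (a i).1.
Hypothesis aD : forall i, a i \notin D.
Variable x0 : set_type (total_space beta a).
Hypothesis x0E : val x0 = sigma (u0 Y).
Variable tau : plane * plane -> R -> plane * plane.
Hypothesis tauP : forall x, total_space beta a x ->
  [/\ path_in (total_space beta a) (tau x), tau x 0 = val x0 & tau x 1 = x].
Hypothesis tau_base : tau (val x0) = fun=> val x0.

Local Notation total := (total_space beta a).
Local Notation cl := (cls x0 tau).
Local Notation sg := (sg x0 tau).
Local Notation around := (around Y eps x0 tau).
Local Notation pot := (pot Y eps x0 tau).
Local Notation box_at i := (box ((a i).1 - 2 * eps) ((a i).1 + 2 * eps) (a i).2).

(** Points straight below [a i] count as lying on its left, in accordance with [pot]. *)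
Definition relevant (u v : plane) i :=
  [&& u.2 < (a i).2, v.2 < (a i).2 & (u.1 <= (a i).1) != (v.1 <= (a i).1)].

(** The generators are read off from the crossings with the half-lines below the
    points [a i]. *)
Definition crossing (u v : plane) : free_group r :=
  if [pick i | relevant u v i] is Some i
  then (if u.1 <= (a i).1 then fg_gen i else (fg_gen i)^-1)%g else 1%g.

Lemma crossing_none u v : (forall i, ~~ relevant u v i) -> crossing u v = 1%g.
Proof. by move=> H; rewrite /crossing; case: pickP => // i; rewrite (negPf (H i)). Qed.

Definition side i (u : plane) : free_group r := if u.1 <= (a i).1 then 1%g else fg_gen i.

(** No other puncture has its abscissa in this range, so only one half-line can be crossed and the
    crossing is the coboundary of [side i]; the cocycle identity follows. *)
Lemma crossing_box i u v : box_at i u -> box_at i v ->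
  crossing u v = ((side i u)^-1 * side i v)%g.
Proof.
move=> [[/= u1 u2] u3] [[/= v1 v2] v3].
have only k : relevant u v k -> k = i.
  move=> /and3P[_ _ uv]; apply: (near_a a_sep); move: uv.
  by case: (lerP u.1 (a k).1) => h1; case: (lerP v.1 (a k).1) => h2 //= _; lra.
rewrite /crossing; case: pickP => [k rk|nr].
  have ki := only k rk; move: rk; rewrite ki => /and3P[_ _]; rewrite /side.
  by case: ifP => h1; case: ifP => h2 //= _; rewrite ?invg1 ?mul1g ?mulg1.
have := nr i; rewrite /relevant u3 v3 /= => /negbFE/eqP uv.
by rewrite /side uv mulVg.
Qed.

Lemma crossing_strip c d h u v : free_strip a c d h -> strip c d h u -> strip c d h v ->
  crossing u v = 1%g.
Proof.
move=> fs [[/= u1 u2] u3] [[/= v1 v2] v3]; apply: crossing_none => i.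
apply/negP => /and3P[ua va uv]; have : (a i).2 <= h.
  apply: fs; move: uv.
  by case: (lerP u.1 (a i).1) => h1; case: (lerP v.1 (a i).1) => h2 //= _; lra.
by lra.
Qed.

Lemma crossing_top u v : above_all a u -> crossing u v = 1%g.
Proof. by move=> ua; apply: crossing_none => i; rewrite /relevant ltNge ltW //. Qed.

Lemma crossing_local q : total q -> exists2 B, nbhs q B & forall x y z,
  total x -> total y -> total z -> B x -> B y -> B z ->
  (crossing x.1 y.1 * crossing y.1 z.1)%g = crossing x.1 z.1.
Proof.
move=> [/(punctured_local a_below eps_gt0)[e e0 H] _].
exists (ball q e); first exact: nbhsx_ballx.
move=> x y z _ _ _; rewrite -ball_normE /= !prod_norm_lt /=.
move=> /andP[qx _] /andP[qy _] /andP[qz _].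
case: H => [[i inB]|[h hY [fs inS]]].
- by rewrite !(@crossing_box i) //; try exact: inB; rewrite mulgA mulgK.
- by rewrite !(crossing_strip fs) ?mulg1 //; exact: inS.
Qed.

Local Notation hol_c := (hol (fun x y : plane * plane => crossing x.1 y.1)).

Lemma hol_sg (E : set plane) p q : convex_subset E -> E `<=` punctured a ->
  (forall u v w, E u -> E v -> E w -> (crossing u v * crossing v w)%g = crossing u w) ->
  E p -> E q -> hol_c (seg (@sigma R) p q) = crossing p q.
Proof.
move=> cE EP coc Ep Eq.
have -> : crossing p q = crossing (seg (@sigma R) p q 0).1 (seg (@sigma R) p q 1).1.
  by rewrite /seg /= scale0r addr0 scale1r (addrC p) subrK.
apply: (hol_cocycle (S := [set x | E x.1 /\ total x])).
- by move=> x y z [? _] [? _] [? _]; exact: coc.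
- split; first by apply: (continuousT_comp _ (@sigma_continuous R)); continuity.
  move=> t tI; rewrite /seg /= seg_combination; have h := cE _ _ _ Ep Eq tI.
  by split => //; apply: (sigma_total beta_bounded); exact: EP.
Qed.

(** The rectangle around [a i] meets the half-lines once, on its lower side, and a fibre loop does
    not move in the base. The holonomies [th] of the paths chosen by [tau] cancel along the loop. *)
Lemma crossing_morphism : exists h : {multiplicative pi1 R x0 -> free_group r},
  (forall i, h (around i) = fg_gen i) /\
  (forall phi, fibre_loop beta (u0 Y) phi -> h (cl (fib (u0 Y) phi)) = 1%g).
Proof.
have [h hE] := @hol_morphism R _ _ _ _ crossing_local x0.
pose th (u : plane) := hol_c (tau (sigma u)).
have clE f : path_in total f ->
    h (cl f) = (hol_c (tau (f 0%R)) * hol_c f * (hol_c (tau (f 1%R)))^-1)%g.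
  by move=> Tf; rewrite hE; [apply: (hol_close crossing_local tauP)|apply: (based_close tauP)].
have th0 : th (u0 Y) = 1%g.
  rewrite /th -x0E tau_base (hol_cocycle (S := [set val x0])).
  - by apply: crossing_top; rewrite x0E; exact: (above_all_Y a_below).
  - move=> x y z -> -> ->; rewrite !crossing_top ?mulg1 //; rewrite x0E;
      exact: (above_all_Y a_below).
  - by split => //; exact: continuousT_cst.
have sgE (E : set plane) p q : convex_subset E -> E `<=` punctured a ->
    (forall u v w, E u -> E v -> E w -> (crossing u v * crossing v w)%g = crossing u w) ->
    E p -> E q -> h (sg p q) = (th p * crossing p q * (th q)^-1)%g.
  move=> cE EP coc Ep Eq; rewrite clE.
    by rewrite (hol_sg cE EP coc Ep Eq) /seg /th scale0r addr0 scale1r (addrC p) subrK.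
  apply: (seg_path (@sigma_continuous R) (E := E)) => // u Eu.
  by apply: (sigma_total beta_bounded); exact: EP.
exists h; split=> [i|phi [Fphi phi0 phi1]]; last first.
  have pu := punctured_u0 a_below.
  have Tf := path_in_fib pu Fphi.
  rewrite clE // /fib phi0 phi1 -/(sigma _) -/(th _) th0 mul1g invg1 mulg1.
  have cT u v : u = u0 Y -> crossing u v = 1%g.
    by move=> ->; apply: crossing_top; exact: (above_all_Y a_below).
  rewrite (hol_cocycle (S := [set x | x.1 = u0 Y /\ total x])).
  - exact: cT.
  - by move=> x y z [xu _] [yu _] _; rewrite !cT // mulg1.
  - by case: Tf => cf Tf; split => // t tI; split => //; exact: Tf.
have e3 := eps_gt0.
(* A descent crosses no half-line; only the holonomy of the closing path at its end remains. *)
have downE x s c d : (forall h, free_strip a c d h) -> c < x < d ->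
    h (down Y x0 tau x s) = (th (x, s))^-1%g.
  move=> fs /andP[cx xd].
  pose k := Num.min (Y - 1) (s - 1).
  have k1 : k <= Y - 1 by rewrite ge_min lexx.
  have k2 : k <= s - 1 by rewrite ge_min lexx orbT.
  rewrite /down gmulfM (sgE (above_all a)); last 4 first.
  - exact: above_all_punctured.
  - by move=> u v w ua va wa; rewrite !crossing_top // mulg1.
  - exact: (above_all_Y a_below).
  - exact: (above_all_Y a_below).
  - rewrite (sgE (strip c d k)).
    + rewrite crossing_top; last exact: (above_all_Y a_below).
      rewrite th0 !mul1g crossing_top; last exact: (above_all_Y a_below).
      by rewrite mulg1 mulgA mulVg mul1g.
    + exact: convex_strip.
    + exact: free_strip_punctured (fs k).
    + by move=> u v w Su Sv Sw; rewrite !(crossing_strip (fs k)) // mulg1.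
    + by split; [split|] => //=; lra.
    + by split; [split|] => //=; lra.
  - exact: convex_above_all.
rewrite aroundE 2!gmulfM morphismV /lam_left /lam_right.
rewrite (@downE (left_of a eps i).1 _ _ _ (free_left eps_gt0 a_sep (i := i))); last by rewrite /left_of /=; lra.
rewrite (@downE (right_of a eps i).1 _ _ _ (free_right eps_gt0 a_sep (i := i))); last by rewrite /right_of /=; lra.
have Bl : box_at i (left_of a eps i) by split; [split|] => /=; lra.
have Br : box_at i (right_of a eps i) by split; [split|] => /=; lra.
rewrite (sgE (box_at i)) //; last 3 first.
- exact: convex_box.
- exact: box_punctured.
- by move=> u v w Bu Bv Bw; rewrite !(@crossing_box i) // mulgA mulgK.
rewrite (crossing_box Bl Br) /side /= ifT; last by lra.
rewrite ifF; last by apply/negbTE; rewrite -ltNge; lra.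
by rewrite invg1 mul1g invgK !mulgA mulVg mul1g mulgVK.
Qed.

(** The projection onto the second factor of the product structure. *)
Lemma fibre_projection (h : {multiplicative pi1 R x0 -> free_group r})
    (l : {multiplicative free_group r -> pi1 R x0}) :
  (forall i, h (around i) = fg_gen i) ->
  (forall phi, fibre_loop beta (u0 Y) phi -> h (cl (fib (u0 Y) phi)) = 1%g) ->
  (forall i, l (fg_gen i) = around i) ->
  exists pr : {multiplicative pi1 R x0 -> pi1 R x0},
    (forall g, pr g = (l (h g))^-1 * g)%g /\ (forall i, pr (around i) = 1%g).
Proof.
move=> ha hf la; pose pr (g : pi1 R x0) := ((l (h g))^-1 * g)%g.
(* Multiplicativity at [(x, y)] needs [pr x] to commute with the image of [l]. So commutation is
   proved first for all elements, by induction on generators, and only then is [pr] a morphism. *)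
have prM x y : (forall i, commute (pr x) (around i)) -> pr (x * y)%g = (pr x * pr y)%g.
  move=> cx; have : commute (pr x) (l (h y)).
    by apply: commute_free_image => i; rewrite la; exact: cx.
  move=> /commuteV; rewrite /commute => E.
  have -> : pr (x * y)%g = ((l (h y))^-1 * pr x * y)%g by rewrite /pr !gmulfM invgM !mulgA.
  by rewrite -E -mulgA.
have prV x : (forall i, commute (pr x) (around i)) -> pr x^-1%g = (pr x)^-1%g.
  move=> cx; have := prM x x^-1%g cx; rewrite mulgV.
  have -> : pr 1%g = 1%g by rewrite /pr !morphism1 invg1 mulg1.
  by move=> E; apply: (@mulgI _ (pr x)); rewrite -E mulgV.
have prc g i : commute (pr g) (around i).
  move: i; apply: (generation beta_continuous beta_bounded betaD a_below eps_gt0 a_sep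
    Dtop x0E tauP tau_base g (P := fun g => forall i, commute (pr g) (around i))).
  - by move=> i; rewrite /pr !morphism1 invg1 mulg1; apply: commute_sym; exact: commute1.
  - move=> x y cx cy i; rewrite prM //.
    by apply: commute_sym; apply: commuteM; apply: commute_sym.
  - by move=> x cx i; rewrite prV //; apply: commute_sym; apply: commuteV; apply: commute_sym.
  - move=> _ [[k ->] i|[phi Lphi ->] i].
      by rewrite /pr ha la mulVg; apply: commute_sym; exact: commute1.
    rewrite /pr hf // morphism1 invg1 mul1g; apply: commute_sym.
    exact: (around_commute beta_continuous beta_bounded betaD a_below eps_gt0 a_sep Dtop Dx aD tauP).
have prM' : {morph pr : x y / (x * y)%g} by move=> x y; exact: prM.
exists (HB.pack_for {multiplicative pi1 R x0 -> pi1 R x0} pr (isMultiplicative.Build _ _ pr prM')).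
by split=> // i; rewrite /= /pr ha la mulVg.
Qed.

End Bundle.

Lemma nearly_constant_le (R : realType) (J : finType) (beta : J -> R * R -> R * R) q e e' rho :
  nearly_constant beta q e rho -> 0 < e' <= e -> nearly_constant beta q e' rho.
Proof.
move=> [e0 r0 h1 h2] /andP[e'0 e'e]; split => // [j u u' qu qu'|j k u jk qu].
  by apply: h1; [exact: lt_le_trans qu e'e|exact: lt_le_trans qu' e'e].
by apply: h2 => //; exact: lt_le_trans qu e'e.
Qed.

(** * The kernel of the inclusion into the complement of the graphs *)

Section Kernel.
Context {R : realType}.
Local Notation plane := (R * R)%type.
Variables (J : finType) (beta : J -> plane -> plane) (D : seq plane).
Variables (r : nat) (a : 'I_r -> plane) (Y eps : R).
Hypothesis beta_continuous : forall j, continuous (beta j).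
Hypothesis beta_bounded : forall j u, `|beta j u| <= 1.
Hypothesis betaD : forall u, u \notin D -> injective (beta ^~ u).
Hypothesis a_below : forall i, (a i).2 + 1 < Y.
Hypothesis eps_gt0 : 0 < eps.
Hypothesis a_sep : forall i i', i != i' -> 2 * eps <= `|(a i).1 - (a i').1|.
Hypothesis Dtop : forall d, d \in D -> d.2 < Y.
Hypothesis Dx : forall d, d \in D -> forall i, d.1 != (a i).1.
Hypothesis aD : forall i, a i \notin D.
Variable x0 : set_type (total_space beta a).
Hypothesis x0E : val x0 = sigma (u0 Y).
Variable tau : plane * plane -> R -> plane * plane.
Hypothesis tauP : forall x, total_space beta a x ->
  [/\ path_in (total_space beta a) (tau x), tau x 0 = val x0 & tau x 1 = x].
Hypothesis tau_base : tau (val x0) = fun=> val x0.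

Local Notation total := (total_space beta a).
Local Notation cl := (cls x0 tau).
Local Notation sg := (sg x0 tau).
Local Notation around := (around Y eps x0 tau).
Local Notation pot := (pot Y eps x0 tau).
Local Notation box_at i := (box ((a i).1 - 2 * eps) ((a i).1 + 2 * eps) (a i).2).
Variable pr : {multiplicative pi1 R x0 -> pi1 R x0}.
Hypothesis pr_around : forall i, pr (around i) = 1%g.
Variables (e rho : 'I_r -> R).
Hypothesis nc : forall i, nearly_constant beta (a i) (e i) (rho i).
Hypothesis e_eps : forall i, e i <= eps.

Definition total0 : set (plane * plane) := [set x | fibre beta x.1 x.2].

(** Paths with arbitrary ends become group elements: the potentials replace the ends, and [pr] kills
    the remaining ambiguity by loops around punctures. In particular a path at level [winf] has
    value [1]. *)
Definition psi (f : R -> plane * plane) : pi1 R x0 :=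
  pr (pot (f 0%R).1 * cl f * (pot (f 1%R).1)^-1)%g.

Lemma psi_mul f g h : (f 0).1 = (h 0).1 -> (f 1).1 = (g 0).1 -> (g 1).1 = (h 1).1 ->
  (cl f * cl g)%g = cl h -> (psi f * psi g)%g = psi h.
Proof. by move=> fh fg gh E; rewrite /psi -gmulfM fg conj_comp E fh gh. Qed.

Lemma psi_concat f g : path_in total f -> path_in total g -> f 1 = g 0 ->
  psi (concat_fun f g) = (psi f * psi g)%g.
Proof.
move=> Tf Tg fg; rewrite (psi_mul (h := concat_fun f g)) ?concat_fun0 ?concat_fun1 ?fg //.
by rewrite (cls_concat tauP).
Qed.

Lemma psi_loops_around g : loops_around Y eps tau g -> pr g = 1%g.
Proof.
move=> H; apply: (H (fun g => pr g = 1%g)) => [|x y px py|x px|x [i ->]].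
- exact: morphism1.
- by rewrite gmulfM px py mulg1.
- by rewrite morphismV px invg1.
- exact: pr_around.
Qed.

Lemma psi_sigma p : path_in (punctured a) p -> psi (fun v => sigma (p v)) = 1%g.
Proof.
by move=> Pp; apply: psi_loops_around; apply: (sigma_path_pot beta_bounded a_below eps_gt0 a_sep tauP).
Qed.

Lemma psi_cst x : total x -> psi (fun=> x) = 1%g.
Proof. by move=> Tx; rewrite /psi (cls_cst tauP) // mulg1 mulgV morphism1. Qed.

Lemma psi_rev f : path_in total f -> psi (fun t => f (1 - t)) = (psi f)^-1%g.
Proof.
move=> Tf; rewrite /psi subr0 subrr (cls_rev tauP) // -morphismV.
by rewrite !invgM invgK mulgA.
Qed.

Lemma psi_square (F : R * R -> plane * plane) : continuous F ->
  (forall s t : R, 0 <= s <= 1 -> 0 <= t <= 1 -> total (F (s, t))) ->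
  (psi (fun s => F (s, 0%R)) * psi (fun t => F (1%R, t)))%g =
  (psi (fun t => F (0%R, t)) * psi (fun s => F (s, 1%R)))%g.
Proof.
by move=> cF TF; rewrite /psi -!gmulfM !conj_comp (cls_square tauP cF TF).
Qed.

(** The two edges at level [winf] have value [1], so the two others have equal values. *)
Lemma psi_square_left (F : R * R -> plane * plane) : continuous F ->
  (forall s t : R, 0 <= s <= 1 -> 0 <= t <= 1 -> total (F (s, t))) ->
  (forall s : R, 0 <= s <= 1 -> (F (s, 0)).2 = winf) ->
  (forall s : R, 0 <= s <= 1 -> (F (s, 1)).2 = winf) ->
  psi (fun t => F (0%R, t)) = psi (fun t => F (1%R, t)).
Proof.
move=> cF TF F0 F1; have := psi_square cF TF.
have side t : 0 <= t <= 1 -> (forall s : R, 0 <= s <= 1 -> (F (s, t)).2 = winf) ->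
    psi (fun s => F (s, t)) = 1%g.
  move=> tI Ft; have cF' : continuous (fun s => F (s, t)).
    by apply: (continuousT_comp _ cF); continuity.
  have TF' : path_in total (fun s => F (s, t)) by split => // s sI; exact: TF.
  have Pp : path_in (punctured a) (fun s => (F (s, t)).1).
    by split; [exact: continuousT_fst|move=> s /TF/(_ tI)[]].
  have I0 : 0 <= (0 : R) <= 1 by lra.
  have I1 : 0 <= (1 : R) <= 1 by lra.
  have e1 (s : R) : 0 <= s <= 1 -> sigma (F (s, t)).1 = F (s, t).
    by move=> sI; move: (Ft s sI); rewrite /sigma; case: (F (s, t)) => /= x y ->.
  rewrite -(psi_sigma Pp) /psi (e1 _ I0) (e1 _ I1).
  rewrite -(cls_eq tauP (f := fun s => sigma (F (s, t)).1)) //.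
  exact: (path_in_sigma beta_bounded).
by rewrite !side ?mul1g ?mulg1 //; lra.
Qed.

(** The fibre over this reference point, near [a i], stands in for the fibre missing over [a i]. *)
Definition ui i : plane := ((a i).1, (a i).2 + e i / 2).

Lemma e_gt0 i : 0 < e i. Proof. by case: (nc i). Qed.

Lemma ui_near i : `|a i - ui i| < e i.
Proof.
rewrite /ui plane_norm_lt /= subrr normr0 opprD addrA subrr add0r normrN.
by have e0 := e_gt0 i; rewrite gtr0_norm; lra.
Qed.

Lemma near_unique i k u : `|a i - u| < e i -> `|a k - u| < e k -> k = i.
Proof.
rewrite !plane_norm_lt => /andP[iu _] /andP[ku _]; apply: (near_a a_sep).
have := e_eps i; have := e_eps k; move: iu ku.
by rewrite /= !ltr_norml => /andP[h1 h2] /andP[h3 h4] h5 h6; lra.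
Qed.

Lemma ui_punctured i : punctured a (ui i).
Proof.
move=> k; apply/eqP => E; have E' := ui_near i; rewrite E in E'.
have ki : k = i by apply: (near_unique E'); rewrite subrr normr0 e_gt0.
by move: E; rewrite ki /ui; have := e_gt0 i; case: (a i) => x y /= h [] ; lra.
Qed.

Lemma psi_move i b (p phi : R -> plane) : `|a i - b| < e i ->
  path_in ([set u | `|a i - u| < e i] `&` punctured a) p -> fibre_loop beta b phi ->
  psi (fib (p 0) (fun t => transport beta (rho i) b (p 0) (phi t))) =
  psi (fib (p 1) (fun t => transport beta (rho i) b (p 1) (phi t))).
Proof.
move=> ib [cp Pp] [[cphi Fphi] phi0 phi1].
apply: (psi_square_left (F := fun st => (p st.1, transport beta (rho i) b (p st.1) (phi st.2)))) => /=.
- have c1 : continuous (fun st : R * R => p st.1) by apply: (continuousT_comp _ cp); continuity.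
  have c2 : continuous (fun st : R * R => phi st.2) by apply: (continuousT_comp _ cphi); continuity.
  apply: pair_continuous => //; apply: (transport_continuous (beta := beta)) => //.
  exact: continuousT_cst.
- move=> s t sI tI; have [qp pp] := Pp _ sI; split => //=.
  by apply: (transport_fibre (nc i)) => //; exact: Fphi.
- by move=> s sI; rewrite phi0 (transport_winf beta_bounded (nc i)).
- by move=> s sI; rewrite phi1 (transport_winf beta_bounded (nc i)).
Qed.

Lemma psi_to_ui i b (phi : R -> plane) : `|a i - b| < e i -> punctured a b -> fibre_loop beta b phi ->
  psi (fib b phi) = psi (fib (ui i) (fun t => transport beta (rho i) b (ui i) (phi t))).
Proof.
move=> ib pb Lphi.
have idE : phi = (fun t => transport beta (rho i) b b (phi t)).
  by apply/funext => t; rewrite transport_id.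
have e0 := e_gt0 i.
(* The segment from [b] to [ui i] could pass through [a i]; the detour by a point level with [a i],
   on the same side as [b], avoids it. *)
pose m : plane := (if (a i).1 <= b.1 then (a i).1 + e i / 2 else (a i).1 - e i / 2, (a i).2).
have im : `|a i - m| < e i.
  rewrite plane_norm_lt /= subrr normr0 e0 andbT; case: ifP => _.
    by rewrite opprD addrA subrr add0r normrN gtr0_norm; lra.
  by rewrite opprD opprK addrA subrr add0r gtr0_norm; lra.
have seg_near u v : `|a i - u| < e i -> `|a i - v| < e i ->
    (forall t : R, 0 <= t <= 1 -> u + t *: (v - u) != a i) ->
    path_in ([set u | `|a i - u| < e i] `&` punctured a) (fun t : R => u + t *: (v - u)).
  move=> iu iv H; split; first by continuity.
  move=> t tI; have nt : `|a i - (u + t *: (v - u))| < e i.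
    by rewrite seg_combination; exact: convex_ball.
  split => // k; apply/eqP => E; have ki : k = i.
    by apply: (near_unique nt); rewrite E subrr normr0 e_gt0.
  by move/eqP: (H t tI); apply; rewrite E ki.
have h1 := seg_near b m ib im _; have h2 := seg_near m (ui i) im (ui_near i) _.
have := psi_move ib (h1 _) Lphi; rewrite scale0r addr0 scale1r (addrC b) subrK -idE => ->.
  have := psi_move ib (h2 _) Lphi; rewrite scale0r addr0 scale1r (addrC m) subrK => -> //.
  move=> t tI; apply/eqP => E; have E1 : m.1 + t * ((ui i).1 - m.1) = (a i).1 by rewrite -[in RHS]E.
  have E2 : m.2 + t * ((ui i).2 - m.2) = (a i).2 by rewrite -[in RHS]E.
  move: E1 E2; rewrite /m /ui /=; case: ifP => _ E1 E2.
    have t1 : (1 - t) * (e i / 2) = 0 by move: E1; lra.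
    have t0 : t * (e i / 2) = 0 by move: E2; lra.
    have : e i / 2 = (1 - t) * (e i / 2) + t * (e i / 2) by ring.
    by rewrite t1 t0; lra.
  have t1 : (1 - t) * (e i / 2) = 0 by move: E1; lra.
  have t0 : t * (e i / 2) = 0 by move: E2; lra.
  have : e i / 2 = (1 - t) * (e i / 2) + t * (e i / 2) by ring.
    by rewrite t1 t0; lra.
move=> t tI; apply/eqP => E; have E1 : b.1 + t * (m.1 - b.1) = (a i).1 by rewrite -[in RHS]E.
have E2 : b.2 + t * (m.2 - b.2) = (a i).2 by rewrite -[in RHS]E.
have ab : b != a i by exact: pb.
move: E1 E2; rewrite /m /=; case: ifP => ib1 E1 E2.
  have tz : t = 0.
    have : (1 - t) * (b.1 - (a i).1) + t * (e i / 2) = 0 by move: E1; lra.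
    by move=> h; apply/eqP; rewrite eq_le; apply/andP; split; [|lra]; nra.
  move/eqP: ab; apply; move: E1 E2; rewrite tz !mul0r !addr0.
  by case: (b) (a i) => x y [x' y'] /= -> ->.
have : (1 - t) * ((a i).1 - b.1) + t * (e i / 2) = 0 by move: E1; lra.
move/negbT: ib1; rewrite -ltNge => h h'.
have h1' : 0 < (a i).1 - b.1 by lra.
have h2' : 0 < e i / 2 by lra.
by have := convex_gt h1' h2' tI; rewrite h' ltxx.
Qed.

(** This makes sense over [a i] as well, where [total0] has points and [total] has none. *)
Definition retract i (x : plane * plane) : plane * plane :=
  (ui i, transport beta (rho i) x.1 (ui i) x.2).

Lemma retract_continuous i : continuous (retract i).
Proof.
apply: pair_continuous; first exact: continuousT_cst.
by apply: (transport_continuous (beta := beta)) => //; [continuity|exact: continuousT_cst|continuity].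
Qed.

Lemma retract_total i x : `|a i - x.1| < e i -> total0 x -> total (retract i x).
Proof.
move=> ix Tx; split; first exact: ui_punctured.
by apply: (transport_fibre (nc i)) => //; exact: ui_near.
Qed.

(** Over a convex punctured set the base coordinate is contracted to its initial value [u1] while
    the fibre coordinate is transported; the resulting fibre loop is then moved to [ui i]. *)
Lemma psi_retract_loop i (E : set plane) (Z : R -> plane * plane) : convex_subset E ->
  E `<=` [set u | `|a i - u| < e i] `&` punctured a -> path_in total Z ->
  (forall t, 0 <= t <= 1 -> E (Z t).1) -> (Z 0).2 = winf -> (Z 1).2 = winf ->
  psi Z = psi (fun t => retract i (Z t)).
Proof.
move=> cE EB [cZ TZ] EZ Z0 Z1.
have I0 : 0 <= (0 : R) <= 1 by lra.
have I1 : 0 <= (1 : R) <= 1 by lra.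
have cu : continuous (fun t => (Z t).1) by exact: continuousT_fst.
have cw : continuous (fun t => (Z t).2) by exact: continuousT_snd.
pose u1 := (Z 0).1; have Eu1 : E u1 by exact: EZ.
have [iu1 pu1] := EB _ Eu1.
pose v (s t : R) : plane := (1 - s) *: (Z t).1 + s *: u1.
have cv : continuous (fun st : R * R => v st.1 st.2).
  have c1 : continuous (fun st : R * R => (Z st.2).1) by apply: (continuousT_comp _ cu); continuity.
  by rewrite /v; continuity.
have cZ2 : continuous (fun st : R * R => (Z st.2).2) by apply: (continuousT_comp _ cw); continuity.
have cZ1 : continuous (fun st : R * R => (Z st.2).1) by apply: (continuousT_comp _ cu); continuity.
have Ev s t : 0 <= s <= 1 -> 0 <= t <= 1 -> E (v s t) by move=> sI tI; apply: cE => //; exact: EZ.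
have FZ t : 0 <= t <= 1 -> fibre beta (Z t).1 (Z t).2 by move=> /TZ[].
have iZ t : 0 <= t <= 1 -> `|a i - (Z t).1| < e i by move=> /EZ/EB[].
pose delta (t : R) := transport beta (rho i) (Z t).1 u1 (Z t).2.
have Ldelta : fibre_loop beta u1 delta.
  split.
  - split; last by move=> t tI; apply: (transport_fibre (nc i)); [exact: iZ|exact: iu1|exact: FZ].
    by apply: (transport_continuous (beta := beta)) => //; exact: continuousT_cst.
  - by rewrite /delta Z0 (transport_winf beta_bounded (nc i)).
  - by rewrite /delta Z1 (transport_winf beta_bounded (nc i)).
have step1 : psi Z = psi (fib u1 delta).
  have := @psi_square_left (fun st => (v st.1 st.2, transport beta (rho i) (Z st.2).1 (v st.1 st.2) (Z st.2).2)).
  rewrite /= /v subr0 subrr.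
  have -> : (fun t => (1 *: (Z t).1 + 0 *: u1, transport beta (rho i) (Z t).1 (1 *: (Z t).1 + 0 *: u1) (Z t).2)) = Z.
    by apply/funext => t; rewrite scale1r scale0r addr0 transport_id; case: (Z t).
  have -> : (fun t => (0 *: (Z t).1 + 1 *: u1, transport beta (rho i) (Z t).1 (0 *: (Z t).1 + 1 *: u1) (Z t).2)) = fib u1 delta.
    by apply/funext => t; rewrite scale1r scale0r add0r.
  apply.
  - by apply: pair_continuous => //; apply: (transport_continuous (beta := beta)).
  - move=> s t sI tI; have [iv pv] := EB _ (Ev s t sI tI); split => //=.
    by apply: (transport_fibre (nc i)) => //; [exact: iZ|exact: FZ].
  - by move=> s sI; rewrite Z0 (transport_winf beta_bounded (nc i)).
  - by move=> s sI; rewrite Z1 (transport_winf beta_bounded (nc i)).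
rewrite step1 (psi_to_ui iu1 pu1 Ldelta).
(* Transport is not functorial: passing through [u1] differs from going straight to [ui i]. Sliding
   the intermediate point from [u1] to [(Z t).1] interpolates between the two. *)
have := @psi_square_left (fun st => (ui i, transport beta (rho i) (v (1 - st.1) st.2) (ui i)
   (transport beta (rho i) (Z st.2).1 (v (1 - st.1) st.2) (Z st.2).2))).
rewrite /= subr0 subrr.
have -> : (fun t => (ui i, transport beta (rho i) (v 1 t) (ui i) (transport beta (rho i) (Z t).1 (v 1 t) (Z t).2)))
   = fib (ui i) (fun t => transport beta (rho i) u1 (ui i) (delta t)).
  by apply/funext => t; rewrite /v subrr scale0r add0r scale1r.
have -> : (fun t => (ui i, transport beta (rho i) (v 0 t) (ui i) (transport beta (rho i) (Z t).1 (v 0 t) (Z t).2)))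
   = fun t => retract i (Z t).
  by apply/funext => t; rewrite /v subr0 scale0r addr0 scale1r transport_id.
apply.
- have cv' : continuous (fun st : R * R => v (1 - st.1) st.2).
    have c2 : continuous (fun st : R * R => (1 - st.1, st.2)) by continuity.
    exact: (continuousT_comp c2 cv).
  apply: pair_continuous; first exact: continuousT_cst.
  apply: (transport_continuous (beta := beta)) => //; first exact: continuousT_cst.
  exact: (transport_continuous (beta := beta)).
- move=> s t sI tI; have sI' : 0 <= 1 - s <= 1 by lra.
  have [iv pv] := EB _ (Ev (1 - s) t sI' tI); split => /=; first exact: ui_punctured.
  apply: (transport_fibre (nc i)) => //; first exact: ui_near.
  by apply: (transport_fibre (nc i)) => //; [exact: iZ|exact: FZ].
- by move=> s sI; rewrite Z0 !(transport_winf beta_bounded (nc i)).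
- by move=> s sI; rewrite Z1 !(transport_winf beta_bounded (nc i)).
Qed.

Variable fp : plane * plane -> R -> plane.
Hypothesis fpP : forall x, total0 x ->
  [/\ path_in (fibre beta x.1) (fp x), fp x 0 = winf & fp x 1 = x.2].

Local Notation sgm := (seg (fun x : plane * plane => x)).
Local Notation fibp x := (fib x.1 (fp x)).

Definition near_cocycle i (x y : plane * plane) : pi1 R x0 :=
  (psi (fun t => retract i (fibp x t)) * psi (fun t => retract i (sgm x y t)) *
   (psi (fun t => retract i (fibp y t)))^-1)%g.

Definition far_cocycle (x y : plane * plane) : pi1 R x0 :=
  (psi (fibp x) * psi (sgm x y) * (psi (fibp y))^-1)%g.

(** The index is unique by [near_unique]. For close points away from the missing fibres the choice
    of formula does not matter, by [near_far]. *)
Definition cocycle (x y : plane * plane) : pi1 R x0 :=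
  if [pick i | (`|a i - x.1| < e i) && (`|a i - y.1| < e i)] is Some i
  then near_cocycle i x y else far_cocycle x y.

Lemma total_total0 x : total x -> total0 x. Proof. by case. Qed.

Lemma retract_path i (f : R -> plane * plane) : path_in total0 f -> (forall t, 0 <= t <= 1 -> `|a i - (f t).1| < e i) ->
  path_in total (fun t => retract i (f t)).
Proof.
move=> [cf Tf] nf; split; first exact: (continuousT_comp cf (@retract_continuous i)).
by move=> t tI; apply: retract_total; [exact: nf|exact: Tf].
Qed.

(** Closed up by the fibre paths of its ends, the segment becomes a path with both ends at level
    [winf], to which [psi_retract_loop] applies. *)
Lemma near_far i (E : set plane) x y : convex_subset E ->
  E `<=` [set u | `|a i - u| < e i] `&` punctured a -> E x.1 -> E y.1 ->
  total x -> total y -> path_in total (sgm x y) -> near_cocycle i x y = far_cocycle x y.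
Proof.
move=> cE EB Ex Ey Tx Ty Tseg.
have [Fx fx0 fx1] := fpP (total_total0 Tx); have [Fy fy0 fy1] := fpP (total_total0 Ty).
have Px := path_in_fib Tx.1 Fx; have Py := path_in_fib Ty.1 Fy; have Pr := path_in_rev Py.
have s0 : sgm x y 0 = x by rewrite /seg scale0r addr0.
have s1 : sgm x y 1 = y by rewrite /seg scale1r addrC subrK.
have xx : fibp x 1 = sgm x y 0 by rewrite s0 /fib fx1; case: (x).
have yy : sgm x y 1 = fibp y (1 - 0) by rewrite s1 subr0 /fib fy1; case: (y).
have Tsr := path_in_concat Tseg Pr yy.
have xsr : fibp x 1 = concat_fun (sgm x y) (fun t => fibp y (1 - t)) 0 by rewrite concat_fun0.
pose Z := concat_fun (fibp x) (concat_fun (sgm x y) (fun t => fibp y (1 - t))).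
have TZ : path_in total Z by exact: path_in_concat.
have EZ t : 0 <= t <= 1 -> E (Z t).1.
  move=> tI; rewrite /Z /concat_fun; case: ifPn => th //=.
  case: ifPn => th' //=; rewrite seg_combination; apply: cE => //.
  by move: th; rewrite -ltNge; lra.
have nZ t : 0 <= t <= 1 -> `|a i - (Z t).1| < e i by move=> /EZ/EB[].
have := psi_retract_loop cE EB TZ EZ; rewrite /Z concat_fun0 !concat_fun1 subrr.
move=> /(_ fx0 fy0).
rewrite psi_concat // psi_concat // (psi_rev Py) // /far_cocycle => E1.
rewrite -mulgA E1.
have near_const z t : E z.1 -> `|a i - (fibp z t).1| < e i by move=> /EB[].
have Rx : path_in total (fun t => retract i (fibp x t)).
  apply: retract_path; last by move=> t _; exact: near_const.
  by apply: path_in_sub Px => z [].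
have Ry : path_in total (fun t => retract i (fibp y t)).
  apply: retract_path; last by move=> t _; exact: near_const.
  by apply: path_in_sub Py => z [].
have Rs : path_in total (fun t => retract i (sgm x y t)).
  apply: retract_path; first by apply: path_in_sub Tseg => z [].
  move=> t tI; have : E (sgm x y t).1 by rewrite /seg /= seg_combination; exact: cE.
  by move=> /EB[].
have rc f g : (fun t : R => retract i (concat_fun f g t)) =
    concat_fun (fun t => retract i (f t)) (fun t => retract i (g t)).
  by apply/funext => t; rewrite /concat_fun; case: ifP.
have Rr := path_in_rev Ry.
rewrite rc rc psi_concat; try (rewrite ?concat_fun0 ?xx // ?s0; fail).
- by have /= rv := psi_rev Ry; rewrite psi_concat ?yy // rv /near_cocycle mulgA.
- by apply: path_in_concat; rewrite ?yy.
Qed.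

Lemma far_cocycle_ball q d x y z : (forall x, `|q - x| < d -> total x) ->
  `|q - x| < d -> `|q - y| < d -> `|q - z| < d ->
  (far_cocycle x y * far_cocycle y z)%g = far_cocycle x z.
Proof.
move=> Td qx qy qz; rewrite /far_cocycle conj_comp; congr (_ * _ * _)%g.
have s0 u v : sgm u v 0 = u by rewrite /seg scale0r addr0.
have s1 u v : sgm u v 1 = v by rewrite /seg scale1r addrC subrK.
apply: psi_mul; rewrite ?s0 ?s1 //.
exact: (cls_seg_cocycle tauP (E := [set u | `|q - u| < d]) (@continuousT_id _) Td (@convex_ball _ _ _ _)).
Qed.

Lemma cocycle_far q : total q -> exists2 d, 0 < d & (forall x, `|q - x| < d -> total x) /\
  forall x y, `|q - x| < d -> `|q - y| < d -> cocycle x y = far_cocycle x y.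
Proof.
move=> Tq; have [d d0 hd] := total_open beta_continuous beta_bounded a_below eps_gt0 a_sep tauP Tq.
exists d => //; split => // x y qx qy; rewrite /cocycle.
case: pickP => // i /andP[ix iy].
have [qx1 qy1] : `|q.1 - x.1| < d /\ `|q.1 - y.1| < d.
  by move: qx qy; rewrite !prod_norm_lt => /andP[? _] /andP[? _].
apply: (@near_far i ([set u | `|a i - u| < e i] `&` [set u | `|q.1 - u| < d])) => //.
- by apply: convex_setI; exact: convex_ball.
- move=> u [iu qu]; split => //.
  suff [] : total (u, q.2) by [].
  by apply: hd; rewrite prod_norm_lt /= qu subrr normr0.
- exact: hd.
- exact: hd.
- exact: (seg_path (@continuousT_id _) hd (@convex_ball _ _ _ _)).
Qed.

(** In a small ball around a point over [a i] only the retracted formula occurs; away from the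
    missing fibres everything reduces to [far_cocycle]. Each formula telescopes by itself. *)
Lemma cocycle_local q : total0 q -> exists2 B, nbhs q B & forall x y z,
  total0 x -> total0 y -> total0 z -> B x -> B y -> B z ->
  (cocycle x y * cocycle y z)%g = cocycle x z.
Proof.
move=> Tq; have [[i /eqP qi]|H] := pselect (exists i, q.1 == a i).
- have [d d0 hd] := fibre_open beta_continuous Tq.
  pose d' := Num.min d (e i); have d'0 : 0 < d' by rewrite lt_min d0 e_gt0.
  exists (ball q d'); first exact: nbhsx_ballx.
  have T0 x : `|q - x| < d' -> total0 x.
    by rewrite prod_norm_lt !lt_min => /andP[/andP[? _] /andP[? _]]; exact: hd.
  have ni x : `|q - x| < d' -> `|a i - x.1| < e i.
    by rewrite prod_norm_lt !lt_min -qi => /andP[/andP[_ h] _].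
  move=> x y z _ _ _; rewrite -ball_normE /= => qx qy qz.
  have near u v : `|q - u| < d' -> `|q - v| < d' -> cocycle u v = near_cocycle i u v.
    move=> /ni iu /ni iv; rewrite /cocycle; case: pickP => [k /andP[ku _]|/(_ i)].
      by rewrite (near_unique iu ku).
    by rewrite iu iv.
  rewrite !near // /near_cocycle conj_comp; congr (_ * _ * _)%g.
  have E := cls_seg_cocycle tauP (F := retract i) (E := [set u | `|q - u| < d'])
    (@retract_continuous i) (fun x qx => retract_total (ni x qx) (T0 x qx)) (@convex_ball _ _ _ _) qx qy qz.
  exact: (psi_mul (f := seg (retract i) x y) (g := seg (retract i) y z)
    (h := seg (retract i) x z) (erefl (ui i)) (erefl (ui i)) (erefl (ui i)) E).
- have Tq' : total q by split => // i; apply/eqP => E; apply: H; exists i; exact/eqP.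
  have [d d0 [Td hd]] := cocycle_far Tq'; exists (ball q d); first exact: nbhsx_ballx.
  move=> x y z _ _ _; rewrite -ball_normE /= => qx qy qz; rewrite !hd //.
  exact: (far_cocycle_ball Td).
Qed.

(** The cocycle lives on all of [total0], so a loop null-homotopic there has holonomy [1]. Computed
    inside [total], the same holonomy is a conjugate of [psi f], which is [pr] of the class of the
    loop. *)
Lemma projection_null f : based_in x0 f ->
  path_homotopic total0 f (fun=> val x0) -> pr (pclass x0 f) = 1%g.
Proof.
move=> bf nf; have [Tf f0 f1] := bf.
have I0 : 0 <= (0 : R) <= 1 by lra.
have I1 : 0 <= (1 : R) <= 1 by lra.
have T0 : path_in total0 f by apply: path_in_sub Tf => x [].
have Tx0 : total0 (val x0) by apply: total_total0; exact: set_typeP.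
have c1 : cocycle (val x0) (val x0) = 1%g.
  have [B nB hB] := cocycle_local Tx0; have Bx := nbhs_singleton nB.
  by apply: (@mulgI _ (cocycle (val x0) (val x0))); rewrite mulg1 hB.
have hol1 : hol cocycle f = 1%g.
  rewrite (hol_homotopic cocycle_local nf T0); last exact: path_in_cst.
  rewrite (hol_cocycle (S := [set val x0])) //; last by split => //; exact: continuousT_cst.
  by move=> x y z -> -> ->; rewrite c1 mulg1.
pose om x := psi (fibp x).
pose kap t := (om (f 0%R) * psi (seg (f : R^o -> _) 0%R t) * (om (f t))^-1)%g.
have s0 s t : seg (f : R^o -> _) s t 0 = f s by rewrite /seg scale0r addr0.
have s1 s t : seg (f : R^o -> _) s t 1 = f t by rewrite /seg scale1r addrC subrK.
have dk : development cocycle f kap.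
  move=> q qI; have [d d0 [Td hd]] := cocycle_far (Tf.2 q qI).
  have [d' d'0 hd'] := cls_local tauP Tf qI d0 Td.
  exists d' => // s t sI tI qs qt; have [qfs qft E] := hd' s t sI tI qs qt.
  rewrite hd // /kap /far_cocycle conj_comp -/(om _); congr (_ * _ * _)%g.
  apply: psi_mul; rewrite ?s0 ?s1 //; first by rewrite /seg scale0r addr0.
    by rewrite /seg scale1r addrC subrK.
  by rewrite -E (cls_subpath tauP Tf).
move: hol1; rewrite (hol_development dk) /kap f0 f1.
have -> : psi (seg (f : R^o -> _) 0 0) = 1%g.
  have -> : seg (f : R^o -> _) 0 0 = fun=> f 0.
    by apply/funext => t; rewrite /seg subrr scaler0 addr0.
  by apply: psi_cst; apply: Tf.2.
rewrite mulg1 mulgV invg1 mul1g seg01 => E.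
have psi1 : psi f = 1%g by apply: (@mulgI _ (om (val x0))); apply: (@mulIg _ (om (val x0))^-1%g); rewrite E mulg1 mulgV.
rewrite -(cls_based tauP tau_base bf) -psi1 /psi f0 f1 x0E /=.
by rewrite (pot_u0 eps beta_bounded a_below tauP) mul1g invg1 mulg1.
Qed.

End Kernel.

(** * Isomorphisms of fundamental groups *)

Section Isomorphisms.

Lemma bijective_of_inj_surj (A B : Type) (f : A -> B) :
  injective f -> (forall y, exists x, f x = y) -> bijective f.
Proof.
move=> fI /choice[g gP]; exists g => // x.
by apply: fI; rewrite gP.
Qed.

Lemma group_isomorphic_of (G H : groupType) (f : G -> H) :
  {morph f : x y / (x * y)%g} -> (forall x, f x = 1%g -> x = 1%g) ->
  (forall y, exists x, f x = y) -> group_isomorphic G H.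
Proof.
move=> fM f1 fS.
pose F := HB.pack_for {multiplicative G -> H} f (isMultiplicative.Build _ _ f fM).
exists F; apply: bijective_of_inj_surj; last exact: fS.
move=> x y xy; apply/eqP; rewrite -divg_eq1; apply/eqP/f1.
have -> : f (x / y)%g = (F x * (F y)^-1)%g by rewrite -morphismV -gmulfM.
by rewrite xy mulgV.
Qed.

Lemma group_isomorphic_refl (G : groupType) : group_isomorphic G G.
Proof. by apply: (@group_isomorphic_of G G id) => // y; exists y. Qed.

Lemma group_isomorphic_trans (H G K : groupType) :
  group_isomorphic G H -> group_isomorphic H K -> group_isomorphic G K.
Proof.
move=> [f bf] [g bg]; apply: (@group_isomorphic_of G K (fun x => g (f x))).
- by move=> x y; rewrite !gmulfM.
- move=> x gfx; apply: (bij_inj bf); apply: (bij_inj bg).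
  by rewrite gfx !morphism1.
- by case: bf bg => [f' fK f'K] [g' gK g'K] y; exists (f' (g' y)); rewrite f'K g'K.
Qed.

Lemma group_isomorphic_sym (G H : groupType) : group_isomorphic G H -> group_isomorphic H G.
Proof.
move=> [f [f' fK f'K]]; apply: (@group_isomorphic_of H G f').
- exact: (can2_gmulfM fK f'K).
- by move=> x fx; rewrite -(f'K x) fx morphism1.
- by move=> y; exists (f y); rewrite fK.
Qed.

Lemma group_isomorphic_prod (G G' H H' : groupType) : group_isomorphic G G' ->
  group_isomorphic H H' -> group_isomorphic (G * H)%type (G' * H')%type.
Proof.
move=> [f bf] [h bh]; apply: (@group_isomorphic_of _ _ (fun x : G * H => (f x.1, h x.2))).
- by move=> x y /=; rewrite !gmulfM.
- move=> [x y] /= [fx hy]; have -> : x = 1%g by apply: (bij_inj bf); rewrite morphism1.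
  by have -> : y = 1%g by apply: (bij_inj bh); rewrite morphism1.
- by case: bf bh => [f' fK f'K] [h' hK h'K] [x y]; exists (f' x, h' y); rewrite /= f'K h'K.
Qed.

End Isomorphisms.

Section BasePoint.
Context {R : realType} {T : topologicalType} (X : set T).

Lemma path_homotopic_sub (Y : set T) (f g : R -> T) : X `<=` Y ->
  path_homotopic X f g -> path_homotopic Y f g.
Proof. by move=> XY [H [cH XH H0 H1 Hs]]; exists H; split => // s t sI tI; exact/XY/XH. Qed.

Definition path_connected_from (R : realType) (x : T) := forall y, X y ->
  exists f : R -> T, [/\ path_in X f, f 0 = x & f 1 = y].

Lemma choose_paths (x0 : set_type X) : path_connected_from R (val x0) ->
  exists tau : T -> R -> T, (forall x, X x ->
    [/\ path_in X (tau x), tau x 0 = val x0 & tau x 1 = x]) /\ tau (val x0) = fun=> val x0.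
Proof.
move=> pc; have /choice[t tP] : forall x, exists f : R -> T, X x ->
    [/\ path_in X f, f 0 = val x0 & f 1 = x].
  move=> x; have [/pc[f fP]|nX] := pselect (X x); first by exists f.
  by exists (fun=> x).
exists (fun x => if pselect (x = val x0) is left _ then fun=> val x0 else t x).
split; last by case: pselect.
move=> x Xx; case: pselect => [->|_]; last exact: tP.
by split => //; apply: path_in_cst; exact: set_typeP.
Qed.

Lemma path_connected_at (x y : set_type X) : path_connected_from R (val x) ->
  path_connected_from R (val y).
Proof.
move=> pc z Xz; have [f [Xf f0 f1]] := pc z Xz; have [g [Xg g0 g1]] := pc (val y) (set_typeP y).
exists (concat_fun (fun t => g (1 - t)) f); split.
- by apply: path_in_concat => //; [exact: path_in_rev|rewrite subrr g0].
- by rewrite concat_fun0 subr0.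
- by rewrite concat_fun1.
Qed.

Lemma based_change (x y : set_type X) tau : (forall z, X z ->
    [/\ path_in X (tau z), tau z 0 = val x & tau z 1 = z]) ->
  exists h : {multiplicative pi1 R y -> pi1 R x}, forall f, based_in y f ->
    h (pclass y f) = cls x tau f.
Proof.
move=> tauP; pose h (g : pi1 R y) := cls x tau (unloop (loop_repr g)).
have hE f : based_in y f -> h (pclass y f) = cls x tau f.
  move=> bf; have b := unloop_based (loop_repr (pclass y f)).
  apply: (cls_homotopic tauP); [by case: b|by case: bf|].
  by apply: (path_homotopic_pclass (x0 := y)) => //; exact: pclass_repr.
have hM : {morph h : g g' / (g * g')%g}.
  move=> g g'; have [f bf <-] := pclass_surj g; have [f' bf' <-] := pclass_surj g'.
  rewrite -pclass_concat // !hE //; last exact: based_concat.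
  case: bf bf' => [Xf f0 f1] [Xf' f'0 f'1]; apply: (cls_concat tauP) => //.
  by rewrite f1.
by exists (HB.pack_for {multiplicative pi1 R y -> pi1 R x} h (isMultiplicative.Build _ _ h hM)).
Qed.

(** Each composite of the two change-of-base morphisms is an inner automorphism. *)
Lemma pi1_base_point (x y : set_type X) : path_connected_from R (val x) ->
  group_isomorphic (pi1 R x) (pi1 R y).
Proof.
move=> pcx; have pcy := path_connected_at y pcx.
have key (u v : set_type X) tau tau' (f : {multiplicative pi1 R u -> pi1 R v})
    (g : {multiplicative pi1 R v -> pi1 R u}) :
    (forall z, X z -> [/\ path_in X (tau z), tau z 0 = val v & tau z 1 = z]) ->
    (forall z, X z -> [/\ path_in X (tau' z), tau' z 0 = val u & tau' z 1 = z]) ->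
    tau' (val u) = (fun=> val u) ->
    (forall l, based_in u l -> f (pclass u l) = cls v tau l) ->
    (forall l, based_in v l -> g (pclass v l) = cls u tau' l) ->
    exists c, forall z, g (f z) = (c * z * c^-1)%g.
  move=> tP tP' tb' fE gE; exists (cls u tau' (tau (val u))) => z.
  have [l bl <-] := pclass_surj z; have [Xl l0 l1] := bl.
  have [Xt t0 t1] := tP _ (set_typeP u); have Xr := path_in_rev Xt.
  rewrite fE // gE; last exact: (based_close tP).
  rewrite -(cls_based tP' tb' bl) /close l0 l1 -(cls_rev tP') //.
  rewrite (cls_concat tP') ?(cls_concat tP') ?concat_fun1 ?subr0 ?l1 ?l0 ?t1 //.
  by apply: path_in_concat; rewrite ?t1 ?l0.
have [tx [txP txb]] := choose_paths pcx; have [ty [tyP tyb]] := choose_paths pcy.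
have [f fE] := based_change x tyP.
have [g gE] := based_change y txP.
have [c cE] := key _ _ _ _ f g tyP txP txb fE gE.
have [d dE] := key _ _ _ _ g f txP tyP tyb gE fE.
apply: (@group_isomorphic_of _ _ f); first exact: gmulfM.
- move=> z fz; have := cE z; rewrite fz morphism1 => E.
  by apply: (@mulgI _ c); apply: (@mulIg _ c^-1%g); rewrite -E mulg1 mulgV.
- by move=> z; exists (g (d^-1 * z * d)%g); rewrite dE !mulgA mulgV mul1g mulgK.
Qed.

Lemma pi1_inclusion (Y : set T) (x : set_type X) (y : set_type Y) : X `<=` Y ->
  val x = val y -> exists h : {multiplicative pi1 R x -> pi1 R y},
    forall f, based_in x f -> h (pclass x f) = pclass y f.
Proof.
move=> XY xy; pose h (g : pi1 R x) := pclass y (unloop (loop_repr g)).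
have bY f : based_in x f -> based_in y f.
  by move=> [Xf f0 f1]; split; rewrite -?xy //; exact: path_in_sub Xf.
have hE f : based_in x f -> h (pclass x f) = pclass y f.
  move=> bf; have b := unloop_based (loop_repr (pclass x f)).
  apply: pclass_homotopic; [exact: bY|exact: bY|].
  apply: (path_homotopic_sub XY).
  by apply: (path_homotopic_pclass (x0 := x)) => //; exact: pclass_repr.
have hM : {morph h : g g' / (g * g')%g}.
  move=> g g'; have [f bf <-] := pclass_surj g; have [f' bf' <-] := pclass_surj g'.
  rewrite -pclass_concat // !hE //; last exact: based_concat.
  by rewrite pclass_concat //; exact: bY.
by exists (HB.pack_for {multiplicative pi1 R x -> pi1 R y} h (isMultiplicative.Build _ _ h hM)).
Qed.

End BasePoint.

Section Homeomorphism.
Context {R : realType}.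

Lemma pi1_map_morphism (T T' : topologicalType) (x : T) (F : T -> T') : continuous F ->
  exists h : {multiplicative pi1 R x -> pi1 R (F x)},
    forall (l : loop R x) (l' : loop R (F x)), (forall t, 0 <= t <= 1 -> l' t = F (l t)) ->
      h (loop_class l) = loop_class l'.
Proof.
move=> cF.
have lc (l : loop R x) : {within `[0, 1], continuous (fun t => F (l t))}.
  apply: (within_continuous_comp2 (B := setT) (@loop_continuous _ _ _ l)) => //.
  exact: continuous_subspaceT.
pose Fl (l : loop R x) : loop R (F x) :=
  Loop (lc l) (congr1 F (loop0 l)) (congr1 F (loop1 l)).
have Fh l l' : homotopic l l' -> homotopic (Fl l) (Fl l').
  move=> [H [cH H0 H1 Hs]]; exists (fun st => F (H st)); split.
  - apply: (within_continuous_comp2 (B := setT) cH) => //.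
    exact: continuous_subspaceT.
  - by move=> t tI /=; rewrite H0.
  - by move=> t tI /=; rewrite H1.
  - by move=> s sI; have [-> ->] := Hs s sI.
have heq (l l' : loop R (F x)) : (forall t, 0 <= t <= 1 -> l' t = l t) -> homotopic l' l.
  move=> ll'; apply: (@loop_reparam R _ _ l id id) => //; try exact: loop_continuous.
  - by move=> t; exact: cvg_id.
  - by move=> t; exact: cvg_id.
pose h (g : pi1 R x) := loop_class (Fl (loop_repr g)).
have hE (l : loop R x) (l' : loop R (F x)) : (forall t, 0 <= t <= 1 -> l' t = F (l t)) -> h (loop_class l) = loop_class l'.
  move=> E; apply/loop_classP; apply: (@homotopic_trans R T' (F x) (Fl l)).
    by apply: Fh; exact: loop_repr_class.
  by apply: homotopic_sym; exact: heq.
have hM : {morph h : g g' / (g * g')%g}.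
  move=> g g'; rewrite -(loop_reprK g) -(loop_reprK g').
  rewrite -[(loop_class _ * loop_class _)%g]loop_class_concat.
  rewrite (hE _ (Fl (loop_concat (loop_repr g) (loop_repr g')))) //.
  rewrite (hE _ (Fl (loop_repr g))) // (hE _ (Fl (loop_repr g'))) //.
  rewrite -[RHS]loop_class_concat; apply/loop_classP; apply: heq => t tI /=.
  by rewrite /concat_fun /=; case: ifP.
by exists (HB.pack_for {multiplicative pi1 R x -> pi1 R (F x)} h (isMultiplicative.Build _ _ h hM)).
Qed.

Lemma pi1_homeomorphic (T T' : topologicalType) (x : T) (F : T -> T') (F' : T' -> T) :
  continuous F -> continuous F' -> cancel F F' -> cancel F' F ->
  group_isomorphic (pi1 R x) (pi1 R (F x)).
Proof.
move=> cF cF' FK F'K.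
have [h hE] := pi1_map_morphism x cF.
have [h' h'E] := pi1_map_morphism (F x) cF'.
apply: (@group_isomorphic_of _ _ h); first exact: gmulfM.
- move=> g hg; have [l lE] : exists l, loop_class l = g by exists (loop_repr g); exact: loop_reprK.
  have lc : {within `[0, 1], continuous (fun t => F (l t))}.
    apply: (within_continuous_comp2 (B := setT) (@loop_continuous _ _ _ l)) => //.
    exact: continuous_subspaceT.
  pose l1 := Loop lc (congr1 F (loop0 l)) (congr1 F (loop1 l)).
  have E1 : loop_class l1 = loop_class (loop_cst R (F x)) by rewrite -(hE l l1) // lE hg.
  have [H [cH H0 H1 Hs]] := (loop_classP _ _).1 E1.
  rewrite -lE; apply/loop_classP; exists (fun st => F' (H st)); split.
  - apply: (within_continuous_comp2 (B := setT) cH) => //.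
    exact: continuous_subspaceT.
  - by move=> t tI; rewrite H0 //= FK.
  - by move=> t tI; rewrite H1 //= FK.
  - by move=> s sI; have [-> ->] := Hs s sI; rewrite FK.
- move=> g; have [l lE] : exists l, loop_class l = g by exists (loop_repr g); exact: loop_reprK.
  have lc : {within `[0, 1], continuous (fun t => F' (l t))}.
    apply: (within_continuous_comp2 (B := setT) (@loop_continuous _ _ _ l)) => //.
    exact: continuous_subspaceT.
  have l0 : F' (l 0) = x by rewrite loop0 FK.
  have l1 : F' (l 1) = x by rewrite loop1 FK.
  exists (loop_class (Loop lc l0 l1)); rewrite -lE; apply: hE => t tI /=.
  by rewrite F'K.
Qed.

End Homeomorphism.

Lemma free_image_trivial (r : nat) (G : groupType) (f : {multiplicative free_group r -> G}) :
  (forall i, f (fg_gen i) = 1%g) -> forall w, f w = 1%g.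
Proof.
move=> f1 [w rw]; elim: w rw => [|b w IH] rw.
  by have -> : FreeGroup rw = 1%g by [exact: val_inj]; rewrite morphism1.
have rw' : reduced w by exact: path_sorted rw.
by rewrite (fg_cons rw rw') gmulfM IH mulg1; case: b.2; rewrite ?morphismV f1 ?invg1.
Qed.

(** * Splitting off the free group of the punctures *)

Section Step.
Context {R : realType}.
Local Notation plane := (R * R)%type.
Variables (J : finType) (beta : J -> plane -> plane) (D : seq plane).
Hypothesis beta_continuous : forall j, continuous (beta j).
Hypothesis beta_bounded : forall j u, `|beta j u| <= 1.
Hypothesis betaD : forall u, u \notin D -> injective (beta ^~ u).

Lemma total_path_connected (r : nat) (a : 'I_r -> plane) (b : plane) : punctured a b ->
  path_connected_from (total_space beta a) R (sigma b).
Proof.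
move=> pb [u w] [/= pu Fw].
pose Z := [seq a i | i <- enum 'I_r].
have ZE v : punctured a v <-> v \notin Z.
  split=> [pv|vZ i]; first by apply/mapP => -[i _ E]; have := pv i; rewrite E eqxx.
  by apply: contra vZ => /eqP ->; apply: map_f; rewrite mem_enum.
have [p [[cp Pp] p0 p1]] := plane_minus_finite ((ZE _).1 pb) ((ZE _).1 pu).
have [f [Ff f0 f1]] := fibre_connected beta_bounded Fw.
exists (concat_fun (fun t => sigma (p t)) (fib u f)); split.
- apply: path_in_concat.
  + by apply: (path_in_sigma beta_bounded); split => // t /Pp/ZE.
  + exact: path_in_fib.
  + by rewrite p1 /fib f0.
- by rewrite concat_fun0 p0.
- by rewrite concat_fun1 /fib f1.
Qed.

(** The crossing morphism and the inclusion identify the fundamental group of the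
    total space over the punctured plane with a direct product. *)
Lemma pi1_total_space (r : nat) (a : 'I_r -> plane) (a0 : 'I_0 -> plane)
    (x : set_type (total_space beta a)) (y : set_type (total_space beta a0)) :
  injective (fun i => (a i).1) -> (forall d, d \in D -> forall i, d.1 != (a i).1) ->
  group_isomorphic (pi1 R x) (free_group r * pi1 R y)%type.
Proof.
move=> a_inj Dx.
have [Y0 hY0] := seq_upper_bound ([seq (a i).2 + 1 | i <- enum 'I_r] ++ [seq d.2 | d <- D]).
have a_below i : (a i).2 + 1 < Y0.
  by apply: hY0; rewrite mem_cat; apply/orP; left; apply/mapP; exists i; rewrite ?mem_enum.
have Dtop d : d \in D -> d.2 < Y0.
  by move=> dD; apply: hY0; rewrite mem_cat; apply/orP; right; apply/mapP; exists d.
have aD i : a i \notin D by apply/negP => /Dx/(_ i); rewrite eqxx.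
have [m m0 hm] : exists2 m, 0 < m & forall ij : 'I_r * 'I_r,
    m <= if ij.1 == ij.2 then 1 else `|(a ij.1).1 - (a ij.2).1|.
  apply: fin_pos_lower_bound => -[i j] /=; case: eqVneq => // ij.
  by rewrite normr_gt0 subr_eq0; apply: contra ij => /eqP/a_inj ->.
pose eps := m / 2; have eps_gt0 : 0 < eps by rewrite /eps; lra.
have a_sep i j : i != j -> 2 * eps <= `|(a i).1 - (a j).1|.
  by move=> ij; have := hm (i, j); rewrite /= (negPf ij) /eps; lra.
have /choice[er erP] : forall i, exists er : R * R,
    nearly_constant beta (a i) er.1 er.2 /\ er.1 <= eps.
  move=> i; have [e [rho nc]] := nearly_constant_exists beta_continuous (betaD (aD i)).
  have e0 : 0 < e by case: nc.
  exists (Num.min e eps, rho) => /=; split; last by rewrite ge_min lexx orbT.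
  by apply: (nearly_constant_le nc); rewrite lt_min e0 eps_gt0 ge_min lexx.
have pu0 : punctured a (u0 Y0) by exact: punctured_u0 a_below.
have Tu0 : total_space beta a (sigma (u0 Y0)) by exact: sigma_total.
pose x0 : set_type (total_space beta a) := SigSub (mem_set Tu0).
have x0E : val x0 = sigma (u0 Y0) by [].
have pu0' : punctured a0 (u0 Y0) by case.
have Tu0' : total_space beta a0 (sigma (u0 Y0)) by exact: sigma_total.
pose y0 : set_type (total_space beta a0) := SigSub (mem_set Tu0').
have y0E : val y0 = sigma (u0 Y0) by [].
have pcx := total_path_connected pu0; have pcy := total_path_connected pu0'.
apply: (@group_isomorphic_trans (pi1 R x0)).
  by apply: group_isomorphic_sym; apply: pi1_base_point.
apply: (@group_isomorphic_trans (free_group r * pi1 R y0)%type); last first.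
  by apply: group_isomorphic_prod; [exact: group_isomorphic_refl|exact: pi1_base_point].
have [tau [tauP tau_base]] := choose_paths (x0 := x0) pcx.
have [tau' [tauP' tau_base']] := choose_paths (x0 := y0) pcy.
have [h [ha hf]] := crossing_morphism beta_bounded a_below eps_gt0 a_sep x0E tauP tau_base.
have [l la] := free_lift (around Y0 eps x0 tau).
have [pr [prE pra]] := fibre_projection beta_continuous beta_bounded betaD a_below eps_gt0 a_sep
  Dtop Dx aD x0E tauP tau_base ha hf la.
have [fp fpP] : exists fp : plane * plane -> R -> plane, forall x, total0 beta x ->
    [/\ path_in (fibre beta x.1) (fp x), fp x 0 = winf & fp x 1 = x.2].
  have /choice[fp fpP] : forall x : plane * plane, exists f : R -> plane, total0 beta x ->
    [/\ path_in (fibre beta x.1) f, f 0 = winf & f 1 = x.2].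
    move=> z; have [/(fibre_connected beta_bounded)[f fP]|nF] := pselect (total0 beta z); first by exists f.
    by exists (fun=> winf).
  by exists fp.
have kernel := projection_null beta_continuous beta_bounded a_below eps_gt0 a_sep x0E tauP tau_base
  pra (fun i => (erP i).1) (fun i => (erP i).2) fpP.
have sub : total_space beta a `<=` total_space beta a0 by move=> z [_ Fz]; split => // -[].
have [inc incE] := pi1_inclusion (R := R) (x := x0) (y := y0) sub (etrans x0E (esym y0E)).
(* Once the punctures are filled, the classes of segments at level [winf] multiply without
   restriction, so the rectangle becomes trivial. *)
have inc_around i : inc (around Y0 eps x0 tau i) = 1%g.
  pose s' p q := cls y0 tau' (seg (@sigma R) p q).
  have s'_tri p q s : (s' p q * s' q s)%g = s' p s.
    apply: (cls_seg_cocycle tauP' (@sigma_continuous R) (E := setT)) => //.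
    by move=> u _; apply: sigma_total => // -[].
  pose t' u := cls y0 tau' (tau (sigma u)).
  have incs p q (E : set plane) : convex_subset E -> E `<=` punctured a -> E p -> E q ->
      inc (sg x0 tau p q) = (t' p * s' p q * (t' q)^-1)%g.
    move=> cE EP Ep Eq.
    have Ts : path_in (total_space beta a) (seg (@sigma R) p q).
      apply: (seg_path (@sigma_continuous R) (E := E)) => // u Eu.
      by apply: sigma_total => //; exact: EP.
    have bc := based_close tauP Ts.
    rewrite incE // -(cls_based tauP' tau_base'); last first.
      by case: bc => Tc c0 c1; split; rewrite ?c0 ?c1 //; exact: path_in_sub Tc.
    have q0 : seg (@sigma R) p q 0 = sigma p by rewrite /seg scale0r addr0.
    have q1 : seg (@sigma R) p q 1 = sigma q by rewrite /seg scale1r addrC subrK.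
    rewrite /close q0 q1.
    have [tp tp0 tp1] := tauP _ (sigma_total beta_bounded (EP _ Ep)).
    have [tq tq0 tq1] := tauP _ (sigma_total beta_bounded (EP _ Eq)).
    have tp' := path_in_sub sub tp; have tq' := path_in_sub sub tq; have Ts' := path_in_sub sub Ts.
    have tr' := path_in_rev tq'.
    rewrite (cls_concat tauP') ?(cls_concat tauP') ?concat_fun1 ?subr0 ?tp1 ?tq1 ?q0 ?q1 //.
      by rewrite (cls_rev tauP').
    by apply: path_in_concat; rewrite ?tp1 ?q0.
  have incd z s c d : (forall k, free_strip a c d k) -> c < z < d ->
      inc (down Y0 x0 tau z s) = (t' (u0 Y0) * s' (u0 Y0) (z, s) * (t' (z, s))^-1)%g.
    move=> fs /andP[cz zd].
    pose k := Num.min (Y0 - 1) (s - 1).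
    have k1 : k <= Y0 - 1 by rewrite ge_min lexx.
    have k2 : k <= s - 1 by rewrite ge_min lexx orbT.
    rewrite /down gmulfM (incs _ _ _ (@convex_above_all _ _ a) (@above_all_punctured _ _ a)); last 2 first.
    - exact: (above_all_Y a_below).
    - exact: (above_all_Y a_below).
    rewrite (incs _ _ _ (@convex_strip _ c d k) (free_strip_punctured (fs k))); last 2 first.
    - by split; [split|] => //=; lra.
    - by split; [split|] => //=; lra.
    by rewrite conj_comp s'_tri.
  have incb := incs (left_of a eps i) (right_of a eps i) _ (@convex_box _ _ _ _) (box_punctured a_sep (i := i)).
  rewrite aroundE 2!gmulfM morphismV /lam_left /lam_right incb; last 2 first.
  - by split; [split|] => /=; lra.
  - by split; [split|] => /=; lra.
  rewrite (@incd (left_of a eps i).1 _ _ _ (free_left eps_gt0 a_sep (i := i))); last by rewrite /left_of /=; lra.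
  rewrite (@incd (right_of a eps i).1 _ _ _ (free_right eps_gt0 a_sep (i := i))); last by rewrite /right_of /=; lra.
  by rewrite conj_comp s'_tri mulgV.
have inc_l w : inc (l w) = 1%g.
  apply: (free_image_trivial (f := (inc \o l : {multiplicative _ -> _}))) => i /=.
  by rewrite la inc_around.
have hl w : h (l w) = w.
  by apply: (free_hom_eq (f := (h \o l : {multiplicative _ -> _})) (f' := idfun)) => i /=; rewrite la ha.
apply: (@group_isomorphic_of _ _ (fun g => (h g, inc g) : (free_group r * pi1 R y0)%type)).
- by move=> g g'; rewrite !gmulfM.
(* Trivial kernel: [h g = 1] gives [pr g = g], and [pr] kills a loop that is trivial in the larger
   space. *)
- move=> g [hg ig]; have pg : pr g = g by rewrite prE hg morphism1 invg1 mul1g.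
  rewrite -pg; have [f bf fE] := pclass_surj g; rewrite -fE; apply: kernel => //.
  have bf' : based_in y0 f by case: bf => Tf f0 f1; split; rewrite ?f0 ?f1 //; exact: path_in_sub Tf.
  have bc : based_in y0 (fun _ : R => val x0) by split => //; exact: path_in_cst.
  apply: (path_homotopic_sub (X := total_space beta a0)); first by move=> z [].
  apply: (path_homotopic_pclass (x0 := y0)) => //.
  rewrite -incE // fE ig -(cls_based tauP' tau_base' bc).
  by rewrite (cls_cst tauP').
(* Surjectivity: over the plane without punctures, the index set of [a0] being empty, only fibre
   loops remain as generators, and they lift to the kernel of [h]. *)
- move=> [w e'].
  have [g [hg ig]] : exists g, h g = 1%g /\ inc g = e'.
    have a_below0 (i : 'I_0) : (a0 i).2 + 1 < Y0 by case: i.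
    have a_sep0 (i j : 'I_0) : i != j -> 2 * eps <= `|(a0 i).1 - (a0 j).1| by case: i.
    apply: (generation beta_continuous beta_bounded betaD a_below0 eps_gt0 a_sep0 Dtop y0E
      tauP' tau_base' e' (P := fun e' => exists g, h g = 1%g /\ inc g = e')).
    + by exists 1%g; rewrite !morphism1.
    + by move=> e1 e2 [g1 [h1 i1]] [g2 [h2 i2]]; exists (g1 * g2)%g; rewrite !gmulfM h1 h2 i1 i2 mulg1.
    + by move=> e1 [g1 [h1 i1]]; exists (g1^-1)%g; rewrite !morphismV h1 i1 invg1.
    + move=> _ [[[]//]|[phi Lphi ->]]; exists (cls x0 tau (fib (u0 Y0) phi)).
      have [Fphi phi0 phi1] := Lphi.
      have bf : based_in x0 (fib (u0 Y0) phi).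
        by split; [exact: path_in_fib|rewrite /fib phi0|rewrite /fib phi1].
      rewrite hf //; split => //; rewrite (cls_based tauP tau_base bf) incE //.
      rewrite (cls_based tauP' tau_base') //.
      by case: bf => Tf f0 f1; split; rewrite ?f0 ?f1 //; exact: path_in_sub Tf.
  by exists (l w * g)%g; rewrite !gmulfM hl hg inc_l ig mulg1 mul1g.
Qed.

End Step.

(** * Homeomorphic subsets and complex coordinates *)

Section HomeomorphicSets.
Context {R : realType}.

Lemma set_map_continuous (T T' : topologicalType) (X : set T) (X' : set T') (f : T -> T')
    (XX' : forall z, X z -> X' (f z)) : (forall z, X z -> {for z, continuous f}) ->
  continuous (fun x : set_type X => SigSub (mem_set (XX' _ (set_typeP x))) : set_type X').
Proof.
move=> cf x U [? [[W oW <-] /= Wt WU]].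
have : nbhs x ((fun z : set_type X => f (val z)) @^-1` W).
  have cv : {for x, continuous (fun z : set_type X => f (val z))}.
    apply: continuous_comp; first exact: val_continuous.
    by apply: cf; exact: set_typeP.
  by apply: cv; apply: open_nbhs_nbhs.
by rewrite nbhs_filterE /=; apply: filterS => z Wz; apply: WU.
Qed.

Lemma pi1_homeomorphic_sets (T T' : topologicalType) (X : set T) (X' : set T')
    (f : T -> T') (g : T' -> T) (x : set_type X) :
  (forall z, X z -> X' (f z)) -> (forall z, X' z -> X (g z)) ->
  (forall z, X z -> g (f z) = z) -> (forall z, X' z -> f (g z) = z) ->
  (forall z, X z -> {for z, continuous f}) -> (forall z, X' z -> {for z, continuous g}) ->
  exists x' : set_type X', group_isomorphic (pi1 R x) (pi1 R x').
Proof.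
move=> XX' X'X fK gK cf cg.
pose F (x : set_type X) : set_type X' := SigSub (mem_set (XX' _ (set_typeP x))).
pose F' (x : set_type X') : set_type X := SigSub (mem_set (X'X _ (set_typeP x))).
exists (F x); apply: (@pi1_homeomorphic R _ _ x F F').
- exact: set_map_continuous.
- exact: set_map_continuous.
- by move=> z; apply: val_inj; rewrite /= fK //; exact: set_typeP.
- by move=> z; apply: val_inj; rewrite /= gK //; exact: set_typeP.
Qed.

End HomeomorphicSets.

Section ComplexPlane.
Local Open Scope complex_scope.
Context {R : realType}.
Local Notation C := (R[i]^o).
Local Notation plane := (R * R)%type.

Lemma Re_continuous : continuous (@complex.Re R : C -> R).
Proof.
move=> z U /nbhs_ballP[e /= e0 eU].
have e0' : 0 < e%:C :> R[i] by rewrite ltcR.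
apply/nbhs_ballP; exists (e%:C : R[i]) => //= w; rewrite -ball_normE /= => zw.
apply: eU; rewrite -ball_normE /= -ltcR.
by apply: le_lt_trans zw; have := normc_ge_Re (z - w); case: (z) (w) => ? ? [].
Qed.

Lemma Im_continuous : continuous (@complex.Im R : C -> R).
Proof.
have -> : (@complex.Im R : C -> R) = fun z : C => - complex.Re (z * ('i : C)).
  by apply/funext => z; rewrite ReiNIm opprK.
apply: continuousT_opp; apply: (continuousT_comp (g := @complex.Re R : C -> R) _ Re_continuous).
by apply: continuousT_mul; [exact: continuousT_id|exact: continuousT_cst].
Qed.

Lemma real_complex_continuous : continuous (fun x : R => x%:C : C).
Proof.
move=> x U /nbhs_ballP[e /= e0 eU].
have e_re : e = (complex.Re e)%:C.
  by move: e0; rewrite ltcE /= => /andP[/eqP h _]; case: (e) h => ? ? /= ->.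
have e0' : 0 < complex.Re e by move: e0; rewrite e_re ltcR.
apply/nbhs_ballP; exists (complex.Re e) => //= y; rewrite -ball_normE /= => xy.
apply: eU; rewrite -ball_normE /= e_re.
have -> : x%:C - y%:C = (x - y)%:C :> R[i] by rewrite rmorphB.
by rewrite normc_def /= expr0n /= addr0 sqrtr_sqr ltcR.
Qed.

Definition to_plane (z : C) : plane := (complex.Re z, complex.Im z).

Definition of_plane (p : plane) : C := p.1%:C + 'i%C * p.2%:C.

Lemma to_plane_continuous : continuous to_plane.
Proof. by apply: pair_continuous; [exact: Re_continuous|exact: Im_continuous]. Qed.

Lemma of_plane_continuous : continuous of_plane.
Proof.
apply: continuousT_add.
  by apply: (continuousT_comp _ real_complex_continuous); continuity.
apply: continuousT_mul; first exact: continuousT_cst.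
by apply: (continuousT_comp _ real_complex_continuous); continuity.
Qed.

Lemma to_planeK : cancel to_plane of_plane.
Proof. by move=> z; rewrite /of_plane [RHS]complexE. Qed.

Lemma of_planeK : cancel of_plane to_plane.
Proof.
move=> [x y]; rewrite /of_plane /to_plane /=.
by rewrite !(mul0r, mul1r, mulr0, subr0, add0r, addr0, oppr0).
Qed.

Definition graph_complement (J : finType) (beta : J -> C -> C) (r : nat) (a : 'I_r -> C)
  : set (C * C) := [set z | (forall i, z.1 != a i) /\ forall j, z.2 != beta j z.1].

Section Coordinates.
Variables (J : finType) (beta : J -> C -> C) (kap : R).
Hypothesis beta_continuous : forall j, continuous (beta j).

(** Half-lines and abscissae belong to the underlying real plane, so a real-linear change of the
    base is enough to separate abscissae. *)
Definition shear (p : plane) : plane := (p.1 + kap * p.2, p.2).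
Definition unshear (p : plane) : plane := (p.1 - kap * p.2, p.2).

Lemma shearK : cancel shear unshear.
Proof. by move=> [x y]; rewrite /shear /unshear /= addrK. Qed.
Lemma unshearK : cancel unshear shear.
Proof. by move=> [x y]; rewrite /shear /unshear /= subrK. Qed.

Definition base (p : plane) : C := of_plane (unshear p).
Definition unbase (z : C) : plane := shear (to_plane z).

Lemma baseK : cancel base unbase.
Proof. by move=> p; rewrite /base /unbase of_planeK unshearK. Qed.
Lemma unbaseK : cancel unbase base.
Proof. by move=> p; rewrite /base /unbase shearK to_planeK. Qed.

Lemma base_continuous : continuous base.
Proof.
by apply: (continuousT_comp _ of_plane_continuous); rewrite /unshear; continuity; exact: continuousT_cst.
Qed.

Lemma unbase_continuous : continuous unbase.
Proof.
by apply: (continuousT_comp to_plane_continuous); rewrite /shear; continuity; exact: continuousT_cst.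
Qed.

(** Dividing by [bound] makes the graphs bounded. *)
Definition bound (p : plane) : R := 1 + \sum_j `|to_plane (beta j (base p))|.

Lemma bound_gt0 p : 0 < bound p.
Proof. by rewrite ltr_pwDl // sumr_ge0. Qed.

Lemma bound_continuous : continuous bound.
Proof.
rewrite /bound; apply: continuousT_add; first exact: continuousT_cst.
elim: (index_enum J) => [|j s IH].
  by under eq_fun do rewrite big_nil; exact: continuousT_cst.
under eq_fun do rewrite big_cons.
apply: continuousT_add => //; apply: continuousT_norm.
apply: (continuousT_comp _ to_plane_continuous).
exact: (continuousT_comp base_continuous).
Qed.

Definition real_beta j (p : plane) : plane := (bound p)^-1 *: to_plane (beta j (base p)).

Lemma bound_inv_continuous : continuous (fun p => (bound p)^-1).
Proof. by move=> p; apply: cvgV; [rewrite gt_eqF // bound_gt0|exact: bound_continuous]. Qed.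

Lemma real_beta_continuous j : continuous (real_beta j).
Proof.
apply: continuousT_scale; first exact: bound_inv_continuous.
apply: (continuousT_comp _ to_plane_continuous).
exact: (continuousT_comp base_continuous).
Qed.

Lemma real_beta_bounded j p : `|real_beta j p| <= 1.
Proof.
rewrite normrZ gtr0_norm ?invr_gt0 ?bound_gt0 // mulrC ler_pdivrMr ?bound_gt0 // mul1r.
by rewrite /bound (bigD1 j) //= addrCA lerDl addr_ge0 // sumr_ge0.
Qed.

Lemma pi1_graph_coordinates (r : nat) (a : 'I_r -> C) (x : set_type (graph_complement beta a)) :
  exists x' : set_type (total_space real_beta (fun i => unbase (a i))),
    group_isomorphic (pi1 R x) (pi1 R x').
Proof.
pose f (z : C * C) : plane * plane := (unbase z.1, (bound (unbase z.1))^-1 *: to_plane z.2).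
pose g (q : plane * plane) : C * C := (base q.1, of_plane (bound q.1 *: q.2)).
have b0 p : bound p != 0 by rewrite gt_eqF // bound_gt0.
have fK z : g (f z) = z.
  by rewrite /f /g /= unbaseK scalerA mulfV // scale1r to_planeK; case: z.
have gK q : f (g q) = q.
  by rewrite /f /g /= baseK of_planeK scalerA mulVf // scale1r; case: q.
apply: (pi1_homeomorphic_sets (f := f) (g := g)) => [[u w]|[p q]|z|q|z|q] /=.
- move=> [/= ua wb]; split => /= [i|j].
    by rewrite (inj_eq (can_inj unbaseK)).
  apply: contra (wb j) => /eqP E; apply/eqP.
  have := scalerI (invr_neq0 (b0 (unbase u))) E; rewrite unbaseK => /(can_inj to_planeK) //.
- move=> [/= pa qb]; split => /= [i|j].
    by apply: contra (pa i) => /eqP <-; rewrite baseK.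
  apply: contra (qb j) => /eqP E; rewrite /real_beta -E of_planeK scalerA mulVf //.
  by rewrite scale1r.
- by move=> _; exact: fK.
- by move=> _; exact: gK.
- move=> _; have : continuous f; last exact.
  apply: pair_continuous.
    by apply: (continuousT_comp _ unbase_continuous); continuity.
  apply: continuousT_scale.
    apply: (continuousT_comp _ bound_inv_continuous).
    by apply: (continuousT_comp _ unbase_continuous); continuity.
  by apply: (continuousT_comp _ to_plane_continuous); continuity.
- move=> _; have : continuous g; last exact.
  apply: pair_continuous.
    by apply: (continuousT_comp _ base_continuous); continuity.
  apply: (continuousT_comp _ of_plane_continuous).
  apply: continuousT_scale; last by continuity.
  by apply: (continuousT_comp _ bound_continuous); continuity.
Qed.

End Coordinates.

Lemma shear_exists (Z : seq plane) : exists kap, forall p q, p \in Z -> q \in Z ->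
  (shear kap p).1 = (shear kap q).1 -> p = q.
Proof.
(* The values of [kap] for which two points of different heights would be sheared onto one vertical
   line. *)
pose bad := [seq - (pq.1.1 - pq.2.1) / (pq.1.2 - pq.2.2) | pq <- [seq (p, q) | p <- Z, q <- Z]].
have [kap _ kb] := pos_notin bad ltr01.
exists kap => -[x y] [x' y'] pZ qZ /= E.
have [yy|yy] := eqVneq y y'.
  by move: E; rewrite yy => /addIr ->.
exfalso; move/negP: kb; apply; apply/mapP; exists ((x, y), (x', y')).
  by apply/allpairsP; exists ((x, y), (x', y')).
rewrite /=; have h : y - y' != 0 by rewrite subr_eq0.
have h2 : kap * (y - y') = - (x - x') by move: E; lra.
by rewrite -h2 mulfK.
Qed.

Lemma pi1_graph_complement (J : finType) (beta : J -> C -> C) (D : seq C) (r : nat)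
    (a : 'I_r -> C) (a0 : 'I_0 -> C)
    (x : set_type (graph_complement beta a)) (y : set_type (graph_complement beta a0)) :
  (forall j, continuous (beta j)) -> (forall u, u \notin D -> injective (beta ^~ u)) ->
  injective a -> (forall i, injective (beta ^~ (a i))) ->
  group_isomorphic (pi1 R x) (free_group r * pi1 R y)%type.
Proof.
move=> cb bD0 a_inj ainj.
pose D' := [seq u <- D | ~~ injectiveb (beta ^~ u)].
have bD u : u \notin D' -> injective (beta ^~ u).
  by rewrite mem_filter negb_and negbK => /orP[/injectiveP//|/bD0].
have aD i : a i \notin D'.
  by rewrite mem_filter negb_and negbK; apply/orP; left; exact/injectiveP.
have [kap hk] := shear_exists (map to_plane (D' ++ [seq a i | i <- enum 'I_r])).
have inZ i : to_plane (a i) \in map to_plane (D' ++ [seq a i | i <- enum 'I_r]).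
  apply: map_f; rewrite mem_cat; apply/orP; right; apply/mapP.
  by exists i; rewrite ?mem_enum.
have [x' xx'] := pi1_graph_coordinates kap cb x.
have [y' yy'] := pi1_graph_coordinates kap cb y.
apply: (group_isomorphic_trans xx').
apply: (@group_isomorphic_trans (free_group r * pi1 R y')%type); last first.
  by apply: group_isomorphic_prod; [exact: group_isomorphic_refl|exact: group_isomorphic_sym].
apply: (pi1_total_space (D := map (unbase kap) D')).
- exact: real_beta_continuous.
- exact: real_beta_bounded.
- move=> u uD' j k /(scalerI (invr_neq0 (lt0r_neq0 (bound_gt0 beta kap u)))).
  move=> /(can_inj to_planeK); apply: bD; apply: contra uD' => uD'.
  by apply/mapP; exists (base kap u) => //; rewrite baseK.
- by move=> i j /(hk _ _ (inZ i) (inZ j))/(can_inj to_planeK)/a_inj.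
- move=> _ /mapP[d dD' ->] i; apply/eqP => E.
  have : to_plane d = to_plane (a i).
    by apply: hk => //; apply: map_f; rewrite mem_cat dD'.
  by move=> /(can_inj to_planeK) da; move: (aD i); rewrite -da dD'.
Qed.

End ComplexPlane.

Lemma pair_continuous_at (X Y Z : topologicalType) (f : X -> Y) (g : X -> Z) (x : X) :
  {for x, continuous f} -> {for x, continuous g} -> {for x, continuous (fun x => (f x, g x))}.
Proof. by move=> cf cg; exact: (@cvg_pair _ _ _ (nbhs x) (nbhs (f x)) (nbhs (g x)) _ _ _ f g cf cg). Qed.

(** * Affine line arrangements *)

Section Lines.
Context {R : realType}.
Local Notation C := (R[i]^o).

Lemma mul_continuous_at (X : topologicalType) (f g : X -> C) (x : X) :
  {for x, continuous f} -> {for x, continuous g} -> {for x, continuous (fun x => f x * g x)}.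
Proof. by move=> cf cg; apply: cvgM; [exact: cf|exact: cg]. Qed.

Lemma inv_continuous_at (X : topologicalType) (f : X -> C) (x : X) : f x != 0 ->
  {for x, continuous f} -> {for x, continuous (fun x => (f x)^-1)}.
Proof. by move=> f0 cf; apply: cvgV => //; exact: cf. Qed.

Lemma pi1_affine_graph_complement (J : finType) (p q : J -> C) (r : nat)
    (a : 'I_r -> C) (a0 : 'I_0 -> C)
    (x : set_type (graph_complement (fun j u => p j * u + q j) a))
    (y : set_type (graph_complement (fun j u => p j * u + q j) a0)) :
  (forall j k, p j = p k -> q j = q k -> j = k) ->
  injective a -> (forall i, injective (fun j => p j * a i + q j)) ->
  group_isomorphic (pi1 R x) (free_group r * pi1 R y)%type.
Proof.
move=> pq a_inj ainj.
(* The abscissae where two graphs of different slopes meet; distinct graphs of equal slope never do,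
   and such a pair only adds the harmless value [0]. *)
pose D := [seq (q jk.2 - q jk.1) / (p jk.1 - p jk.2) | jk <- enum {: J * J}].
apply: (@pi1_graph_complement _ _ _ D) => //.
- move=> j; apply: continuousT_add; last exact: continuousT_cst.
  by apply: continuousT_mul; [exact: continuousT_cst|exact: continuousT_id].
- move=> u uD j k /= E; have [pp|pp] := eqVneq (p j) (p k).
    by apply: pq => //; move: E; rewrite pp => /addrI.
  exfalso; move/negP: uD; apply; apply/mapP; exists (j, k); first by rewrite mem_enum.
  have pp' : p j - p k != 0 by rewrite subr_eq0.
  apply: (mulIf pp'); rewrite /= divfK //.
  have -> : u * (p j - p k) = (p j * u + q j) - (p k * u + q k) + (q k - q j) by ring.
  by rewrite E subrr add0r.
Qed.

Variables (I : finType) (al be ga : I -> C).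
Hypothesis nonparallel : forall i j, i != j -> al i * be j - al j * be i != 0.
Hypothesis nonconstant : forall i, (al i != 0) || (be i != 0).

Definition form i (z : C * C) : C := al i * z.1 + be i * z.2 + ga i.

Definition arrangement_complement (S : {set I}) : set (C * C) :=
  [set z | forall i, i \in S -> form i z != 0].

Lemma form_continuous i : continuous (form i).
Proof. by rewrite /form; continuity; exact: continuousT_cst. Qed.

Lemma unimodular_completion l : exists cd : C * C, al l * cd.2 - be l * cd.1 = 1.
Proof.
have [bl|bl] := eqVneq (be l) 0; last by exists (- (be l)^-1, 0) => /=; field.
have al0 : al l != 0 by move: (nonconstant l); rewrite bl eqxx orbF.
by exists (0, (al l)^-1) => /=; field.
Qed.

Section Coordinates.
Variables (l : I) (P : C * C) (c d : C).
Hypothesis det1 : al l * d - be l * c = 1.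

(** [slope] and [cross] are the coefficients of the form [i] in the unimodular coordinates of
    [of_coordinates], centred at [P]. *)
Definition slope i := al i * d - be i * c.
Definition cross i := be i * al l - al i * be l.
Definition transversal (z : C * C) : C := c * (z.1 - P.1) + d * (z.2 - P.2).
Definition of_coordinates (y1 y2 : C) : C * C :=
  (P.1 + (d * y1 - be l * y2), P.2 + (al l * y2 - c * y1)).

Lemma cross_neq0 i : i != l -> cross i != 0.
Proof. by move=> /nonparallel; rewrite /cross -oppr_eq0 opprB [be i * _]mulrC. Qed.

(** The change of coordinates has determinant [1], so it preserves the determinants expressing that
    lines are not parallel. *)
Lemma slope_cross i j : slope i * cross j - slope j * cross i = al i * be j - al j * be i.
Proof.
rewrite -[RHS]mul1r -det1 /slope /cross; ring.
Qed.

Lemma form_of_coordinates i y1 y2 :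
  form i (of_coordinates y1 y2) = slope i * y1 + cross i * y2 + form i P.
Proof. by rewrite /form /slope /cross /=; ring. Qed.

Lemma transversal_of_coordinates y1 y2 : transversal (of_coordinates y1 y2) = y2.
Proof. by rewrite -[RHS]mul1r -det1 /transversal /=; ring. Qed.

Lemma coordinatesK z : of_coordinates (form l z - form l P) (transversal z) = z.
Proof.
case: z => z1 z2; rewrite /of_coordinates /transversal /form /=; congr (_, _).
  have -> : P.1 + (d * (al l * z1 + be l * z2 + ga l - (al l * P.1 + be l * P.2 + ga l)) -
     be l * (c * (z1 - P.1) + d * (z2 - P.2))) = P.1 + (al l * d - be l * c) * (z1 - P.1) by ring.
  by rewrite det1 mul1r addrC subrK.
have -> : P.2 + (al l * (c * (z1 - P.1) + d * (z2 - P.2)) -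
  c * (al l * z1 + be l * z2 + ga l - (al l * P.1 + be l * P.2 + ga l))) =
  P.2 + (al l * d - be l * c) * (z2 - P.2) by ring.
by rewrite det1 mul1r addrC subrK.
Qed.

Lemma transversal_continuous : continuous transversal.
Proof. by rewrite /transversal; continuity; exact: continuousT_cst. Qed.

Lemma slope_self : slope l = 1. Proof. by rewrite /slope det1. Qed.
Lemma cross_self : cross l = 0. Proof. by rewrite /cross mulrC subrr. Qed.

Hypothesis lP : form l P = 0.

Lemma of_coordinates_form z : of_coordinates (form l z) (transversal z) = z.
Proof. by rewrite -[in RHS](coordinatesK z) lP subr0. Qed.

Lemma form_line_coordinates y1 y2 : form l (of_coordinates y1 y2) = y1.
Proof. by rewrite form_of_coordinates slope_self cross_self lP mul1r mul0r !addr0. Qed.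

Lemma of_coordinates_continuous : continuous (fun y : C * C => of_coordinates y.1 y.2).
Proof. by rewrite /of_coordinates; continuity; exact: continuousT_cst. Qed.

Section ParallelProjection.
Variable S : {set I}.
Let J := {i : I | (i \in S) && (i != l)}.
Definition parallel_slope (j : J) : C := - (slope (val j) / cross (val j)).
Definition parallel_offset (j : J) : C := - (form (val j) P / cross (val j)).

Lemma cross_neq0_val (j : J) : cross (val j) != 0.
Proof. by have /andP[_ /cross_neq0] := valP j. Qed.

Lemma on_parallel_graph (j : J) y1 y2 :
  (form (val j) (of_coordinates y1 y2) == 0) = (y2 == parallel_slope j * y1 + parallel_offset j).
Proof.
rewrite form_of_coordinates -[RHS](inj_eq (mulfI (cross_neq0_val j))) -[RHS]subr_eq0.
congr (_ == _); rewrite /parallel_slope /parallel_offset; field.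
exact: cross_neq0_val.
Qed.

(** The set [T] is kept apart from [S] so that the same family of graphs serves for the arrangement
    with [l], as one puncture, and for the one without it. *)
Lemma parallel_coordinates (T : {set I}) (r : nat) (a : 'I_r -> C)
    (x : set_type (arrangement_complement T)) :
  (forall z, arrangement_complement T z <->
    (forall k, form l z != a k) /\ (forall j : J, form (val j) z != 0)) ->
  exists x' : set_type (graph_complement (fun j u => parallel_slope j * u + parallel_offset j) a),
    group_isomorphic (pi1 R x) (pi1 R x').
Proof.
move=> TE; apply: (@pi1_homeomorphic_sets R _ _ _ _ (fun z => (form l z, transversal z))
  (fun y => of_coordinates y.1 y.2)).
- move=> z /TE[la J0]; split=> //= j.
  by rewrite -on_parallel_graph of_coordinates_form.
- move=> [u w] [/= ua wJ]; apply/TE; split=> [k|j]; first by rewrite form_line_coordinates.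
  by rewrite on_parallel_graph.
- by move=> z _; exact: of_coordinates_form.
- by move=> [u w] _ /=; rewrite form_line_coordinates transversal_of_coordinates.
- have h : continuous (fun z => (form l z, transversal z)).
    by apply: pair_continuous; [exact: form_continuous|exact: transversal_continuous].
  by move=> z _; exact: h.
- by move=> z _; exact: of_coordinates_continuous.
Qed.

End ParallelProjection.

Section CentralProjection.
Variable S : {set I}.
Let J := option {i : I | (i \in S) && (form i P != 0)}.
(** [None] is the graph [w = 0], the former line at infinity. For a line missing [P] the equation is
    multiplied by [w] and divided by the value of the form at [P]. *)
Definition central_slope (j : J) : C :=
  if j is Some i then - (cross (val i) / form (val i) P) else 0.
Definition central_offset (j : J) : C :=
  if j is Some i then - (slope (val i) / form (val i) P) else 0.

Lemma on_central_graph (i : {i : I | (i \in S) && (form i P != 0)}) u w : w != 0 ->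
  (form (val i) (of_coordinates w^-1 (u / w)) == 0) =
  (w == central_slope (Some i) * u + central_offset (Some i)).
Proof.
have /andP[_ iP] := valP i.
move=> w0; rewrite form_of_coordinates -[RHS](inj_eq (mulfI iP)) -[RHS]subr_eq0.
rewrite -[LHS](inj_eq (mulfI w0)) mulr0.
congr (_ == _); rewrite /central_slope /central_offset; field.
by rewrite w0 iP.
Qed.

Lemma central_coordinates (T : {set I}) (r : nat) (a : 'I_r -> C)
    (x : set_type (arrangement_complement T)) :
  (forall z, arrangement_complement T z <-> [/\ form l z != 0,
    (forall k, transversal z / form l z != a k) &
    (forall i, i \in S -> form i P != 0 -> form i z != 0)]) ->
  exists x' : set_type (graph_complement (fun j u => central_slope j * u + central_offset j) a),
    group_isomorphic (pi1 R x) (pi1 R x').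
Proof.
move=> TE; apply: (@pi1_homeomorphic_sets R _ _ _ _
  (fun z => (transversal z / form l z, (form l z)^-1))
  (fun y => of_coordinates y.2^-1 (y.1 / y.2))).
- move=> z /TE[l0 la J0]; split=> //= -[i|] /=; last by rewrite mul0r addr0 invr_eq0.
  have l1 : (form l z)^-1 != 0 by rewrite invr_eq0.
  rewrite -[X in _ != X]/(central_slope (Some i) * _ + central_offset (Some i)).
  rewrite -on_central_graph // invrK divfK // of_coordinates_form.
  by have /andP[iS iP] := valP i; exact: J0.
- move=> [u w] [/= ua wJ].
  have w0 : w != 0 by have := wJ None; rewrite /= mul0r addr0.
  apply/TE; rewrite form_line_coordinates transversal_of_coordinates; split.
  + by rewrite invr_eq0.
  + by move=> k; rewrite invrK divfK.
  + move=> i iS iP; have iSP : (i \in S) && (form i P != 0) by rewrite iS.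
    pose j : {i : I | (i \in S) && (form i P != 0)} := exist _ i iSP.
    have : w != central_slope (Some j) * u + central_offset (Some j) by exact: wJ.
    by rewrite -on_central_graph.
- move=> z /TE[l0 _ _] /=; rewrite invrK divfK //; exact: of_coordinates_form.
- move=> [u w] [_ wJ] /=; have w0 : w != 0 by have := wJ None; rewrite /= mul0r addr0.
  by rewrite form_line_coordinates transversal_of_coordinates invrK divfK.
- move=> z /TE[l0 _ _]; have cV : {for z, continuous (fun z => (form l z)^-1)}.
    by apply: cvgV => //; exact: form_continuous.
  apply: (@pair_continuous_at _ _ _ (fun z => transversal z / form l z)
    (fun z => (form l z)^-1) z _ cV).
  have cT : {for z, continuous transversal} by exact: transversal_continuous.
  exact: (@mul_continuous_at _ transversal (fun z => (form l z)^-1) z cT cV).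
- move=> [u w] [_ wJ]; have w0 : w != 0 by have := wJ None; rewrite /= mul0r addr0.
  have cV : {for (u, w), continuous (fun z : C * C => z.2^-1)}.
    by apply: cvgV => //; exact: cvg_snd.
  apply: (@continuous_comp _ _ _ (fun z : C * C => (z.2^-1, z.1 / z.2))
    (fun y => of_coordinates y.1 y.2) (u, w)).
    apply: (@pair_continuous_at _ _ _ (fun z : C * C => z.2^-1) (fun z => z.1 / z.2) _ cV).
    have c1 : {for (u, w), continuous (fun z : C * C => z.1)} by exact: cvg_fst.
    exact: (@mul_continuous_at _ (fun z : C * C => z.1) (fun z => z.2^-1) _ c1 cV).
  exact: of_coordinates_continuous.
Qed.

End CentralProjection.

End Coordinates.

(** In the coordinates [(form l, transversal)] the line [l] is vertical and the
    other lines are graphs. *)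
Lemma pi1_remove_line (S : {set I}) (l : I) (x : set_type (arrangement_complement S))
    (y : set_type (arrangement_complement (S :\ l))) : l \in S ->
  (forall i j z, i \in S -> j \in S -> i != l -> j != l ->
    form l z = 0 -> form i z = 0 -> form j z = 0 -> i = j) ->
  group_isomorphic (pi1 R x) (free_group 1 * pi1 R y)%type.
Proof.
move=> lS simple; have [[c d] /= det1] := unimodular_completion l.
(* A point of [l], since the form takes the value [ga l] at the origin. *)
pose P := of_coordinates l (0, 0) c d (- ga l) 0.
have lP : form l P = 0.
  rewrite /P form_of_coordinates slope_self // cross_self /form /=; ring.
have [|x' xx'] := @parallel_coordinates l P c d det1 lP S S 1 (fun=> 0) x.
  move=> z; split=> [Sz|[l0 Sz] i iS]; first split => [_|j].
  - exact: Sz.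
  - by apply: Sz; case/andP: (valP j).
  - have [->|il] := eqVneq i l; first exact: l0 ord0.
    have iSl : (i \in S) && (i != l) by rewrite iS.
    exact: (Sz (exist _ i iSl)).
have [|y' yy'] := @parallel_coordinates l P c d det1 lP S (S :\ l) 0 (fun=> 0) y.
  move=> z; split=> [Sz|[_ Sz] i]; first split => [[]//|j].
    by apply: Sz; rewrite !inE andbC; exact: valP j.
  rewrite !inE andbC => iS; exact: (Sz (exist _ i iS)).
apply: (group_isomorphic_trans xx').
apply: (@group_isomorphic_trans (free_group 1 * pi1 R y')%type); last first.
  by apply: group_isomorphic_prod; [exact: group_isomorphic_refl|exact: group_isomorphic_sym].
apply: pi1_affine_graph_complement.
(* Equal slopes would make the two lines parallel. *)
- move=> j k jk _; apply/eqP; apply: contraT => njk.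
  have ij : val j != val k by [].
  move: (nonparallel ij); rewrite -(slope_cross det1) => /negP[].
  move/oppr_inj/eqP: jk; rewrite eqr_div ?cross_neq0_val // => /eqP ->.
  by rewrite subrr.
- by move=> i j _; rewrite (ord1 i) (ord1 j).
- move=> _ j k; pose z := of_coordinates l P c d 0 (parallel_offset P j).
  rewrite !mulr0 !add0r => jk; apply: val_inj.
  have /andP[jS jl] := valP j; have /andP[kS kl] := valP k.
  apply: (simple _ _ z) => //; first exact: form_line_coordinates.
    by apply/eqP; rewrite on_parallel_graph mulr0 add0r.
  by apply/eqP; rewrite on_parallel_graph mulr0 add0r jk.
Qed.

(** With [y1 = form l] and [y2 = transversal], in the coordinates [(y2 / y1, 1 / y1)]
    the line [l] is at infinity, the other lines through [P] are vertical, the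
    remaining ones are graphs, and so is the former line at infinity. *)
Lemma pi1_remove_pencil (S : {set I}) (l : I) (P : C * C)
    (x : set_type (arrangement_complement S))
    (y : set_type (arrangement_complement (S :\: [set i | (form i P == 0) && (i != l)]))) :
  l \in S -> form l P = 0 ->
  (forall r i j z, r \in S -> i \in S -> j \in S -> form r P = 0 -> r != l ->
    form i P != 0 -> form j P != 0 ->
    form r z = 0 -> form i z = 0 -> form j z = 0 -> i = j) ->
  group_isomorphic (pi1 R x)
    (free_group #|S :&: [set i | (form i P == 0) && (i != l)]| * pi1 R y)%type.
Proof.
move=> lS lP simple; have [[c d] /= det1] := unimodular_completion l.
pose Q := [set i | (form i P == 0) && (i != l)]%SET; rewrite -/Q in y *; pose r := #|S :&: Q|.
pose e (k : 'I_r) : I := enum_val k.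
have eP k : [/\ e k \in S, form (e k) P = 0 & e k != l].
  by have := enum_valP k; rewrite !inE => /and3P[? /eqP].
(* On a line through the centre [P] the ratio of the coordinates [y2 / y1] is constant; this is its
   value on [e k]. *)
pose a (k : 'I_r) : C := - slope c d (e k) / cross l (e k).
have on_a k z : form l z != 0 -> (form (e k) z == 0) = (transversal P c d z / form l z == a k).
  move=> l0; have [_ ekP el] := eP k; have ce := cross_neq0 el.
  rewrite -{1}(of_coordinates_form det1 lP z) form_of_coordinates // ekP addr0.
  rewrite /a eqr_div // addrC addr_eq0 mulrC -mulNr; congr (_ == _); ring.
have [|x' xx'] := @central_coordinates l P c d det1 lP S S r a x.
  move=> z; split=> [Sz|[l0 Sa Sz] i iS].
    split; first exact: Sz.
    - by move=> k; rewrite -on_a; [have [? _ _] := eP k|]; exact: Sz.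
    - by move=> i iS _; exact: Sz.
  have [iP|] := eqVneq (form i P) 0; last exact: Sz.
  have [->//|il] := eqVneq i l.
  have iQ : i \in S :&: Q by rewrite !inE iS iP eqxx.
  by have := Sa (enum_rank_in iQ i); rewrite -on_a // /e enum_rankK_in.
have [|y' yy'] := @central_coordinates l P c d det1 lP S (S :\: Q) 0 (fun=> 0) y.
  move=> z; split=> [Sz|[l0 _ Sz] i].
    split => [|[]//|i iS iP]; apply: Sz; rewrite !inE.
      by rewrite eqxx andbF.
    by rewrite (negPf iP).
  rewrite !inE negb_and negbK => /andP[/orP[iP|/eqP->]] // iS.
  exact: Sz.
apply: (group_isomorphic_trans xx').
apply: (@group_isomorphic_trans (free_group r * pi1 R y')%type); last first.
  by apply: group_isomorphic_prod; [exact: group_isomorphic_refl|exact: group_isomorphic_sym].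
have neql i : form i P != 0 -> i != l by apply: contra => /eqP ->; rewrite lP.
have nb i j : i != j -> slope c d i * cross l j - slope c d j * cross l i != 0.
  by move=> ij; rewrite (slope_cross det1); exact: nonparallel.
apply: pi1_affine_graph_complement.
- move=> [j|] [k|] //=.
  + have /andP[_ jP] := valP j; have /andP[_ kP] := valP k.
    move=> /oppr_inj/eqP; rewrite eqr_div // => /eqP cjk.
    move=> /oppr_inj/eqP; rewrite eqr_div // => /eqP sjk.
    congr Some; apply: val_inj; apply/eqP; apply: contraT => /nb/negP[].
    rewrite -(inj_eq (mulfI jP)) mulr0; apply/eqP.
    have -> : form (val j) P * (slope c d (val j) * cross l (val k) -
        slope c d (val k) * cross l (val j)) =
      slope c d (val j) * (cross l (val k) * form (val j) P) -
      slope c d (val k) * form (val j) P * cross l (val j) by ring.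
    by rewrite -cjk -sjk; ring.
  + have /andP[_ jP] := valP j; move=> /eqP; rewrite oppr_eq0 mulf_eq0 invr_eq0 (negPf jP) orbF.
    by rewrite (negPf (cross_neq0 (neql _ jP))).
  + have /andP[_ jP] := valP k; move=> /esym/eqP; rewrite oppr_eq0 mulf_eq0 invr_eq0 (negPf jP) orbF.
    by rewrite (negPf (cross_neq0 (neql _ jP))).
- move=> i j /eqP; rewrite /a !mulNr eqr_opp.
  have [_ _ il] := eP i; have [_ _ jl] := eP j.
  rewrite eqr_div ?cross_neq0 // -subr_eq0 => E; apply: enum_val_inj; apply/eqP.
  by apply: contraTT E => /nb.
- move=> m; have [mS mP ml] := eP m.
  (* Over [a m] no graph meets [w = 0]: the meeting point would be a former point at infinity common
     to the lines [j] and [e m], which are not parallel. *)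
  have key (j : {i : I | (i \in S) && (form i P != 0)}) :
      central_slope l (Some j) * a m + central_offset c d (Some j) != 0.
    have /andP[jS jP] := valP j; have cm := cross_neq0 ml.
    have jm : val j != e m by apply: contra jP => /eqP ->; rewrite mP.
    have -> : central_slope l (Some j) * a m + central_offset c d (Some j) =
        - (slope c d (val j) * cross l (e m) - slope c d (e m) * cross l (val j)) /
        (form (val j) P * cross l (e m)).
      by rewrite /= /a; field; rewrite jP cm.
    by rewrite mulf_neq0 ?oppr_eq0 ?nb // invr_eq0 mulf_neq0.
  move=> [j|] [k|] //.
  (* Two graphs meeting over [a m] yield a point [z] common to [e m] and to two lines missing [P],
     so [simple] identifies these lines. *)
  + have /andP[jS jP] := valP j; have /andP[kS kP] := valP k.
    set w := (X in X = _) => E.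
    pose z := of_coordinates l P c d w^-1 (a m / w).
    have w0 : w != 0 by exact: key.
    congr Some; apply: val_inj; apply: (simple (e m) _ _ z) => //.
    * apply/eqP; rewrite on_a /z form_line_coordinates ?invr_eq0 //.
      by rewrite transversal_of_coordinates // invrK divfK.
    * by apply/eqP; rewrite on_central_graph.
    * by apply/eqP; rewrite on_central_graph //; apply/eqP.
  + by rewrite [RHS]/= mul0r addr0 => /eqP; rewrite (negPf (key _)).
  + by rewrite [LHS]/= mul0r addr0 => /esym/eqP; rewrite (negPf (key _)).
Qed.

End Lines.

(** * Direct products, and the infinite cyclic group as a free group *)

Section DirectProducts.

Lemma word_val_nseq (g : 'I_1 -> Algebra.to_multiplicative int) n b : (forall i, g i = 1 :> int) ->
  word_val g (nseq n (ord0, b)) = (if b then - n%:Z else n%:Z) :> int.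
Proof.
move=> g1; elim: n => [|n IH]; first by case: b.
rewrite /= -[LHS]/((letter_val g (ord0, b) : int) + (word_val g (nseq n (ord0, b)) : int)) IH.
rewrite /letter_val /=; case: b {IH}; rewrite intS; last by rewrite g1.
by rewrite -[X in X + _]/(- (g ord0 : int)) g1 opprD.
Qed.

Lemma reduced_nseq n (a : letter 1) : reduced (nseq n a).
Proof.
case: n => // n; rewrite /reduced /=; elim: n => //= n ->; rewrite andbT.
by case: a => i b; rewrite /linv /eq_op /= eqxx; case: b.
Qed.

(** With a single generator, a change of sign between neighbours would be a cancellation. *)
Lemma reduced1P (w : seq (letter 1)) : reduced w -> exists b, w = nseq (size w) (ord0, b).
Proof.
case: w => [|[i b] w]; first by exists false.
rewrite /reduced /= => pw; exists b; rewrite (ord1 i); congr cons.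
elim: w i b pw => //= -[j c] w IH i b /andP[ne pw].
have -> : c = b.
  by move: ne; rewrite /linv /= (ord1 i) (ord1 j); case: (b) (c) => [] [].
rewrite (ord1 j); congr cons; apply: (IH j); suff -> : b = c by [].
by move: ne; rewrite /linv /= (ord1 i) (ord1 j); case: (b) (c) => [] [].
Qed.

Lemma free_group1_int : group_isomorphic (free_group 1) (Algebra.to_multiplicative int).
Proof.
pose g (_ : 'I_1) : Algebra.to_multiplicative int := (1 : int).
pose f (x : free_group 1) := word_val g x.
have g1 i : g i = 1 :> int by [].
apply: (@group_isomorphic_of _ _ f).
- by move=> x y; rewrite /f /= word_val_reduce word_val_cat.
- move=> [w rw] fw; apply: val_inj => /=; have [b wE] := reduced1P rw.
  suff : size w = 0%N by case: (w).
  move: fw; rewrite /f /= wE size_nseq => fw; have := word_val_nseq (size w) b g1.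
  rewrite fw; case: (b) (size w) => [] [] //.
- move=> [] n.
    exists (FreeGroup (reduced_nseq n (ord0, false))); exact: (word_val_nseq n false g1).
  exists (FreeGroup (reduced_nseq n.+1 (ord0, true))); rewrite NegzE.
  exact: (word_val_nseq n.+1 true g1).
Qed.

Lemma direct_product_recl n (G : 'I_n.+1 -> groupType) :
  group_isomorphic (direct_product G)
    (G ord0 * direct_product (fun s : 'I_n => G (lift ord0 s)))%type.
Proof.
pose f (g : direct_product G) : (G ord0 * direct_product (fun s : 'I_n => G (lift ord0 s)))%type :=
  (g ord0, [ffun s => g (lift ord0 s)]).
apply: (@group_isomorphic_of _ _ f).
- move=> g h; rewrite /f; congr (_, _); first by rewrite ffunE.
  by apply/ffunP => s; rewrite !ffunE.
- move=> g [g0 /ffunP gs]; apply/ffunP => s; rewrite [RHS]ffunE.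
  case: (unliftP ord0 s) => [j ->|-> //].
  by have := gs j; rewrite !ffunE.
(* The factors depend on the index, so the components are cast along the equality that splits it. *)
- move=> [a h]; pose u (s : 'I_n.+1) : G s :=
    match unliftP ord0 s with
    | UnliftSome j e => ecast i (G i) (esym e) (h j)
    | UnliftNone e => ecast i (G i) (esym e) a
    end.
  exists [ffun s => u s]; rewrite /f; congr (_, _).
    rewrite ffunE /u; case: (unliftP ord0 ord0) => [j e|e]; first by case/eqP: (neq_lift ord0 j).
    by rewrite eq_axiomK.
  apply/ffunP => j; rewrite !ffunE /u; case: (unliftP ord0 (lift ord0 j)) => [j' e|e].
    by have ej := lift_inj e; move: e; rewrite -ej => e; rewrite eq_axiomK.
  by case/eqP: (neq_lift ord0 j).
Qed.

Lemma free_abelian_group_recl n :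
  group_isomorphic (free_abelian_group n.+1) (free_group 1 * free_abelian_group n)%type.
Proof.
pose f (g : free_abelian_group n.+1) : (Algebra.to_multiplicative int * free_abelian_group n)%type :=
  (g ord0, [ffun s => g (lift ord0 s)]).
apply: (@group_isomorphic_trans (Algebra.to_multiplicative int * free_abelian_group n)%type).
  apply: (@group_isomorphic_of _ _ f).
  - move=> g h; rewrite /f; congr (_, _); first by rewrite ffunE.
    by apply/ffunP => s; rewrite !ffunE.
  - move=> g [g0 /ffunP gs]; apply/ffunP => s; rewrite [RHS]ffunE.
    case: (unliftP ord0 s) => [j ->|-> //].
    by have := gs j; rewrite !ffunE.
  - move=> [a h]; exists [ffun i => if unlift ord0 i is Some j then h j else a].
    rewrite /f ffunE unlift_none; congr (_, _).
    by apply/ffunP => j; rewrite !ffunE liftK.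
apply: group_isomorphic_prod; last exact: group_isomorphic_refl.
exact/group_isomorphic_sym/free_group1_int.
Qed.

Lemma group_isomorphic_trivial (G H : groupType) :
  (forall x y : G, x = y) -> (forall x y : H, x = y) -> group_isomorphic G H.
Proof.
by move=> G1 H1; apply: (@group_isomorphic_of _ _ (fun=> 1%g)) => // y; exists 1%g.
Qed.

Lemma group_isomorphic_prodA (G H K : groupType) :
  group_isomorphic (G * (H * K))%type ((G * H) * K)%type.
Proof.
apply: (@group_isomorphic_of _ _ (fun x : G * (H * K) => ((x.1, x.2.1), x.2.2))) => //.
- by move=> [x [y z]] [] /= -> -> ->.
- by move=> [[x y] z]; exists (x, (y, z)).
Qed.

End DirectProducts.

(** * Removing the pencils, then the remaining lines *)

Section ArrangementInduction.
Context {R : realType}.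
Local Notation C := (R[i]^o).

(** The contraction is done in real coordinates, where the straight-line homotopy applies. *)
Lemma pi1_plane (X : set (C * C)) (x : set_type X) (g h : pi1 R x) :
  (forall z, X z) -> g = h.
Proof.
move=> Xall; suff key (g' : pi1 R x) : g' = pclass x (fun=> val x) by rewrite (key g) (key h).
have [f [[cf Xf] f0 f1] <-] := pclass_surj g'; have I0 : 0 <= (0 : R) <= 1 by lra.
have I1 : 0 <= (1 : R) <= 1 by lra.
apply: pclass_homotopic.
- split; [split; [exact: cf|exact: Xf]|exact: f0|exact: f1].
- split; [split; [exact: continuousT_cst|by move=> t _; exact: Xall]|reflexivity|reflexivity].
pose F (p : (R * R) * (R * R)) : C * C := (of_plane p.1, of_plane p.2).
pose F' (z : C * C) : (R * R) * (R * R) := (to_plane z.1, to_plane z.2).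
have FK z : F (F' z) = z by rewrite /F /F' /= !to_planeK; case: z.
have cF : continuous F.
  by rewrite /F; apply: pair_continuous;
    apply: (continuousT_comp _ of_plane_continuous); continuity.
have cF' : continuous F'.
  by rewrite /F'; apply: pair_continuous;
    apply: (continuousT_comp _ to_plane_continuous); continuity.
have -> : f = fun t => F (F' (f t)) by apply/funext => t; rewrite FK.
have -> : (fun=> val x) = (fun t : R => F (F' (val x))) by apply/funext => t; rewrite FK.
apply: (@path_homotopic_convex R _ _ setT) => //=.
- by split => //; apply: (continuousT_comp cf).
- by split => //; exact: continuousT_cst.
- by rewrite f0.
- by rewrite f1.
Qed.

Variables (I : finType) (al be ga : I -> C).
Hypothesis nonparallel : forall i j, i != j -> al i * be j - al j * be i != 0.
Hypothesis nonconstant : forall i, (al i != 0) || (be i != 0).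
Local Notation form := (form al be ga).
Local Notation arrangement_complement := (arrangement_complement al be ga).

(** Without triple points the lines can be removed in any order, each leaving a factor
    [free_group 1], that is [Z]. *)
Lemma pi1_simple_arrangement N (S : {set I}) (x : set_type (arrangement_complement S)) :
  #|S| = N ->
  (forall i j h z, i \in S -> j \in S -> h \in S -> form i z = 0 -> form j z = 0 ->
    form h z = 0 -> i != j -> i != h -> j != h -> False) ->
  group_isomorphic (pi1 R x) (free_abelian_group N).
Proof.
elim: N S x => [|N IH] S x cS simple.
  apply: group_isomorphic_trivial; last by move=> g h; apply/ffunP => -[].
  by move=> g h; apply: pi1_plane => z i; rewrite (cards0_eq cS) inE.
have /card_gt0P[l lS] : (0 < #|S|)%N by rewrite cS.
have Sl z : arrangement_complement S z -> arrangement_complement (S :\ l) z.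
  by move=> Sz i; rewrite !inE => /andP[_]; exact: Sz.
pose y : set_type (arrangement_complement (S :\ l)) := SigSub (mem_set (Sl _ (set_typeP x))).
apply: (group_isomorphic_trans (pi1_remove_line nonparallel nonconstant x y lS _)).
  move=> i j z iS jS il jl lz iz jz; apply/eqP; apply: contraT => ij.
  by case: (simple i j l z).
apply: (@group_isomorphic_trans (free_group 1 * free_abelian_group N)%type); last first.
  exact/group_isomorphic_sym/free_abelian_group_recl.
apply: group_isomorphic_prod; first exact: group_isomorphic_refl.
apply: IH.
  by move: cS; rewrite (cardsD1 l) lS => -[].
move=> i j h z; rewrite !inE => /andP[_ iS] /andP[_ jS] /andP[_ hS]; exact: simple.
Qed.

(** Removing the lines through one [p s] other than [l s] leaves the other pencils untouched and
    leaves a single line through [p s]. [N] counts the lines left when all pencils are gone, the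
    lines [l s] among them. *)
Theorem pi1_collinear_arrangement k (p : 'I_k -> C * C) (l : 'I_k -> I) N (S : {set I})
    (x : set_type (arrangement_complement S)) :
  (forall s, l s \in S /\ form (l s) (p s) = 0) ->
  (forall s t i, i \in S -> t != s -> form i (p s) = 0 -> i != l s -> form i (p t) != 0) ->
  (forall i j h z, i \in S -> j \in S -> h \in S -> form i z = 0 -> form j z = 0 ->
    form h z = 0 -> i != j -> i != h -> j != h -> exists s, z = p s) ->
  #|S| = (\sum_(s < k) #|S :&: [set i | (form i (p s) == 0%R) && (i != l s)]%SET| + N)%N ->
  group_isomorphic (pi1 R x)
    (direct_product (fun s : 'I_k =>
      free_group #|S :&: [set i | (form i (p s) == 0) && (i != l s)]%SET|) *
     free_abelian_group N)%type.
Proof.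
elim: k p l S x => [|k IH] p l S x lP pencil simple.
  rewrite big_ord0 add0n => cS.
  apply: (group_isomorphic_trans (pi1_simple_arrangement x cS _)).
    by move=> i j h z iS jS hS iz jz hz ij ih jh; have [[]] := simple i j h z iS jS hS iz jz hz ij ih jh.
  apply: (@group_isomorphic_of _ _ (fun a => (1%g, a))) => //.
  - by move=> a b; rewrite -[LHS]/((1 : direct_product _)%g, (a * b)%g) -[in LHS](mulg1 1%g).
  - by move=> a [].
  - by move=> [b a]; exists a; congr (_, _); apply/ffunP => -[].
rewrite big_ord_recl.
pose Q s : {set I} := [set i | (form i (p s) == 0) && (i != l s)]%SET.
rewrite -/(Q _) => cS.
under [X in direct_product X]eq_fun => s do rewrite -/(Q s).
have Sl z : arrangement_complement S z -> arrangement_complement (S :\: Q ord0) z.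
  by move=> Sz i; rewrite inE => /andP[_]; exact: Sz.
pose y : set_type (arrangement_complement (S :\: Q ord0)) := SigSub (mem_set (Sl _ (set_typeP x))).
have [l0S l0P] := lP ord0.
apply: (group_isomorphic_trans (pi1_remove_pencil nonparallel nonconstant x y l0S l0P _)).
  (* As [i] misses [p ord0], a triple point [z] on [i] and on a line [r] of the pencil would be
     another [p s] on [r], which [pencil] forbids. *)
  move=> r i j z rS iS jS rp rl ip jp rz iz jz; apply/eqP; apply: contraT => ij.
  have nr h : form h (p ord0) != 0 -> r != h by apply: contra => /eqP <-; rewrite rp.
  have [s zs] := simple r i j z rS iS jS rz iz jz (nr _ ip) (nr _ jp) ij.
  have s0 : s != ord0 by apply: contra ip => /eqP s0; rewrite -s0 -zs iz.
  by have := pencil ord0 s r rS s0 rp rl; rewrite -zs rz eqxx.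
have SQ s : s != ord0 -> (S :\: Q ord0) :&: Q s = S :&: Q s.
  move=> s0; apply/setP => i; rewrite [LHS]finset.in_setI [RHS]finset.in_setI finset.in_setD.
  have [|_] := boolP (i \in Q s); rewrite ?andbF ?andbT // inE => /andP[/eqP ip il].
  have [iS|] := boolP (i \in S); rewrite ?andbF //= andbT inE.
  by rewrite (negPf (pencil s ord0 i iS _ ip il)) // eq_sym.
(* Either [l s] is [l ord0], which is kept, or it misses [p ord0]: a line through [p ord0] other
   than [l ord0] contains no other [p s]. *)
have lS0 s : s != ord0 -> l s \in S :\: Q ord0.
  move=> s0; have [lS lp] := lP s; rewrite finset.in_setD lS andbT inE negb_and negbK.
  have [//|/= ll0] := eqVneq (l s) (l ord0); rewrite ?orbT // orbF.
  apply/eqP => lp0; have := pencil ord0 s (l s) lS s0 lp0 ll0.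
  by rewrite lp eqxx.
have [||||] := IH (fun s => p (lift ord0 s)) (fun s => l (lift ord0 s)) _ y.
- by move=> s; split; [apply: lS0; rewrite eq_sym neq_lift|have [] := lP (lift ord0 s)].
- move=> s t i; rewrite finset.in_setD => /andP[_ iS] ts; exact: pencil.
- move=> i j h z; rewrite !finset.in_setD => /andP[iQ iS] /andP[jQ jS] /andP[hQ hS] iz jz hz ij ih jh.
  have [s zs] := simple i j h z iS jS hS iz jz hz ij ih jh.
  move: zs; case: (unliftP ord0 s) => [s' ->|->] zs; first by exists s'.
  move: iQ jQ; rewrite !inE -zs iz jz eqxx /= !negbK => /eqP il /eqP jl.
  by move: ij; rewrite il jl eqxx.
- apply/eqP; rewrite -(eqn_add2l #|S :&: Q ord0|) cardsID cS -addnA; apply/eqP; congr (_ + (_ + _))%N.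
  by apply: eq_bigr => s _; rewrite -/(Q _) SQ // eq_sym neq_lift.
have -> : (fun s : 'I_k => free_group #|(S :\: Q ord0) :&:
    [set i | (form i (p (lift ord0 s)) == 0) && (i != l (lift ord0 s))]%SET| : groupType) =
    (fun s : 'I_k => free_group #|S :&: Q (lift ord0 s)|).
  by apply/funext => s; rewrite -/(Q _) SQ // eq_sym neq_lift.
move=> f bf; set G := fun s : 'I_k.+1 => _ : groupType.
apply: (@group_isomorphic_trans (G ord0 *
  (direct_product (fun s => G (lift ord0 s)) * free_abelian_group N))%type).
  by apply: group_isomorphic_prod; [exact: group_isomorphic_refl|by exists f].
apply: (group_isomorphic_trans (group_isomorphic_prodA _ _ _)).
apply: group_isomorphic_prod; last exact: group_isomorphic_refl.
exact/group_isomorphic_sym/direct_product_recl.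
Qed.

End ArrangementInduction.

(** The rank factorisation of a nonzero row: its extended row basis starts with a multiple of that
    row. This makes the line at infinity a coordinate line of a chart. *)
Lemma unit_matrix_row (F : fieldType) n (b : 'rV[F]_n.+1) : b != 0 ->
  exists2 M : 'M[F]_n.+1, M \in unitmx & exists2 c : F, c != 0 & b = c *: row ord0 M.
Proof.
move=> b0; exists (row_ebase b); first exact: row_ebase_unit.
have bE : b = col_ebase b 0 0 *: row ord0 (row_ebase b).
  rewrite -[LHS]mulmx_ebase [col_ebase b]mx11_scalar -mulmxA mul_scalar_mx mxE eqxx mulr1n.
  rewrite rank_rV b0 rowE; congr (_ *: (_ *m _)); apply/matrixP => i j.
  by rewrite !mxE (ord1 i) eqxx /= -val_eqE eq_sym /=; case: (nat_of_ord j).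
exists (col_ebase b 0 0) => //; apply: contraNneq b0 => c0.
by rewrite bE c0 scale0r.
Qed.

Lemma lift_ord3_1 : lift ord0 ord0 = 1 :> 'I_3. Proof. exact: val_inj. Qed.

Lemma lift_ord3_2 : lift ord0 (lift ord0 ord0) = ord_max :> 'I_3. Proof. exact: val_inj. Qed.

(** * Affine charts of the projective plane *)

Section Chart.
Context {R : realType}.
Local Notation C := (R[i]^o).
Local Open Scope quotient_scope.
Variables (M : 'M[C]_3).
Hypothesis Mu : M \in unitmx.

Definition coordinate (i : 'I_3) (v : 'cV[C]_3) : C := (M *m v) i ord0.

Definition column (x0 x1 x2 : C) : 'cV[C]_3 :=
  x0 *: col 0 (invmx M) + x1 *: col 1 (invmx M) + x2 *: col ord_max (invmx M).

Lemma coordinate_inj v w : coordinate^~ v =1 coordinate^~ w -> v = w.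
Proof.
by move=> vw; apply: (can_inj (mulKmx Mu)); apply/colP => i; exact: vw.
Qed.

Lemma ord3P (P : 'I_3 -> Prop) : P 0 -> P 1 -> P ord_max -> forall i, P i.
Proof.
move=> P0 P1 P2 [[|[|[|//]]] h]; [move: P0|move: P1|move: P2];
  by congr P; apply: val_inj.
Qed.

Lemma coordinate_column x0 x1 x2 : [/\ coordinate 0 (column x0 x1 x2) = x0,
  coordinate 1 (column x0 x1 x2) = x1 & coordinate ord_max (column x0 x1 x2) = x2].
Proof.
have e i : M *m col i (invmx M) = delta_mx i ord0 by rewrite colE mulmxA mulmxV // mul1mx.
have eE i : coordinate i (column x0 x1 x2) =
    x0 * (i == 0)%:R + x1 * (i == 1)%:R + x2 * (i == ord_max)%:R.
  by rewrite /coordinate /column !mulmxDr -!scalemxAr !e !mxE !eqxx !andbT.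
by split; rewrite eE !(mulr1, mulr0, addr0, add0r).
Qed.

Lemma column_coordinate v :
  column (coordinate 0 v) (coordinate 1 v) (coordinate ord_max v) = v.
Proof.
by apply: coordinate_inj; have [? ? ?] := coordinate_column (coordinate 0 v) (coordinate 1 v)
  (coordinate ord_max v); apply: ord3P.
Qed.

Lemma coordinateZ i c v : coordinate i (c *: v) = c * coordinate i v.
Proof. by rewrite /coordinate -scalemxAr mxE. Qed.

Lemma column_eq0 x0 x1 x2 : column x0 x1 x2 = 0 -> [/\ x0 = 0, x1 = 0 & x2 = 0].
Proof.
move=> c0; have := coordinate_column x0 x1 x2; rewrite c0 /coordinate mulmx0 !mxE.
by move=> [<- <- <-].
Qed.

Lemma mulmx_coordinate (a : 'rV[C]_3) v : (a *m v) ord0 ord0 =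
  (a *m invmx M) ord0 1 * coordinate 1 v + (a *m invmx M) ord0 ord_max * coordinate ord_max v +
  (a *m invmx M) ord0 0 * coordinate 0 v.
Proof.
have -> : a *m v = (a *m invmx M) *m (M *m v) by rewrite mulmxA mulmxKV.
by rewrite [LHS]mxE !big_ord_recl big_ord0 addr0 addrC lift_ord3_1 lift_ord3_2.
Qed.

Lemma mulmx_eq0P (a : 'rV[C]_3) (v : 'cV[C]_3) : a *m v = 0 <-> (a *m v) ord0 ord0 = 0.
Proof.
split=> [->|h]; first by rewrite mxE.
by apply/matrixP => i j; rewrite (ord1 i) (ord1 j) h mxE.
Qed.

Lemma coordinate_continuous i : continuous (fun v : nzvec R => coordinate i (set_val v)).
Proof.
have c (j : 'I_3) : continuous (fun v : nzvec R => (set_val v) j ord0 : C).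
  apply: (@continuousT_comp (nzvec R) 'cV[C]_3 C (fun v => set_val v) (fun N => N j ord0)).
    exact: val_continuous.
  exact: (@coord_continuous R[i]^o).
have -> : (fun v : nzvec R => coordinate i (set_val v)) = fun v : nzvec R =>
    M i 0 * (set_val v) 0 ord0 + M i 1 * (set_val v) 1 ord0 +
    M i ord_max * (set_val v) ord_max ord0.
  apply/funext => v; rewrite /coordinate [LHS]mxE !big_ord_recl big_ord0 addr0 addrA.
  by rewrite lift_ord3_1 lift_ord3_2.
by apply: continuousT_add; [apply: continuousT_add|]; apply: continuousT_mul;
  [exact: continuousT_cst|exact: c|exact: continuousT_cst|exact: c|exact: continuousT_cst|exact: c].
Qed.

Definition chart_vec (v : 'cV[C]_3) : C * C :=
  (coordinate 1 v / coordinate 0 v, coordinate ord_max v / coordinate 0 v).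

Definition chart (P : CP2 R) : C * C := chart_vec (set_val (repr P)).

Lemma repr_proportional (v : nzvec R) :
  exists2 c : C, c != 0 & set_val (repr (\pi_(CP2 R) v)) = c *: set_val v.
Proof.
have /eqmodP/asboolP[c c0 E] :
    repr (\pi_(CP2 R) v) = v %[mod {eq_quot (@proportional_equivRel R)}].
  exact: (@reprK _ (CP2 R)).
by exists c.
Qed.

Lemma chart_pi (v : nzvec R) : chart (\pi_(CP2 R) v) = chart_vec (set_val v).
Proof.
rewrite /chart; have [c c0 ->] := repr_proportional v.
by rewrite /chart_vec !coordinateZ !invfM !mulrA ![c * _]mulrC !mulfK //; congr (_, _);
  rewrite -mulrA [c^-1 * _]mulrC mulrA.
Qed.

Lemma proportional_pi (v w : nzvec R) (c : C) : c != 0 -> set_val v = c *: set_val w ->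
  \pi_(CP2 R) v = \pi_(CP2 R) w.
Proof.
move=> c0 E; have : v = w %[mod {eq_quot (@proportional_equivRel R)}].
  by apply/eqmodP/asboolP; exists c.
exact.
Qed.

Definition at_infinity (P : CP2 R) : Prop := coordinate 0 (set_val (repr P)) = 0.

Lemma at_infinity_pi (v : nzvec R) :
  at_infinity (\pi_(CP2 R) v) <-> coordinate 0 (set_val v) = 0.
Proof.
rewrite /at_infinity; have [c c0 ->] := repr_proportional v; rewrite coordinateZ.
by split=> [/eqP|->]; rewrite ?mulr0 // mulf_eq0 (negPf c0) => /eqP.
Qed.

Lemma column_neq0 z : column 1 z.1 z.2 != 0 :> 'cV[C]_3.
Proof. by apply/eqP => /column_eq0[/eqP]; rewrite oner_eq0. Qed.

Definition unchart_vec (z : C * C) : nzvec R :=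
  SigSub (mem_set (column_neq0 z : [set v : 'cV[C]_3 | v != 0] (column 1 z.1 z.2))).

Definition unchart (z : C * C) : CP2 R := \pi_(CP2 R) (unchart_vec z).

Lemma unchartK : cancel unchart chart.
Proof.
move=> z; rewrite /unchart chart_pi /chart_vec /=.
by have [-> -> ->] := coordinate_column 1 z.1 z.2; rewrite !divr1; case: z.
Qed.

Lemma unchart_finite z : ~ at_infinity (unchart z).
Proof.
move/at_infinity_pi; have [-> _ _] := coordinate_column 1 z.1 z.2.
by apply/eqP; rewrite oner_eq0.
Qed.

Lemma chartK P : ~ at_infinity P -> unchart (chart P) = P.
Proof.
move=> /eqP P0; rewrite -[RHS](@reprK _ (CP2 R)); set v := repr P.
apply: (@proportional_pi _ _ (coordinate 0 (set_val v))^-1); first by rewrite invr_eq0.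
rewrite -[X in _ = _ *: X](column_coordinate (set_val v)) /= /column !scalerDr !scalerA.
by rewrite mulVf // /chart /chart_vec -/v ![_^-1 * _]mulrC.
Qed.

(** [chart] reads an arbitrary representative, so openness is checked upstairs, among nonzero
    vectors, where [chart_vec] is continuous off the zeros of the first coordinate and, by
    [chart_pi], computes [chart]. *)
Lemma chart_continuous P : ~ at_infinity P -> {for P, continuous chart}.
Proof.
move=> P0 U; rewrite nbhsE => -[W [oW WP] WU].
pose V : set (CP2 R) := [set Q | ~ at_infinity Q /\ W (chart Q)].
apply: (@filterS _ _ _ V); first by move=> Q [_ /WU].
apply: open_nbhs_nbhs; split => //.
suff oV : @quotient_open (nzvec R) {eq_quot (@proportional_equivRel R)} V by exact: oV.
rewrite /quotient_open openE => v [v0 vW]; have v0' : coordinate 0 (set_val v) != 0.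
  by apply/eqP => /at_infinity_pi.
have cI : {for v, continuous (fun v : nzvec R => (coordinate 0 (set_val v))^-1)}.
  have c0 : {for v, continuous (fun v : nzvec R => coordinate 0 (set_val v))}.
    by have := @coordinate_continuous 0; apply.
  exact: (@inv_continuous_at _ _ (fun v : nzvec R => coordinate 0 (set_val v)) _ v0' c0).
have cc : {for v, continuous (fun v : nzvec R => chart_vec (set_val v))}.
  apply: (@pair_continuous_at _ _ _ (fun v : nzvec R => coordinate 1 (set_val v) / coordinate 0 (set_val v))
    (fun v : nzvec R => coordinate ord_max (set_val v) / coordinate 0 (set_val v))).
    have c1 : {for v, continuous (fun v : nzvec R => coordinate 1 (set_val v))}.
      by have := @coordinate_continuous 1; apply.
    exact: (@mul_continuous_at _ _ (fun v : nzvec R => coordinate 1 (set_val v)) _ _ c1 cI).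
  have c2 : {for v, continuous (fun v : nzvec R => coordinate ord_max (set_val v))}.
    by have := @coordinate_continuous ord_max; apply.
  exact: (@mul_continuous_at _ _ (fun v : nzvec R => coordinate ord_max (set_val v)) _ _ c2 cI).
have nW : nbhs v [set v : nzvec R | W (chart_vec (set_val v))].
  by apply: cc; apply: open_nbhs_nbhs; split => //; rewrite -chart_pi.
have n0 : nbhs v [set v : nzvec R | coordinate 0 (set_val v) != 0].
  have : open [set x : C | x != 0].
    rewrite (_ : [set _ | _] = ~` [set 0]); last by apply/seteqP; split => x /eqP.
    by apply: closed_openC; apply/accessible_closed_set1/hausdorff_accessible; exact: (@norm_hausdorff C C).
  move=> o0; have c0 : {for v, continuous (fun v : nzvec R => coordinate 0 (set_val v))}.
    by have := @coordinate_continuous 0; apply.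
  by apply: (c0 [set x : C | x != 0]); exact: open_nbhs_nbhs.
apply: filterS (filterI nW n0) => w [wW w0]; split; last by rewrite chart_pi.
by move/at_infinity_pi/eqP; rewrite (negPf w0).
Qed.

Lemma unchart_continuous : continuous unchart.
Proof.
have cv : continuous unchart_vec.
  have cc : continuous (fun z : C * C => column 1 z.1 z.2).
    by rewrite /column; continuity; exact: continuousT_cst.
  move=> z U [? [[W oW <-] /= Wz WU]].
  have : nbhs z [set z : C * C | W (column 1 z.1 z.2)] by apply: cc; exact: open_nbhs_nbhs.
  by rewrite nbhs_filterE /=; apply: filterS => y Wy; apply: WU.
by apply: (continuousT_comp cv); exact: pi_continuous.
Qed.

End Chart.

Section AffineChart.
Context {R : realType}.
Local Notation C := (R[i]^o).
Local Open Scope quotient_scope.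

Lemma two_le_multiplicity n (L : 'I_n -> set (CP2 R)) P i j : i != j -> L i P -> L j P ->
  intersection_point L P.
Proof.
move=> ij iP jP; rewrite /intersection_point /multiplicity.
by apply/card_gt1P; exists i, j; split => //; rewrite unfold_in /=; exact: mem_set.
Qed.

(** For two lines with vanishing determinant, [(x, y)] is a common direction, that is, a point at
    infinity on both. *)
Lemma exists_orthogonal (u v u' v' : C) : u * v' - u' * v = 0 ->
  exists x y, [/\ (x != 0) || (y != 0), u * x + v * y = 0 & u' * x + v' * y = 0].
Proof.
move=> uv; have [/eqP u0|] := boolP (u == 0); last first.
  move=> u0; exists v, (- u); split; first by rewrite oppr_eq0 u0 orbT.
    by ring.
  by rewrite -[RHS]oppr0 -uv; ring.
have [/eqP v0|] := boolP (v == 0); last first.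
  move=> v0; exists v, (- u); split; first by rewrite v0.
    by ring.
  by rewrite -[RHS]oppr0 -uv; ring.
have [/eqP u'0|] := boolP (u' == 0).
  have [/eqP v'0|] := boolP (v' == 0).
    by exists 1, 0; rewrite u0 v0 u'0 v'0 oner_neq0; split => //; ring.
  move=> v'0; exists v', (- u'); rewrite u0 v0 v'0; split=> //; ring.
move=> u'0; exists v', (- u'); rewrite u0 v0 oppr_eq0 u'0 orbT; split=> //; ring.
Qed.

Lemma affine_chart n (L : 'I_n -> set (CP2 R)) (linf : set (CP2 R)) :
  is_line linf -> (forall i, is_line (L i)) -> (forall i, L i <> linf) ->
  (forall P, intersection_point L P -> ~ linf P) ->
  exists (al be ga : 'I_n -> C) (f : CP2 R -> C * C) (g : C * C -> CP2 R),
    [/\ forall i j, i != j -> al i * be j - al j * be i != 0,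
        forall i, (al i != 0) || (be i != 0) &
        forall P i, ~ linf P -> (L i P <-> form al be ga i (f P) = 0)] /\
    [/\ forall z, ~ linf (g z), cancel g f, forall P, ~ linf P -> g (f P) = P,
        forall P, ~ linf P -> {for P, continuous f} & continuous g].
Proof.
move=> [b b0 linfE] /(_ _)/cid2 L_line L_linf L_generic.
pose a i := sval (L_line i).
have a0 i : a i != 0 by rewrite /a; case: (L_line i).
have LE i : L i = proj_line (a i) by rewrite /a; case: (L_line i).
have [M Mu [c c0 bE]] := unit_matrix_row b0.
have linfP P : linf P <-> at_infinity M P.
  rewrite linfE bE /proj_line /at_infinity /= mulmx_eq0P -scalemxAl mxE -row_mul mxE.
  rewrite -[X in c * X]/(coordinate M 0 (set_val (repr P))).
  by split=> [/eqP|->]; rewrite ?mulr0 // mulf_eq0 (negPf c0) => /eqP.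
pose al i := (a i *m invmx M) ord0 1; pose be i := (a i *m invmx M) ord0 ord_max.
pose ga i := (a i *m invmx M) ord0 0.
have onL i P : ~ linf P -> L i P <-> form al be ga i (chart M P) = 0.
  move=> /linfP/eqP P0; rewrite LE /proj_line /= mulmx_eq0P (mulmx_coordinate Mu).
  rewrite /form /chart /chart_vec /= -/(al i) -/(be i) -/(ga i).
  set v := set_val _; set y0 := coordinate M 0 v; have y00 : y0 != 0 by [].
  have -> : al i * coordinate M 1 v + be i * coordinate M ord_max v + ga i * y0 =
    (al i * (coordinate M 1 v / y0) + be i * (coordinate M ord_max v / y0) + ga i) * y0.
    by field.
  by split=> [/eqP|->]; rewrite ?mul0r // mulf_eq0 (negPf y00) orbF => /eqP.
have on_infinity i x y (h : column M 0 x y != 0) :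
    al i * x + be i * y = 0 -> L i (\pi_(CP2 R) (SigSub (mem_set (h : [set v : 'cV[C]_3 | v != 0] _)) : nzvec R)).
  move=> E; rewrite LE; apply/proj_lineE/mulmx_eq0P; rewrite (mulmx_coordinate Mu) /=.
  by have [-> -> ->] := coordinate_column Mu 0 x y; rewrite mulr0 addr0.
exists al, be, ga, (chart M), (unchart Mu); split; split.
(* Parallel lines would meet on the line at infinity, against genericity. *)
- move=> i j ij; apply/negP => /eqP/exists_orthogonal[x [y [xy ix jy]]].
  have h : column M 0 x y != 0.
    by apply: contraTneq xy => /(column_eq0 Mu)[_ -> ->]; rewrite eqxx.
  apply: (L_generic _ (two_le_multiplicity ij (on_infinity i x y h ix) (on_infinity j x y h jy))).
  by apply/linfP/at_infinity_pi; have [-> _ _] := coordinate_column Mu 0 x y.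
(* A form without linear part is a multiple of the first coordinate, so its line would be the line
   at infinity. *)
- move=> i; apply: contra_notT (L_linf i); rewrite negb_or !negbK => /andP[/eqP ai /eqP bi].
  have ri v : (a i *m v) ord0 ord0 = ga i * coordinate M 0 v.
    by rewrite (mulmx_coordinate Mu) -/(al i) -/(be i) ai bi !mul0r !add0r.
  have gi : ga i != 0.
    apply: contra_neq (a0 i) => gi; apply/rowP => j; rewrite mxE.
    have := ri (delta_mx j ord0); rewrite gi mul0r -colE mxE => <-; congr (a i _ _).
  apply/seteqP; split => P; rewrite linfP LE /proj_line /= mulmx_eq0P ri.
    by move/eqP; rewrite mulf_eq0 (negPf gi) => /eqP.
  by rewrite /at_infinity => ->; rewrite mulr0.
- by move=> P i; exact: onL.
- by move=> z /linfP; exact: unchart_finite.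
- exact: unchartK.
- by move=> P nP; apply: chartK => /linfP.
- by move=> P nP; apply: chart_continuous => /linfP.
- exact: unchart_continuous.
Qed.

End AffineChart.

(** * Counting the lines *)

Lemma card_imset_same_kernel (T A B : finType) (f : T -> A) (g : T -> B) :
  (forall s t, f s = f t <-> g s = g t) ->
  #|[set f s | s : T]%SET| = #|[set g s | s : T]%SET|.
Proof.
have le (A' B' : finType) (f' : T -> A') (g' : T -> B') : (forall s t, g' s = g' t -> f' s = f' t) ->
    (#|[set f' s | s : T]%SET| <= #|[set g' s | s : T]%SET|)%N.
  move=> fg; pose h y := omap f' [pick s | g' s == y].
  have hg s : h (g' s) = Some (f' s).
    by rewrite /h; case: pickP => [t /eqP/fg <- //|/(_ s)]; rewrite eqxx.
  rewrite -(card_imset (f := Some)); last exact: Some_inj.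
  apply: leq_trans (leq_imset_card h _); apply: subset_leq_card; apply/fintype.subsetP => y.
  move=> /imsetP[_ /imsetP[s _ ->] ->]; apply/imsetP; exists (g' s); last by rewrite hg.
  exact: imset_f.
by move=> fg; apply/eqP; rewrite eqn_leq !le // => s t /fg.
Qed.

Section Incidence.
Variables (I K : finType) (through : K -> {set I}) (l : K -> I).
Hypothesis l_through : forall s, l s \in through s.
Hypothesis pencil : forall s t i, i \in through s -> i != l s -> t != s -> i \notin through t.

(** Every line is of exactly one kind: a removed line of a unique pencil, a chosen line [l s], or a
    line through none of the points. By [pencil], a chosen line belongs to no removed pencil. *)
Lemma card_lines : #|I| = (\sum_s #|through s :\ l s| +
  (#|[set l s | s : K]%SET| + #|[set i | [forall s, i \notin through s]]%SET|))%N.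
Proof.
pose U := (\bigcup_s (through s :\ l s))%SET.
pose E := [set i | [forall s, i \notin through s]]%SET.
have -> : (\sum_s #|through s :\ l s| = #|U|)%N.
  rewrite -sum1_card partition_disjoint_bigcup.
    by apply: eq_bigr => s _; rewrite sum1_card.
  move=> s t st; rewrite -setI_eq0; apply/eqP/setP => i; rewrite !inE.
  have [is_|] := boolP (i \in through s); rewrite ?andbF //= andbT.
  have [//|il] := eqVneq i (l s); rewrite /= (negPf (pencil is_ il _)) ?andbF //.
  by rewrite eq_sym.
have lU s : l s \notin U.
  apply/bigcupP => -[t _]; rewrite !inE => /andP[lst st].
  have nst : s != t by apply: contraNneq lst => ->.
  by have := pencil st lst nst; rewrite l_through.
have disj : [set l s | s : K]%SET :&: U = finset.set0.
  by apply/setP => i; rewrite !inE; apply/andP => -[/imsetP[s _ ->]]; apply/negP.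
have EU : E = ~: ([set l s | s : K]%SET :|: U).
  apply/setP => i; rewrite !inE negb_or; apply/forallP/andP => [h|[il iU] s].
    split; first by apply/imsetP => -[s _ il]; move: (h s); rewrite il l_through.
    by apply/bigcupP => -[s _]; rewrite !inE (negPf (h s)) andbF.
  apply/negP => is_; move/negP: iU; apply; apply/bigcupP; exists s => //; rewrite !inE is_ andbT.
  by apply: contraNneq il => ->; exact: imset_f.
rewrite -/E EU addnA addnC -[LHS](cardsC ([set l s | s : K]%SET :|: U)) addnC; congr (_ + _)%N.
by rewrite cardsU disj cards0 subn0 addnC.
Qed.

End Incidence.

(** Cramer's rule: the determinant times each coordinate is an expression in the coefficients
    alone. *)
Lemma forms_meet_once (F : fieldType) (a b c a' b' c' x y x' y' : F) : a * b' - a' * b != 0 ->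
  a * x + b * y + c = 0 -> a' * x + b' * y + c' = 0 ->
  a * x' + b * y' + c = 0 -> a' * x' + b' * y' + c' = 0 -> (x, y) = (x', y').
Proof.
move=> d0 e1 e2 e3 e4; congr (_, _); apply: (mulfI d0).
  have -> : (a * b' - a' * b) * x = b' * (a * x + b * y + c) - b * (a' * x + b' * y + c')
    - (b' * c - b * c') by ring.
  have -> : (a * b' - a' * b) * x' = b' * (a * x' + b * y' + c) - b * (a' * x' + b' * y' + c')
    - (b' * c - b * c') by ring.
  by rewrite e1 e2 e3 e4.
have -> : (a * b' - a' * b) * y = a * (a' * x + b' * y + c') - a' * (a * x + b * y + c)
  - (a * c' - a' * c) by ring.
have -> : (a * b' - a' * b) * y' = a * (a' * x' + b' * y' + c') - a' * (a * x' + b * y' + c)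
  - (a * c' - a' * c) by ring.
by rewrite e1 e2 e3 e4.
Qed.

Theorem theorem5p2p1 (R : realType) (n : nat) (L : 'I_n -> set (CP2 R))
    (linf : set (CP2 R)) (k : nat) (p : 'I_k -> CP2 R) (m : 'I_k -> nat)
    (L_arr : real_line_arrangement L)
    (linf_line : is_line linf)
    (linf_notin : forall i, L i <> linf)
    (* all the intersection points lie in C^2 *)
    (linf_generic : forall P, intersection_point L P -> ~ linf P)
    (p_inj : injective p)
    (p_range : range p = [set P | multiple_point L P])
    (m_mult : forall s, m s = multiplicity L (p s))
    (collinear : forall s, exists i, forall t, point_equiv L p s t -> L i (p t))
    (u0 : set_type (affine_complement L linf)) :
  group_isomorphic (pi1 R u0)
    (direct_product (fun s : 'I_k => free_group (m s - 1)) *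
     free_abelian_group (n - \sum_(s < k) (m s - 1)))%type
  /\
  n%:Z - \sum_(s < k) ((m s)%:Z - 1) =
    (#|equivalence_partition (point_equiv L p) finset.setT|
     + #|[pred i | `[< only_simple_points L i >]]|)%N%:Z.
Proof.
have L_line i : is_line (L i).
  have [a a0 ->] := L_arr.2 i; exists (map_mx (real_complex R) a) => //.
  by rewrite map_mx_eq0.
have [al [be [ga [f [g [[nonparallel nonconstant onL] [g_finite gK fK cf cg]]]]]]] :=
  affine_chart linf_line L_line linf_notin linf_generic.
have p_mult s : multiple_point L (p s).
  have : range p (p s) by exists s.
  by rewrite p_range.
have p_finite s : ~ linf (p s) by apply: linf_generic; exact/ltnW/p_mult.
pose e : rel 'I_k := fun s t => [exists i, (p s \in L i) && (p t \in L i)].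
have conn_sym : connect_sym e.
  apply: sym_connect_sym => s t.
  by apply/existsP/existsP => -[i /andP[? ?]]; exists i; apply/andP.
pose rt := fingraph.root e.
have equivE s t : point_equiv L p s t = (rt s == rt t) by rewrite (root_connect conn_sym).
have [l0 l0P] := choice collinear.
(* Taking the line attached to the root of the component makes [l] constant on each class, so chosen
   lines and classes correspond one to one. *)
pose l s := l0 (rt s).
have l_equiv s t : point_equiv L p s t -> L (l s) (p t).
  move=> st; apply: l0P; have rs : point_equiv L p s (rt s) by exact: connect_root.
  move: st rs; rewrite !equivE => /eqP <- /eqP <-; exact: eqxx.
have l_on s : L (l s) (p s) by apply: l_equiv; rewrite equivE.
have same_line s t i : L i (p s) -> L i (p t) -> point_equiv L p s t.
  by move=> is_ it; apply: connect1; apply/existsP; exists i; rewrite !mem_set.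
have lE s t : l s = l t <-> point_equiv L p s t.
  split=> [lst|]; last by rewrite equivE /l => /eqP ->.
  by apply: (same_line _ _ (l s)) => //; rewrite lst.
(* A second multiple point on [i] is equivalent to [p s], hence also on [l s]; the distinct lines
   [i] and [l s] would then meet twice. *)
have pencil s t i : L i (p s) -> i != l s -> t != s -> ~ L i (p t).
  move=> is_ il ts it; have st := same_line _ _ _ is_ it.
  move/negP: ts; apply; apply/eqP/p_inj.
  rewrite -(fK _ (p_finite s)) -(fK _ (p_finite t)); congr g.
  have := forms_meet_once (nonparallel _ _ il) ((onL _ _ (p_finite t)).1 it)
    ((onL _ _ (p_finite t)).1 (l_equiv _ _ st)) ((onL _ _ (p_finite s)).1 is_)
    ((onL _ _ (p_finite s)).1 (l_on s)).
  by case: (f (p s)) (f (p t)) => ? ? [].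
pose through s : {set 'I_n} := [set i | p s \in L i]%SET.
have throughP s i : reflect (L i (p s)) (i \in through s).
  by rewrite inE; apply: (iffP idP) => [/set_mem|/mem_set].
have card_through s : #|through s :\ l s| = (m s - 1)%N.
  have -> : m s = #|through s|.
    by rewrite m_mult /multiplicity; apply: eq_card => i; rewrite [RHS]inE.
  by rewrite (cardsD1 (l s) (through s)) (_ : l s \in _) ?addKn //; exact/throughP.
have m_gt0 s : (0 < m s)%N by rewrite m_mult; have := p_mult s; apply: leq_trans.
have cardn : n = (\sum_s #|through s :\ l s| + (#|[set l s | s : 'I_k]%SET| +
    #|[set i | [forall s, i \notin through s]]%SET|))%N.
  rewrite -[LHS]card_ord; apply: card_lines => [s|s t i /throughP is_ il ts].
    exact/throughP.
  by apply/throughP; exact: (pencil s t i is_ il ts).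
have classesE : #|equivalence_partition (point_equiv L p) finset.setT| = #|[set l s | s : 'I_k]%SET|.
  rewrite -(card_imset_same_kernel (f := fun s => [set t in finset.setT | point_equiv L p s t]%SET)).
    by apply: eq_card => B; apply/imsetP/imsetP => -[s _ ->]; exists s.
  move=> s t; rewrite lE; split=> [/setP/(_ t)|st].
    by rewrite !inE [X in _ = X]equivE eqxx.
  by apply/setP => r; rewrite !inE !equivE; move: st; rewrite equivE => /eqP ->.
have simpleE : #|[pred i | `[< only_simple_points L i >]]| =
    #|[set i | [forall s, i \notin through s]]%SET|.
  apply: eq_card => i; rewrite [RHS]inE; apply/asboolP/forallP => [simple s|none P iP P2].
    apply/throughP => /simple/(_ (ltnW (p_mult s))) s2.
    by have := p_mult s; rewrite /multiple_point s2.
  apply/eqP; rewrite eqn_leq P2 andbT leqNgt; apply/negP => P3.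
  have : range p P by rewrite p_range.
  by move=> [s _ sP]; have /throughP[] := none s; rewrite sP.
have sumE : (\sum_(s < k) (m s - 1) = \sum_s #|through s :\ l s|)%N.
  by apply: eq_bigr => s _; rewrite card_through.
(* In the integers the sum counts the removed lines, each [m s] being positive; the two other terms
   of [cardn] remain. *)
split; last first.
  rewrite classesE simpleE {1}cardn.
  have -> : \sum_(s < k) ((m s)%:Z - 1) = (\sum_s #|through s :\ l s|)%N%:Z.
    rewrite (big_morph Posz PoszD (erefl _)); apply: eq_bigr => s _.
    by rewrite card_through subzn.
  by rewrite PoszD addrC addKr.
(* The truncated subtraction is exact, since by [cardn] the sum is at most [n]. *)
have NE : (n - \sum_(s < k) (m s - 1) = #|[set l s | s : 'I_k]%SET| +
    #|[set i | [forall s, i \notin through s]]%SET|)%N by rewrite sumE {1}cardn addKn.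
have cplE z : affine_complement L linf z -> ~ linf z /\ arrangement_complement al be ga finset.setT (f z).
  move=> [zf zL]; split=> // i _; apply/eqP => /(onL _ _ zf) iz; apply: zL; exists i => //.
have [] := @pi1_homeomorphic_sets R _ _ _ (arrangement_complement al be ga finset.setT) f g u0.
- by move=> z /cplE[].
- move=> z Sz; split; first exact: g_finite.
  move=> [i _] /(onL _ _ (g_finite z)); rewrite gK; apply/eqP; exact: Sz.
- by move=> z /cplE[zf _]; exact: fK.
- by move=> z _; exact: gK.
- by move=> z /cplE[zf _]; exact: cf.
- by move=> z _; exact: cg.
move=> x u0x; apply: (group_isomorphic_trans u0x); rewrite NE.
have QE s : finset.setT :&: [set i | (form al be ga i (f (p s)) == 0) && (i != l s)]%SET = through s :\ l s.
  apply/setP => i; rewrite !inE andTb andbC; congr (_ && _).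
  by apply/eqP/idP => [/(onL _ _ (p_finite s))/mem_set|/set_mem/(onL _ _ (p_finite s))].
have -> : (fun s => free_group (m s - 1) : groupType) = fun s => free_group
   #|finset.setT :&: [set i | (form al be ga i (f (p s)) == 0) && (i != l s)]%SET|.
  by apply/funext => s; rewrite QE card_through.
apply: (pi1_collinear_arrangement nonparallel nonconstant).
- by move=> s; split; [rewrite inE|exact/onL].
- move=> s t i _ ts /onL is_ il; apply/eqP => /onL it.
  by apply: (pencil s t i (is_ _) il ts); [exact: p_finite|exact: it].
- move=> i j h z _ _ _ iz jz hz ij ih jh.
  have onz r : form al be ga r z = 0 -> L r (g z) by move=> rz; apply/(onL _ _ (g_finite z)); rewrite gK.
  suff : range p (g z) by move=> [s _ sz]; exists s; rewrite sz gK.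
  rewrite p_range /= /multiple_point /multiplicity; apply/card_gt2P.
  by exists i, j, h; split; split => //; rewrite ?unfold_in /=; do ?exact/mem_set/onz; rewrite // eq_sym.
- by rewrite cardsT card_ord [LHS]cardn; congr (_ + _)%N; apply: eq_bigr => s _; rewrite QE.
Qed.
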